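(* For every integer $n\ge 3$ there exists a maximal planar graph $G$ on $n$ vertices such that $psr(G)\ge \frac{\frac32 n-3}{3n-6}=\frac12$, where $psr(G)$ is the plane-saturation ratio of $G$.
   Context: All graphs are finite and simple. A plane graph is a planar graph together with a specific plane embedding: vertices are mapped to distinct points of $\mathbb{R}^2$ and edges to simple topological curves joining their endpoints, where no two curves intersect, overlap or touch except possibly at common endpoints. A maximal planar graph on $n\ge 3$ vertices is a planar graph to which no edge can be added while keeping it simple and planar; it has $3n-6$ edges. Let $e(\cdot)$ denote the number of edges. Plane-saturated subgraph (unlabeled): a plane graph $H$ is a plane-saturated subgraph of $G$ if $H$ is (isomorphic to) a subgraph of $G$ with the same number of vertices as $G$, and adding any edge (between two non-adjacent vertices of $H$) to the drawing of $H$ either introduces a crossing or results in a graph that is no longer (isomorphic to) a subgraph of $G$. The embedding of $H$ is arbitrary and need not extend to an embedding of $G$. The plane-saturation ratio is $psr(G)=\min\{\frac{e(H)}{e(G)} : H \text{ is a plane-saturated subgraph of } G\}$. *)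

(* Defs.v *)
From HB Require Import structures.
From mathcomp Require Import all_boot all_order all_algebra.
From mathcomp Require Import all_classical all_reals all_analysis.

Set Implicit Arguments.
Unset Strict Implicit.
Unset Printing Implicit Defensive.

Import Order.TTheory GRing.Theory Num.Theory.
Import numFieldNormedType.Exports.

Local Open Scope classical_set_scope.
Local Open Scope ring_scope.

Record sgraph (V : finType) := SGraph {
  edges : {set {set V}};
  card_edge : forall e, e \in edges -> #|e| = 2%N }.

Definition num_edges (V : finType) (G : sgraph V) : nat := #|edges G|.

Definition adds_edge (V : finType) (G : sgraph V) (e : {set V})
    (G' : sgraph V) : Prop :=
  e \notin edges G /\ edges G' = (e |: edges G)%SET.

Definition iso_to_subgraph (W V : finType) (H : sgraph W) (G : sgraph V) :
    Prop :=
  exists f : W -> V,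
    injective f /\ forall e, e \in edges H -> (f @: e)%SET \in edges G.

(* Only the values of [edge_curve e] on [0, 1], for [e] an edge of the graph
   being drawn, are meaningful. *)
Record drawing (R : realType) (V : finType) := Drawing {
  vertex_pos : V -> R * R;
  edge_curve : {set V} -> R -> R * R }.

Definition curve_image (R : realType) (V : finType) (D : drawing R V)
    (e : {set V}) : set (R * R) :=
  edge_curve D e @` `[0, 1].

(* The curve of an edge joins its ends in an arbitrary direction.  The clause
   [plane_vertex] excludes curves running through a vertex that is not one of
   their ends; for an isolated vertex this is not a condition on two curves. *)
Record plane (R : realType) (V : finType) (G : sgraph V) (D : drawing R V) :
    Prop := Plane {
  plane_pos : injective (vertex_pos D);
  plane_continuous : forall e, e \in edges G ->
    {within `[0, 1], continuous (edge_curve D e)};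
  plane_simple : forall e, e \in edges G ->
    {in `[0, 1] &, injective (edge_curve D e)};
  plane_ends : forall e, e \in edges G ->
    [set edge_curve D e 0; edge_curve D e 1] = vertex_pos D @` [set` e];
  plane_vertex : forall e v, e \in edges G ->
    curve_image D e (vertex_pos D v) -> v \in e;
  plane_disjoint : forall e f, e \in edges G -> f \in edges G -> e != f ->
    curve_image D e `&` curve_image D f `<=`
      vertex_pos D @` [set` (e :&: f)%SET] }.

Definition planar (R : realType) (V : finType) (G : sgraph V) : Prop :=
  exists D : drawing R V, plane G D.

Definition maximal_planar (R : realType) (V : finType) (G : sgraph V) : Prop :=
  planar R G /\
  forall (e : {set V}) (G' : sgraph V), adds_edge G e G' -> ~ planar R G'.

Definition extends (R : realType) (V : finType) (G : sgraph V)
    (D D' : drawing R V) : Prop :=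
  vertex_pos D' =1 vertex_pos D /\
  forall e, e \in edges G -> {in `[0, 1], edge_curve D' e =1 edge_curve D e}.

(* A new edge introduces no crossing exactly when some curve for it extends
   [D] to a plane drawing of the larger graph. *)
Definition plane_saturated (R : realType) (W V : finType) (H : sgraph W)
    (D : drawing R W) (G : sgraph V) : Prop :=
  [/\ plane H D,
      #|W| = #|V|,
      iso_to_subgraph H G &
      forall (e : {set W}) (H' : sgraph W) (D' : drawing R W),
        adds_edge H e H' -> extends H D D' -> plane H' D' ->
        ~ iso_to_subgraph H' G].

Definition saturation_ratios (R : realType) (V : finType) (G : sgraph V) :
    set R :=
  [set r | exists (W : finType) (H : sgraph W) (D : drawing R W),
     plane_saturated H D G /\ r = (num_edges H)%:R / (num_edges G)%:R].

(* The least element of [A]; by convention 0 if there is none. *)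
Definition set_min (R : realType) (A : set R) : R :=
  xget 0 [set r | A r /\ lbound A r].

Definition psr (R : realType) (V : finType) (G : sgraph V) : R :=
  set_min (saturation_ratios G).

(* Main.v *)
(** In the graph formed by a path and two adjacent vertices (the hubs, labelled 0
    and 1) joined to everything, let [H] be a plane-saturated subgraph.  A vertex
    that shares a face with a hub is adjacent to that hub.  Every face has a hub on
    its boundary, since the path edges form a forest and a forest does not separate
    the plane; so every other vertex is adjacent to a hub.  The only vertices that
    contribute too little to the edge count are the leaves.  A vertex on the face
    of a leaf is the hub of the leaf or has both its path edges, as otherwise the
    leaf could be joined to it after relabelling the path; and the face of a leaf
    avoids the other hub.  So the leaves at a hub lie in distinct components of the
    complement of a forest with a star, which meet in the neighbours [U] of the hub
    having both path edges; there are at most [#|U|] such leaves, and these pay for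
    them.

    Edges are arbitrary arcs, so planar separation is obtained from Eilenberg's
    criterion: a combination of angles [x - z_i] with a continuous real lift on a
    compact set [X] has coefficient zero at a point that is alone in a bounded
    component of the complement of [X].  If [X] and [Y] meet in [m] points, linear
    algebra over the integers on the discrepancies of the lifts shows that adding
    [X] to [Y] cuts a component into at most [m] pieces.  This bounds the number of
    components near a vertex, whence the vertices on the boundary of a face are
    accessible by arcs, and it bounds the number of faces of leaves.  Maximality of
    the graph is the van Kampen parity argument for a subdivided [K_5]. *)

Require Import Defs.
From HB Require Import structures.
From mathcomp Require Import all_boot all_order all_algebra.
From mathcomp Require Import all_classical all_reals all_analysis.
From mathcomp Require Import ring lra zify.

Set Implicit Arguments.
Unset Strict Implicit.
Unset Printing Implicit Defensive.

Import Order.TTheory GRing.Theory Num.Theory.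
Import numFieldNormedType.Exports.

Local Open Scope classical_set_scope.
Local Open Scope ring_scope.

(** * Functions modulo 1 and their lifts *)

(** The factor 3/2 is a local count. Give each of the [n - 2] path vertices twice the number of its
    hub edges plus the number of its path edges; the total is at most [2 e(H)], because a path edge
    is counted at both ends. Being joined to a hub, a vertex receives at least 3 unless it is a leaf
    (one hub edge, no path edge), which receives 2. A vertex with both path edges receives at least
    one unit beyond 3 for each hub adjacent to it, and the leaves consume this surplus.

    The obstacle is that [H] is far from a forest: its cycles through the hubs do separate the
    plane. Only the boundary of the faces under study may be used, and the edges at its vertices may
    still run to a hub that those faces do not touch. Every edge is therefore cut short of each end
    outside the closure of the faces. This loses no boundary point and opens every cycle through an
    untouched hub, so that the remaining arcs form an acyclic set, or two acyclic sets meeting in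
    few points. *)

Section ModContinuity.
Variable R : realType.
Implicit Types (V W : normedModType R) (d e : R).

Lemma continuous_atP V W (f : V -> W) (x : V) :
  {for x, continuous f} <->
  forall e, 0 < e -> exists2 d : R, 0 < d &
    forall y, `|y - x| < d -> `|f y - f x| < e.
Proof.
split=> [/cvgrPdist_lt cf e e0|cf].
  have /nbhs_ballP [d /= d0 H] := cf _ e0.
  exists d => // y yx; rewrite distrC; apply: H.
  by rewrite -ball_normE /= distrC.
apply/cvgrPdist_lt => e e0; have [d d0 H] := cf _ e0.
apply/nbhs_ballP; exists d => //= y; rewrite -ball_normE /= distrC => /H.
by rewrite distrC.
Qed.

Definition modeq (x y : R) := x - y \is a Num.int.

Lemma modeq_refl x : modeq x x.
Proof. by rewrite /modeq subrr. Qed.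

Lemma modeq_sym x y : modeq x y -> modeq y x.
Proof. by rewrite /modeq -rpredN opprB. Qed.

Lemma modeq_trans y x z : modeq x y -> modeq y z -> modeq x z.
Proof. by move=> xy yz; rewrite /modeq -(subrKA y) rpredD. Qed.

Lemma modeqD x y x' y' : modeq x y -> modeq x' y' -> modeq (x + x') (y + y').
Proof. by move=> xy xy'; rewrite /modeq opprD addrACA rpredD. Qed.

Lemma modeqN x y : modeq x y -> modeq (- x) (- y).
Proof. by move=> xy; rewrite /modeq -opprD rpredN. Qed.

Lemma modeqB x y x' y' : modeq x y -> modeq x' y' -> modeq (x - x') (y - y').
Proof. by move=> xy /modeqN; apply: modeqD. Qed.

Lemma modeqM (x y z : R) : z \is a Num.int -> modeq x y -> modeq (z * x) (z * y).
Proof. by move=> zi xy; rewrite /modeq -mulrBr rpredM. Qed.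

Lemma modeq_sum (I : Type) (s : seq I) (F G : I -> R) :
  (forall i, modeq (F i) (G i)) ->
  modeq (\sum_(i <- s) F i) (\sum_(i <- s) G i).
Proof. by move=> H; rewrite /modeq -sumrB; apply: rpred_sum => i _; apply: H. Qed.

Lemma int_lt1_eq0 (x : R) : x \is a Num.int -> `|x| < 1 -> x = 0.
Proof.
by move=> /intrP[k ->]; rewrite -intr_norm ltrz1 => k1; have -> : k = 0 by lia.
Qed.

(* The representative of [x] modulo 1 in [-1/2, 1/2[. *)
Definition frac0 (x : R) : R := x - (Num.floor (x + 2^-1))%:~R.

Lemma frac0_modeq x : modeq (frac0 x) x.
Proof. by rewrite /modeq /frac0 addrAC subrr sub0r rpredN intr_int. Qed.

Lemma frac0_bounds x : - 2^-1 <= frac0 x < 2^-1.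
Proof.
have := floor_itv (x + 2^-1); rewrite /frac0 intrD.
by move=> /andP[h1 h2]; apply/andP; split; lra.
Qed.

Lemma frac0_eq x e : modeq x e -> - 2^-1 < e < 2^-1 -> frac0 x = e.
Proof.
move=> xe /andP[e1 e2]; apply/eqP; rewrite -subr_eq0; apply/eqP.
have /andP[h1 h2] := frac0_bounds x.
apply: int_lt1_eq0; first exact: modeq_trans (frac0_modeq x) xe.
by rewrite ltr_norml; apply/andP; split; lra.
Qed.

(** Continuity at [x] of the induced map into R/Z; the integer [k] may vary with [y], so no branch
    is fixed. *)
Definition modcont V (a : V -> R) (x : V) :=
  forall e, 0 < e -> exists2 d : R, 0 < d &
    forall y, `|y - x| < d -> exists2 k, k \is a Num.int & `|a y - a x - k| < e.

Lemma continuous_modcont V (a : V -> R) x :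
  {for x, continuous a} -> modcont a x.
Proof.
move=> /continuous_atP ca e /ca[d d0 H]; exists d => // y /H h.
by exists 0; rewrite ?subr0.
Qed.

Lemma modcont_near V (a b : V -> R) x :
  (exists2 d : R, 0 < d & forall y, `|y - x| < d -> modeq (a y) (b y)) ->
  modcont b x -> modcont a x.
Proof.
move=> [d d0 H] cb e /cb[d' d'0 H']; exists (Num.min d d').
  by rewrite lt_min d0.
move=> y; rewrite lt_min => /andP[/H hd /H'[k ki hk]].
exists (k + ((a y - b y) - (a x - b x))).
  by apply: rpredD => //; apply: rpredB => //; apply: H; rewrite subrr normr0.
by apply: le_lt_trans hk; rewrite le_eqVlt; apply/orP; left; apply/eqP; congr `|_|; ring.
Qed.

Lemma modcont_eq V (a b : V -> R) x :
  (forall y, modeq (a y) (b y)) -> modcont b x -> modcont a x.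
Proof. by move=> H; apply: modcont_near; exists 1. Qed.

Lemma modcontD V (a b : V -> R) x :
  modcont a x -> modcont b x -> modcont (fun y => a y + b y) x.
Proof.
move=> ca cb e e0; have e20 : 0 < e / 2 by lra.
have [d d0 H] := ca _ e20; have [d' d'0 H'] := cb _ e20.
exists (Num.min d d'); first by rewrite lt_min d0.
move=> y; rewrite lt_min => /andP[/H[k ki hk] /H'[k' k'i hk']].
exists (k + k'); first by rewrite rpredD.
have -> : a y + b y - (a x + b x) - (k + k')
  = (a y - a x - k) + (b y - b x - k') by ring.
by rewrite (le_lt_trans (ler_normD _ _))//; lra.
Qed.

Lemma modcontN V (a : V -> R) x : modcont a x -> modcont (fun y => - a y) x.
Proof.
move=> ca e /ca[d d0 H]; exists d => // y /H[k ki hk].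
exists (- k); first by rewrite rpredN.
by rewrite -normrN; congr (`|_| < _): hk; ring.
Qed.

Lemma modcont0 V (x : V) : modcont (fun=> 0) x.
Proof. by move=> e e0; exists 1 => // y _; exists 0 => //; rewrite !subr0 normr0. Qed.

Lemma modcontMn V (a : V -> R) x n : modcont a x -> modcont (fun y => n%:R * a y) x.
Proof.
move=> ca; elim: n => [|n IH].
  apply: modcont_eq (@modcont0 _ x) => y; rewrite mul0r; exact: modeq_refl.
apply: modcont_eq (modcontD ca IH) => y.
by rewrite -natr1 mulrDl mul1r addrC; exact: modeq_refl.
Qed.

(** Multiplication descends to R/Z for integer factors only, which is why the combinations of angles
    below have integer coefficients. *)
Lemma modcontMz V (a : V -> R) x (k : int) :
  modcont a x -> modcont (fun y => k%:~R * a y) x.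
Proof.
move=> ca; case: k => n; first exact: modcontMn.
apply: modcont_eq (modcontN (modcontMn n.+1 ca)) => y.
by rewrite NegzE mulrNz mulNr; exact: modeq_refl.
Qed.

Lemma modcont_comp V W (a : W -> R) (f : V -> W) x :
  {for x, continuous f} -> modcont a (f x) -> modcont (a \o f) x.
Proof.
move=> /continuous_atP cf ca e /ca[d /cf[d' d'0 H] H'].
by exists d' => // y /H /H'.
Qed.

(** [frac0] jumps only where its value is -1/2, so it gives a continuous branch wherever that value
    is avoided. *)
Lemma continuous_frac0 V (a : V -> R) x :
  modcont a x -> - 2^-1 < frac0 (a x) -> {for x, continuous (fun y => frac0 (a y))}.
Proof.
move=> ca lx; apply/continuous_atP => e e0.
have /andP[_ ux] := frac0_bounds (a x).
pose m := Num.min e (Num.min (frac0 (a x) + 2^-1) (2^-1 - frac0 (a x))).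
have m0 : 0 < m by rewrite !lt_min e0 /=; apply/andP; split; lra.
have [d d0 H] := ca _ m0; exists d => // y /H[k ki].
rewrite !lt_min => /and3P[he].
rewrite !ltr_norml => /andP[h1 h2] /andP[h3 h4].
have -> : frac0 (a y) = frac0 (a x) + (a y - a x - k).
  apply: frac0_eq; last by apply/andP; split; lra.
  rewrite /modeq (_ : _ - _ = k - (frac0 (a x) - a x)); last by ring.
  by apply: rpredB => //; exact: frac0_modeq.
by rewrite -ltr_norml (_ : _ - _ = a y - a x - k) //; ring.
Qed.

End ModContinuity.

(** * Lifting functions modulo 1 to real functions *)

Section Lifting.
Variable R : realType.
Implicit Types (V W : normedModType R) (d e : R).

(** The retraction of the line onto [a, b], used to extend maps that matter only on an interval to
    total continuous maps. *)
Definition clamp (a b x : R) : R := Num.max a (Num.min b x).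

Lemma clamp_continuous a b : continuous (clamp a b).
Proof.
move=> x; apply: continuous_max; first exact: cvg_cst.
by apply: continuous_min; [exact: cvg_cst|exact: cvg_id].
Qed.

Lemma clamp_itv a b x : a <= b -> clamp a b x \in `[a, b].
Proof.
by move=> ab; rewrite in_itv /= /clamp le_max lexx ge_max ab ge_min lexx.
Qed.

Lemma clamp_id a b x : x \in `[a, b] -> clamp a b x = x.
Proof. by rewrite in_itv /= => /andP[ax xb]; rewrite /clamp min_r// max_r. Qed.

Lemma compact_closed_norm V (K : set V) : compact K -> closed K.
Proof. by apply: compact_closed; exact: norm_hausdorff. Qed.

Lemma compact_norm_bound V (K : set V) : compact K ->
  exists2 M : R, 0 < M & forall x, K x -> `|x| < M.
Proof.
move=> /compact_bounded [M [Mr HM]]; exists (`|M| + 2).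
  by rewrite ltr_wpDl.
move=> x /(HM (`|M| + 1)) h; apply: le_lt_trans (h _) _.
  by rewrite (le_lt_trans (ler_norm M))// ltrDl.
by rewrite ltrD2l; lra.
Qed.

(** Heine-Cantor modulo 1. Only the base point [x] lies in [K]; the point [y] near it is
    arbitrary. *)
Lemma modcont_unif V (a : V -> R) (K : set V) : compact K ->
  (forall x, K x -> modcont a x) -> forall e, 0 < e ->
  exists2 d : R, 0 < d & forall x y, K x -> `|y - x| < d ->
    exists2 k, k \is a Num.int & `|a y - a x - k| < e.
Proof.
move=> /compact_near_coveringP cK ca e e0.
pose P d x := forall y, `|y - x| < d ->
    exists2 k, k \is a Num.int & `|a y - a x - k| < e.
have := cK R (0^'+) P _ _; case=> [|d /= d0 H].
  move=> x Kx; have e20 : 0 < e / 2 by lra.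
  have [d d0 H] := ca x Kx _ e20; have d20 : 0 < d / 2 by lra.
  exists ([set y | `|y - x| < d / 2], [set s | 0 < s < d / 2]) => /=.
    split; first by apply/nbhs_ballP; exists (d / 2) => //= y; rewrite -ball_normE /= distrC.
    exists (d / 2) => //= s; rewrite /ball /= sub0r normrN => h s0; rewrite s0 /=.
    by rewrite -(gtr0_norm s0).
  move=> [y s] /= [yx /andP[s0 sd]] z zy.
  have [|k ki hk] := H y; first by apply: lt_trans yx _; lra.
  have [|l li hl] := H z.
    rewrite -(subrKA y) (le_lt_trans (ler_normD _ _))//; lra.
  exists (l - k); first exact: rpredB.
  have -> : a z - a y - (l - k) = (a z - a x - l) - (a y - a x - k) by ring.
  by rewrite (le_lt_trans (ler_normB _ _))//; lra.
exists (d / 2); first lra.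
move=> x y Kx yx; apply: (H (d / 2) _ _ x) => //=; last lra.
by rewrite sub0r normrN gtr0_norm; lra.
Qed.

(** The value is carried from the origin to [x] along the ray: by uniform continuity each of [N]
    equal steps changes [a] by little modulo 1, and [frac0] of each change is continuous and can be
    added to the lift. *)
Lemma modcont_lift V (a : V -> R) (K : set V) : compact K ->
  (forall x t, K x -> 0 <= t <= 1 -> K (t *: x)) -> (forall x, modcont a x) ->
  exists2 th : V -> R, (forall x, K x -> {for x, continuous th}) &
    forall x, K x -> modeq (th x) (a x).
Proof.
move=> cK starK ca.
(* Changes below 1/4 keep [frac0] away from its jump at -1/2. *)
have e40 : 0 < (4^-1 : R) by lra.
have [d d0 Hd] := modcont_unif cK (fun x _ => ca x) e40.
have [M M0 HM] := compact_norm_bound cK.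
pose N := (Num.truncn (M / d)).+1.
have N0 : 0 < N%:R :> R by rewrite ltr0n.
have MN : M < d * N%:R.
  by rewrite mulrC -ltr_pdivrMr//; exact: truncnS_gt.
suff H k : (k <= N)%N -> exists2 th : V -> R,
    (forall x, K x -> {for x, continuous th}) &
    forall x, K x -> modeq (th x) (a ((k%:R / N%:R) *: x)).
  have [th c1 c2] := H N (leqnn _); exists th => // x Kx.
  by move: (c2 x Kx); rewrite divff ?scale1r// gt_eqF.
elim: k => [_|k IH kN].
  exists (fun=> a 0); first by move=> x _; exact: cvg_cst.
  by move=> x _; rewrite mul0r scale0r; exact: modeq_refl.
have [th c1 c2] := IH (ltnW kN).
pose b i (x : V) := a ((i%:R / N%:R) *: x).
exists (fun x => th x + frac0 (b k.+1 x - b k x)); last first.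
  move=> x Kx; rewrite -/(b k.+1 x).
  have {2}-> : b k.+1 x = b k x + (b k.+1 x - b k x) by ring.
  apply: modeqD; first exact: c2.
  by apply: modeq_trans (frac0_modeq _) _; exact: modeq_refl.
move=> x Kx; apply: cvgD; first exact: c1.
have cb i : modcont (b i) x.
  apply: modcont_comp => //; exact: scaler_continuous.
apply: (@continuous_frac0 _ _ (fun y => b k.+1 y - b k y)).
  by apply: modcontD => //; exact: modcontN.
have [||j ji hj] := Hd ((k%:R / N%:R) *: x) ((k.+1%:R / N%:R) *: x).
- apply: starK => //; rewrite divr_ge0//= ler_pdivrMr// mul1r ler_nat; exact: ltnW.
- rewrite -scalerBl -mulrBl -natrB// subSnn mul1r normrZ normfV (gtr0_norm N0).
  by rewrite mulrC ltr_pdivrMr// (lt_trans (HM _ Kx)).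
rewrite (@frac0_eq _ _ (b k.+1 x - b k x - j)).
- by move: hj; rewrite ltr_norml => /andP[h1 h2]; rewrite /b; lra.
- by rewrite /modeq opprB addrCA subrr addr0.
- by move: hj; rewrite ltr_norml /b => /andP[h1 h2]; apply/andP; split; lra.
Qed.

(** The lift is defined on the whole space; for compact [X] Tietze's theorem makes this no
    restriction. *)
Definition liftable V (X : set V) (a : V -> R) :=
  exists2 th : V -> R, continuous th & forall x, X x -> modeq (th x) (a x).

Lemma compact_extension V (X : set V) (f : V -> R) : compact X ->
  {within X, continuous f} ->
  exists2 g : V -> R, continuous g & forall x, X x -> g x = f x.
Proof.
move=> cX cf; have [M M0 HM] := compact_norm_bound (continuous_compact cf cX).
have [|g [fg cg _]] := continuous_bounded_extension
  (@pseudometric_normal R V) (compact_closed_norm cX) M0 cf.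
  by move=> x Xx; apply/ltW/HM; exists x.
by exists g => // x Xx; rewrite fg// inE.
Qed.

Lemma liftable_glue V (X Y : set V) (a f g : V -> R) :
  compact X -> compact Y -> continuous f -> continuous g ->
  (forall x, X x -> modeq (f x) (a x)) -> (forall x, Y x -> modeq (g x) (a x)) ->
  (forall x, X x -> Y x -> f x = g x) -> liftable (X `|` Y) a.
Proof.
move=> cX cY cf cg fa ga fg.
pose h x := if pselect (X x) then f x else g x.
have [|k ck kh] := @compact_extension V (X `|` Y) h (compactU cX cY).
  apply: withinU_continuous; try exact: compact_closed_norm.
    apply: subspace_eq_continuous (continuous_subspaceT cf) => x.
    by rewrite inE /from_subspace /h; case: pselect.
  apply: subspace_eq_continuous (continuous_subspaceT cg) => x.
  by rewrite inE /from_subspace /h; case: pselect => // Xx Yx; rewrite fg.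
exists k => // x XYx; rewrite kh// /h; case: pselect => [|nX]; first exact: fa.
by case: XYx => // Yx; exact: ga.
Qed.

(** On the parameter interval every continuous function modulo 1 has a lift; composing it with the
    inverse parametrization, which is continuous by compactness, lifts [a] on the arc. *)
Lemma liftable_curve V (a : V -> R) (g : R -> V) (s t : R) : continuous g ->
  {in `[s, t] &, injective g} -> (forall u, u \in `[s, t] -> modcont a (g u)) ->
  liftable (g @` `[s, t]) a.
Proof.
move=> cg ig ca.
case: (leP s t) => st; last first.
  exists (fun=> 0) => [|x [u /=]]; first by move=> x; exact: cvg_cst.
  by rewrite in_itv /= => /andP[] su ut; have := le_trans su ut; rewrite leNgt st.
pose M := `|s| + `|t|.
have [||th cth Hth] := @modcont_lift R (a \o g \o clamp s t) _ (@segment_compact R (-M) M).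
- move=> x u /=; rewrite !in_itv /= -!ler_norml normrM => xM /andP[u0 u1].
  by rewrite ger0_norm// (le_trans _ xM)// ler_piMl.
- move=> x; apply: modcont_comp; first exact: clamp_continuous.
  by apply: modcont_comp; [exact: cg | apply: ca; exact: clamp_itv].
have stM u : u \in `[s, t] -> u \in `[-M, M].
  rewrite !in_itv /= -ler_norml => /andP[su ut]; rewrite /M ler_norml; apply/andP; split.
    by have := ler_norm (- s); rewrite normrN; have := normr_ge0 t; lra.
  by have := ler_norm t; have := normr_ge0 s; lra.
pose ph := th \o clamp s t.
have cph : continuous ph.
  move=> x; apply: continuous_comp; first exact: clamp_continuous.
  by apply: cth; apply: stM; exact: clamp_itv.
pose gi x := xget s [set u | u \in `[s, t] /\ g u = x].
have giK u : u \in `[s, t] -> gi (g u) = u.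
  move=> ust; rewrite /gi; case: xgetP => [v _ [vst gvu]|/(_ u)]; first exact: ig.
  by case.
have [||k ck kh] := @compact_extension V (g @` `[s, t]) (ph \o gi).
- by apply: continuous_compact; [exact: continuous_subspaceT | exact: segment_compact].
- apply/continuous_closedP => C cC; apply/closed_subspaceP.
  exists (g @` (`[s, t]%classic `&` ph @^-1` C)).
    apply: compact_closed_norm; apply: continuous_compact.
      exact: continuous_subspaceT.
    apply: compact_closedI; first exact: segment_compact.
    by apply: closed_comp => // x _; exact: cph.
  apply/seteqP; split=> x [].
    by move=> [u [ust /= Cu] <-] _; split; [change (C (ph (gi (g u)))); rewrite giK | exists u].
  by move=> /= Cx [u ust ux]; split; exists u => //; split => //; rewrite /= -(giK u)// ux.
exists k => // x gx; rewrite kh//; case: gx => u ust <- /=.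
rewrite giK// /ph /= clamp_id//; apply: modeq_trans (Hth _ (stM _ ust)) _.
by rewrite /= clamp_id//; exact: modeq_refl.
Qed.

End Lifting.

(** * The angle of a plane vector *)

Section Angle.
Variable R : realType.
Local Notation pt := (R * R)%type.
Implicit Types (p q x y z : pt) (t : R).

(* A piecewise rational substitute for the argument of [p], counted in turns:
   the position of the direction of [p] along the unit circle of the 1-norm. *)
Definition cosd p : R := p.1 / (`|p.1| + `|p.2|).

Definition angle p : R := if 0 <= p.2 then (1 - cosd p) / 4 else - ((1 - cosd p) / 4).

Lemma norm1_gt0 p : p != 0 -> 0 < `|p.1| + `|p.2|.
Proof.
case: p => a b /= ab; rewrite lt_def addr_ge0// andbT paddr_eq0// !normr_eq0.
by apply: contraNN ab => /andP[/eqP-> /eqP->].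
Qed.

Lemma cosd_continuous p : p != 0 -> {for p, continuous cosd}.
Proof.
move=> p0; rewrite /cosd /prop_for /continuous_at; apply: cvgM; first exact: cvg_fst.
apply: cvgV; first by rewrite gt_eqF// norm1_gt0.
by apply: cvgD; apply: cvg_norm; [exact: cvg_fst|exact: cvg_snd].
Qed.

(** The two formulas agree on the positive horizontal axis and differ by 1, a full turn, on the
    negative one. *)
Lemma angle_modcont p : p != 0 -> modcont angle p.
Proof.
move=> p0; have /continuous_atP cs := cosd_continuous p0.
have cp2 : {for p, continuous (snd : pt -> R)} by exact: cvg_snd.
have [p2|p2|p2] := ltgtP 0 p.2.
- apply: (@modcont_near _ _ _ (fun q => 4^-1 * (1 - cosd q))).
    move/continuous_atP: cp2 => /(_ _ p2)[d d0 H]; exists d => // q /H.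
    rewrite ltr_norml => /andP[h _]; rewrite /angle ifT; last lra.
    by rewrite mulrC; exact: modeq_refl.
  apply: continuous_modcont; apply: cvgM; [exact: cvg_cst|]; apply: cvgB; first exact: cvg_cst.
  exact: cosd_continuous.
- apply: (@modcont_near _ _ _ (fun q => - 4^-1 * (1 - cosd q))).
    have np2 : 0 < - p.2 by lra.
    move/continuous_atP: cp2 => /(_ _ np2)[d d0 H]; exists d => // q /H.
    rewrite ltr_norml => /andP[_ h]; rewrite /angle ifF; last by apply/negbTE; rewrite -ltNge; lra.
    by rewrite mulNr mulrC; exact: modeq_refl.
  apply: continuous_modcont; apply: cvgM; [exact: cvg_cst|]; apply: cvgB; first exact: cvg_cst.
  exact: cosd_continuous.
have p1 : p.1 != 0.
  by apply: contraNN p0 => /eqP h; case: (p) h p2 => a b /= -> <-.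
have : cosd p = 1 \/ cosd p = -1.
  rewrite /cosd -p2 normr0 addr0; have [h|h|h] := ltgtP 0 p.1.
  - by left; rewrite gtr0_norm// divff.
  - by right; rewrite ltr0_norm// invrN mulrN divff.
  - by rewrite -h eqxx in p1.
move=> hp e e0; have [d d0 H] := cs _ e0; exists d => // q /H.
rewrite [angle p]/angle -p2 lexx; case: hp => ->; rewrite ltr_norml => /andP[h1 h2].
  exists 0 => //; rewrite subrr /angle; case: ifP => _; rewrite ltr_norml; apply/andP; split; lra.
rewrite /angle; case: ifP => _; [exists 0 => //|exists (-1); first by rewrite rpredN rpred1];
  rewrite ltr_norml; apply/andP; split; lra.
Qed.

Lemma cosdN p : cosd (- p) = - cosd p.
Proof. by rewrite /cosd /= !normrN mulNr. Qed.

Lemma angleN p : p != 0 -> modeq (angle (- p)) (angle p + 2^-1).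
Proof.
move=> p0; rewrite /angle cosdN /=.
have [p2|p2|p2] := ltgtP 0 p.2.
- rewrite ifF; last by apply/negbTE; rewrite -ltNge; lra.
  rewrite /modeq (_ : _ - _ = -1); first by rewrite rpredN rpred1.
  by lra.
- rewrite ifT; last by lra.
  rewrite /modeq (_ : _ - _ = 0) //; lra.
have p1 : p.1 != 0.
  by apply: contraNN p0 => /eqP h; case: (p) h p2 => a b /= -> <-.
rewrite ifT; last by lra.
have : cosd p = 1 \/ cosd p = -1.
  rewrite /cosd -p2 normr0 addr0; have [h|h|h] := ltgtP 0 p.1.
  - by left; rewrite gtr0_norm// divff.
  - by right; rewrite ltr0_norm// invrN mulrN divff.
  - by rewrite -h eqxx in p1.
case=> ->; rewrite /modeq; [rewrite (_ : _ - _ = 0) //|rewrite (_ : _ - _ = -1) ?rpredN ?rpred1 //]; lra.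
Qed.

Lemma cosd_le1 p : -1 <= cosd p <= 1.
Proof.
have [->|p0] := eqVneq p 0; first by rewrite /cosd /= mul0r; apply/andP; split; lra.
rewrite -ler_norml /cosd normrM normfV (ger0_norm (ltW (norm1_gt0 p0))).
by rewrite ler_pdivrMr ?norm1_gt0// mul1r lerDl.
Qed.

(** For the 1-norm, the unit vector along [p] has first coordinate [cosd p] and a second coordinate
    of absolute value [1 - |cosd p|]; the angle fixes the first and the sign of the second. *)
Lemma angle_direction p q : p != 0 -> q != 0 -> modeq (angle p) (angle q) ->
  exists2 c : R, 0 < c & p = c *: q.
Proof.
move=> p0 q0 pq.
have np := norm1_gt0 p0; have nq := norm1_gt0 q0.
have /andP[sp1 sp2] := cosd_le1 p; have /andP[sq1 sq2] := cosd_le1 q.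
have sy u : u != 0 -> 0 <= u.2 -> u.2 = (`|u.1| + `|u.2|) * (1 - `|cosd u|).
  move=> u0 u2; have nu := norm1_gt0 u0.
  rewrite /cosd normrM normfV (ger0_norm (ltW nu)) mulrBr mulr1 mulrCA divff ?mulr1 ?gt_eqF//.
  by rewrite (ger0_norm u2); lra.
have sy' u : u != 0 -> u.2 < 0 -> u.2 = - ((`|u.1| + `|u.2|) * (1 - `|cosd u|)).
  move=> u0 u2; have nu := norm1_gt0 u0.
  rewrite /cosd normrM normfV (ger0_norm (ltW nu)) mulrBr mulr1 mulrCA divff ?mulr1 ?gt_eqF//.
  by rewrite (ltr0_norm u2); lra.
have sx u : u != 0 -> u.1 = (`|u.1| + `|u.2|) * cosd u.
  by move=> u0; rewrite /cosd mulrCA divff ?mulr1 ?gt_eqF ?norm1_gt0.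
have key : cosd p = cosd q /\ ((0 <= p.2) = (0 <= q.2) \/ (`|cosd p| = 1 /\ `|cosd q| = 1)).
  (* Angles lie in [-1/2, 1/2], so two of them differ by less than 1 unless both vectors have [cosd]
     equal to -1. *)
  have small : - 1 < angle p - angle q < 1 \/ (cosd p = -1 /\ cosd q = -1).
    rewrite /angle; case: ifP => _; case: ifP => _.
    - by left; apply/andP; split; lra.
    - have [h|h] := ltP (-1) (cosd p); first by left; apply/andP; split; lra.
      have [h'|h'] := ltP (-1) (cosd q); first by left; apply/andP; split; lra.
      by right; split; lra.
    - have [h|h] := ltP (-1) (cosd p); first by left; apply/andP; split; lra.
      have [h'|h'] := ltP (-1) (cosd q); first by left; apply/andP; split; lra.
      by right; split; lra.
    - by left; apply/andP; split; lra.
  case: small => [h|[-> ->]]; last by rewrite normrN normr1; split => //; right.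
  have := int_lt1_eq0 pq; rewrite ltr_norml h => /(_ isT).
  rewrite /angle; case: ifP => hp; case: ifP => hq e.
  - by split; [lra|left].
  - have e1 : cosd p = 1 by lra.
    have e2 : cosd q = 1 by lra.
    by rewrite e1 e2 normr1; split => //; right.
  - have e1 : cosd p = 1 by lra.
    have e2 : cosd q = 1 by lra.
    by rewrite e1 e2 normr1; split => //; right.
  - by split; [lra|left].
case: key => e hh; exists ((`|p.1| + `|p.2|) / (`|q.1| + `|q.2|)).
  exact: divr_gt0.
have eq1 : p.1 = (`|p.1| + `|p.2|) / (`|q.1| + `|q.2|) * q.1.
  by rewrite {1}sx// [X in _ = _ * X](sx q)// e [RHS]mulrA mulfVK// gt_eqF.
have eq2 : p.2 = (`|p.1| + `|p.2|) / (`|q.1| + `|q.2|) * q.2.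
  case: hh => [hh|[hp hq]].
    have [h|h] := leP 0 p.2.
      rewrite {1}sy// [X in _ = _ * X](sy q)// -?hh// e [RHS]mulrA mulfVK// gt_eqF//.
    have h' : q.2 < 0 by rewrite ltNge -hh -ltNge.
    by rewrite {1}sy'// [X in _ = _ * X](sy' q)// e mulrN [X in _ = - X]mulrA mulfVK// gt_eqF.
  have z u : u != 0 -> `|cosd u| = 1 -> u.2 = 0.
    move=> u0 h; have [h2|h2] := leP 0 u.2; [rewrite sy//|rewrite sy'//]; by rewrite h subrr mulr0 ?oppr0.
  by rewrite (z p)// (z q)// mulr0.
have E (u v : pt) : u.1 = v.1 -> u.2 = v.2 -> u = v by case: u v => ? ? [? ?] /= -> ->.
exact: E.
Qed.

End Angle.

(** * A loop that winds once around the origin *)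

Section SquareLoop.
Variable R : realType.
Local Notation pt := (R * R)%type.
Implicit Types (p q : pt) (t : R).

Lemma continuous_pair (V W1 W2 : normedModType R) (f : V -> W1) (g : V -> W2) (x : V) :
  {for x, continuous f} -> {for x, continuous g} ->
  {for x, continuous (fun y => (f y, g y))}.
Proof.
move=> /continuous_atP cf /continuous_atP cg; apply/continuous_atP => e e0.
have [d d0 H] := cf e e0; have [d' d'0 H'] := cg e e0.
exists (Num.min d d'); first by rewrite lt_min d0.
by move=> y; rewrite lt_min => /andP[/H h /H' h']; rewrite prod_normE /= gt_max h.
Qed.

(** The unit circle of the 1-norm, run through once counterclockwise from (1, 0) in such a way that
    [t] is the angle in turns. *)
Definition square_loop t : pt :=
  (`|4 * t - 2| - 1,
   Num.max 0 (1 - `|4 * t - 1|) - Num.max 0 (1 - `|4 * t - 3|)).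

Lemma square_loop_continuous : continuous square_loop.
Proof.
have aff c : continuous (fun t : R => `|4 * t - c|).
  by move=> t; apply: cvg_norm; apply: cvgB; [apply: cvgM; [exact: cvg_cst|]; exact: cvg_id|exact: cvg_cst].
move=> t; apply: (@continuous_pair R R R (fun t : R => `|4 * t - 2| - 1) (fun t : R => Num.max 0 (1 - `|4 * t - 1|) - Num.max 0 (1 - `|4 * t - 3|))); first by apply: cvgB; [exact: aff|exact: cvg_cst].
have mx c : continuous (fun t : R => Num.max 0 (1 - `|4 * t - c|)).
  move=> u; apply: (@continuous_max _ _ (fun=> 0) (fun t => 1 - `|4 * t - c|)).
    exact: cvg_cst.
  by apply: cvgB; [exact: cvg_cst|exact: aff].
by apply: cvgB; exact: mx.
Qed.

Lemma square_loop01 : square_loop 0 = square_loop 1.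
Proof.
rewrite /square_loop !mulr0 !mulr1 !sub0r !normrN.
rewrite !ger0_norm; [|lra ..].
by congr (_, _); [lra|rewrite !max_l; lra].
Qed.

Lemma square_loop_coord t : t \in `[0, 1] ->
  square_loop t = if t <= 2^-1 then (1 - 4 * t, 1 - `|1 - 4 * t|)
                  else (4 * t - 3, `|4 * t - 3| - 1).
Proof.
rewrite in_itv /= => /andP[t0 t1]; rewrite /square_loop; case: ifP => h.
  rewrite (ler0_norm (x := 4 * t - 2)); last lra.
  rewrite (ler0_norm (x := 4 * t - 3)); last lra.
  rewrite (max_l (x := 0) (y := 1 - - _)); last lra.
  rewrite (distrC 1) max_r; first by congr (_, _); lra.
  by rewrite subr_ge0 ler_norml; apply/andP; split; lra.
have {}h : 2^-1 < t by rewrite ltNge h.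
rewrite (ger0_norm (x := 4 * t - 2)); last lra.
rewrite (ger0_norm (x := 4 * t - 1)); last lra.
rewrite (max_l (x := 0) (y := 1 - (_ - _))); last lra.
rewrite max_r; first by congr (_, _); lra.
by rewrite subr_ge0 ler_norml; apply/andP; split; lra.
Qed.

Lemma square_loop_norm1 t : t \in `[0, 1] ->
  `|(square_loop t).1| + `|(square_loop t).2| = 1.
Proof.
move=> ht; rewrite square_loop_coord//; move: ht; rewrite in_itv /= => /andP[t0 t1].
case: leP => h /=.
  rewrite (ger0_norm (x := 1 - `|_|)); first lra.
  by rewrite subr_ge0 ler_norml; apply/andP; split; lra.
rewrite (ler0_norm (x := `|_| - 1)); first lra.
by rewrite subr_le0 ler_norml; apply/andP; split; lra.
Qed.

Lemma angle_square_loop t (r : R) : 0 < r -> t \in `[0, 1] ->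
  modeq (angle (r *: square_loop t)) t.
Proof.
move=> r0 ht; have n1 := square_loop_norm1 ht.
have cE : cosd (r *: square_loop t) = (square_loop t).1.
  rewrite /cosd /= !normrM -mulrDr n1 mulr1 (gtr0_norm r0) mulrAC divff ?mul1r//.
  by rewrite gt_eqF.
have -> : angle (r *: square_loop t) = if 0 <= (square_loop t).2
    then (1 - (square_loop t).1) / 4 else - ((1 - (square_loop t).1) / 4).
  by rewrite /angle cE /= pmulr_rge0.
rewrite square_loop_coord//; move: ht; rewrite in_itv /= => /andP[t0 t1].
case: (leP t 2^-1) => h /=.
  rewrite ifT; first by rewrite /modeq [X in X \is a _](_ : _ = 0)//; lra.
  by rewrite subr_ge0 ler_norml; apply/andP; split; lra.
have [->|t1'] := eqVneq t 1.
  rewrite ifT; last by rewrite ger0_norm; lra.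
  by rewrite /modeq [X in X \is a _](_ : _ = -1) ?rpredN ?rpred1//; lra.
have {t1 t1'}t1 : t < 1 by rewrite lt_neqAle t1'.
rewrite ifF; first by rewrite /modeq [X in X \is a _](_ : _ = -1) ?rpredN ?rpred1//; lra.
by apply/negbTE; rewrite -ltNge subr_lt0 ltr_norml; apply/andP; split; lra.
Qed.

Lemma square_loop_norm t : t \in `[0, 1] -> 2^-1 <= `|square_loop t| <= 1.
Proof.
move=> /square_loop_norm1; rewrite prod_normE /= le_max ge_max.
have := normr_ge0 (square_loop t).1; have := normr_ge0 (square_loop t).2.
move=> h1 h2 h3; apply/andP; split; last by apply/andP; split; lra.
by case: (leP (2^-1) `|(square_loop t).1|) => //= h; lra.
Qed.

Lemma int_valued_const (h : R -> R) : continuous h ->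
  (forall t, t \in `[0, 1] -> h t \is a Num.int) -> h 0 = h 1.
Proof.
move=> ch hi.
wlog h01 : h ch hi / h 0 < h 1.
  move=> H; have [h01|h01|//] := ltgtP (h 0) (h 1); first exact: H.
  apply: oppr_inj; apply: (H (fun t => - h t)); last by rewrite ltrN2.
    by move=> t; apply: cvgN; exact: ch.
  by move=> t /hi; rewrite rpredN.
have i0 : h 0 \is a Num.int by apply: hi; rewrite in_itv /=; apply/andP; split; lra.
have i1 : h 1 \is a Num.int by apply: hi; rewrite in_itv /=; apply/andP; split; lra.
have d1 : 1 <= h 1 - h 0.
  rewrite leNgt; apply/negP => lt1.
  have := int_lt1_eq0 (rpredB i1 i0); rewrite ger0_norm; last lra.
  by move=> /(_ lt1); lra.
have [||c c01 hc] := @IVT R h 0 1 (h 0 + 2^-1) ler01.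
- exact: continuous_subspaceT.
- by rewrite ge_min le_max; apply/andP; split; apply/orP; [left|right]; lra.
have := hi _ c01; rewrite hc rpredDl// => /int_lt1_eq0.
by rewrite gtr0_norm; lra.
Qed.

End SquareLoop.

(** * Components of the complement and acyclic sets *)

Section Chains.
Variable R : realType.
Local Notation pt := (R * R)%type.
Implicit Types (p q r z w : pt) (U X Y : set pt) (t : R).

Lemma pair_ext p q : p.1 = q.1 -> p.2 = q.2 -> p = q.
Proof. by case: p q => a b [c d] /= -> ->. Qed.

Definition segment_in U p q := forall t, 0 <= t <= 1 -> U (p + t *: (q - p)).

(** Connection by polygonal paths; for open [U] its classes are the connected components, so the
    faces of a drawing are its classes in the complement. *)
Inductive chain U : pt -> pt -> Prop :=
| chain_nil p of U p : chain U p p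
| chain_cons p q r of segment_in U p q & chain U q r : chain U p r.

Lemma segment_in_l U p q : segment_in U p q -> U p.
Proof. by move=> /(_ 0); rewrite scale0r addr0 lexx ler01 => /(_ isT). Qed.

Lemma segment_in_r U p q : segment_in U p q -> U q.
Proof. by move=> /(_ 1); rewrite scale1r addrC subrK lexx ler01 => /(_ isT). Qed.

Lemma segment_in_sym U p q : segment_in U p q -> segment_in U q p.
Proof.
move=> H t /andP[t0 t1].
have -> : q + t *: (p - q) = p + (1 - t) *: (q - p).
  by apply: pair_ext => /=; rewrite /GRing.scale /=; ring.
by apply: H; apply/andP; split; lra.
Qed.

Lemma chain_l U p q : chain U p q -> U p.
Proof. by case=> // {}p {}q r /segment_in_l. Qed.

Lemma chain_r U p q : chain U p q -> U q.
Proof. by elim. Qed.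

Lemma chain_segment U p q : segment_in U p q -> chain U p q.
Proof. by move=> pq; apply: chain_cons pq (chain_nil (segment_in_r pq)). Qed.

Lemma chain_trans U q p r : chain U p q -> chain U q r -> chain U p r.
Proof. by elim=> // {}p {}q s pq qs IH /IH; exact: chain_cons. Qed.

Lemma chain_sym U p q : chain U p q -> chain U q p.
Proof.
elim=> [{}p Up|{}p {}q r pq qr IH]; first exact: chain_nil.
by apply: chain_trans IH _; apply: chain_segment; exact: segment_in_sym.
Qed.

Lemma chain_sub U V p q : U `<=` V -> chain U p q -> chain V p q.
Proof.
move=> UV; elim=> [{}p /UV|{}p {}q r pq _]; first exact: chain_nil.
by apply: chain_cons => t /pq /UV.
Qed.

Lemma segment_ball (c p q : pt) (d : R) : `|p - c| < d -> `|q - c| < d ->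
  segment_in [set x | `|x - c| < d] p q.
Proof.
move=> pc qc t /andP[t0 t1] /=.
have -> : p + t *: (q - p) - c = (1 - t) *: (p - c) + t *: (q - c).
  by apply: pair_ext => /=; rewrite /GRing.scale /=; ring.
have t1' : 0 <= 1 - t by lra.
rewrite (le_lt_trans (ler_normD _ _))// !normrZ (ger0_norm t0) (ger0_norm t1').
have [h|h] := leP t 2^-1.
  have : (1 - t) * `|p - c| < (1 - t) * d by rewrite ltr_pM2l//; lra.
  have : t * `|q - c| <= t * d by rewrite ler_wpM2l// ltW.
  by lra.
have : (1 - t) * `|p - c| <= (1 - t) * d by apply: ler_wpM2l => //; exact: ltW.
have : t * `|q - c| < t * d by rewrite ltr_pM2l//; lra.
by lra.
Qed.

Lemma closed_far (V : normedModType R) (X : set V) (w : V) : closed X -> ~ X w ->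
  exists2 d : R, 0 < d & forall y, `|y - w| < d -> ~ X y.
Proof.
move=> cX nXw; have /nbhs_ballP[d /= d0 H] : nbhs w (~` X).
  by apply: open_nbhs_nbhs; split => //; exact: closed_openC.
exists d => // y yw; apply: H; by rewrite -ball_normE /= distrC.
Qed.

Lemma chain_open X z w : closed X -> chain (~` X) z w ->
  exists2 d : R, 0 < d & forall y, `|y - w| < d -> chain (~` X) z y.
Proof.
move=> cX zw; have [d d0 H] := closed_far cX (chain_r zw).
exists d => // y yw; apply: chain_trans zw _; apply: chain_segment => t t01.
by apply/H/(segment_ball (c := w) (d := d)); rewrite ?subrr ?normr0.
Qed.

(* With the sup norm on the plane the complement of a box is chain connected
   through a corner beyond it. *)
Lemma chain_outside X (M : R) p q : (forall x, X x -> `|x| < M) ->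
  M <= `|p| -> M <= `|q| -> chain (~` X) p q.
Proof.
move=> XM; pose c := Num.max 0 M.
suff H u : M <= `|u| -> chain (~` X) u (c, c).
  by move=> /H pc /H qc; apply: chain_trans pc (chain_sym qc).
have out (x : pt) : M <= `|x.1| \/ M <= `|x.2| -> (~` X) x.
  move=> h /XM; rewrite prod_normE /= gt_max => /andP[h1 h2].
  by case: h => h; [have := le_lt_trans h h1|have := le_lt_trans h h2]; rewrite ltxx.
have cM : M <= `|c| by rewrite (le_trans _ (ler_norm c))// le_max lexx orbT.
rewrite prod_normE le_max => /orP[h|h].
  apply: (@chain_cons _ _ (u.1, c)) => [t _|].
    by apply: out; left; rewrite /= subrr scaler0 addr0.
  apply: chain_segment => t _; apply: out; right => /=.
  by rewrite subrr scaler0 addr0.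
apply: (@chain_cons _ _ (c, u.2)) => [t _|].
  by apply: out; right; rewrite /= subrr scaler0 addr0.
apply: chain_segment => t _; apply: out; left => /=.
by rewrite subrr scaler0 addr0.
Qed.

Lemma liftable_eq X (a b : pt -> R) : (forall x, X x -> modeq (a x) (b x)) ->
  liftable X a -> liftable X b.
Proof.
by move=> ab [th cth H]; exists th => // x Xx; apply: modeq_trans (H x Xx) (ab x Xx).
Qed.

Lemma liftableD X (a b : pt -> R) : liftable X a -> liftable X b ->
  liftable X (fun x => a x + b x).
Proof.
move=> [th cth H] [th' cth' H']; exists (fun x => th x + th' x).
  by move=> x; apply: cvgD; [exact: cth|exact: cth'].
by move=> x Xx; apply: modeqD; [exact: H|exact: H'].
Qed.

Lemma liftableN X (a : pt -> R) : liftable X a -> liftable X (fun x => - a x).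
Proof.
move=> [th cth H]; exists (fun x => - th x); first by move=> x; apply: cvgN; exact: cth.
by move=> x Xx; apply: modeqN; exact: H.
Qed.

Lemma angle_sub_modcont x z : x != z -> modcont (fun y => angle (y - z)) x.
Proof.
move=> xz; apply: (@modcont_comp _ _ _ _ (fun y : pt => y - z)).
  by apply: cvgB; [exact: cvg_id|exact: cvg_cst].
by apply: angle_modcont; rewrite subr_eq0.
Qed.

(** If the segment misses [X], no point of [X] sees [z] and [w] in opposite directions; the
    difference of the angles is then never a half turn, and [frac0] of it is a continuous lift. *)
Lemma liftable_segment X z w : compact X -> segment_in (~` X) z w ->
  liftable X (fun x => angle (x - z) - angle (x - w)).
Proof.
move=> cX zw.
have nX u : segment_in (~` X) z w -> forall x, X x -> u = z \/ u = w -> x != u.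
  by move=> H x Xx [->|->]; apply/eqP => e; [have := segment_in_l H|have := segment_in_r H]; rewrite -e.
have [|th cth H] := @compact_extension R _ X (fun x => frac0 (angle (x - z) - angle (x - w))) cX; last first.
  exists th => // x Xx; rewrite H//; exact: frac0_modeq.
apply: continuous_in_subspaceT => x; rewrite inE => Xx.
have xz : x != z by apply: nX zw _ Xx _; left.
have xw : x != w by apply: nX zw _ Xx _; right.
apply: (@continuous_frac0 _ _ (fun x => angle (x - z) - angle (x - w))).
  by apply: modcontD; [|apply: modcontN]; exact: angle_sub_modcont.
have /andP[h _] := frac0_bounds (angle (x - z) - angle (x - w)).
rewrite lt_neqAle h andbT; apply/eqP => e.
have xw0 : x - w != 0 by rewrite subr_eq0.
have [|||c c0 hc] := @angle_direction R (x - z) (- (x - w)).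
- by rewrite subr_eq0.
- by rewrite oppr_eq0.
- apply: modeq_trans (modeq_sym (angleN xw0)).
  have := frac0_modeq (angle (x - z) - angle (x - w)); rewrite -e => /modeq_sym h1.
  rewrite /modeq [X in X \is a _](_ : _ = (angle (x - z) - angle (x - w) - - 2^-1) - 1); last lra.
  by apply: rpredB; [exact: h1|exact: rpred1].
have c1 : 1 + c != 0 by rewrite gt_eqF//; lra.
(* The equation [x - z = c (w - x)] places [x] on the segment, at this parameter. *)
apply: (zw (c / (1 + c))).
  by apply/andP; split; [rewrite divr_ge0//; lra|rewrite ler_pdivrMr; lra].
suff -> : z + c / (1 + c) *: (w - z) = x by [].
move/(congr1 (fun u : pt => (u.1, u.2))): hc => -[hc1 hc2].
move: hc1 hc2; rewrite /GRing.scale /= => hc1 hc2.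
apply: pair_ext; rewrite /= /GRing.scale /=; apply: (mulfI c1).
  have -> : (1 + c) * (z.1 + c / (1 + c) * (w.1 - z.1)) = (1 + c) * z.1 + c * (w.1 - z.1) by field.
  by lra.
have -> : (1 + c) * (z.2 + c / (1 + c) * (w.2 - z.2)) = (1 + c) * z.2 + c * (w.2 - z.2) by field.
by lra.
Qed.

Lemma liftable_chain X z w : compact X -> chain (~` X) z w ->
  liftable X (fun x => angle (x - z) - angle (x - w)).
Proof.
move=> cX; elim=> [{}z _|{}z v {}w zv _ IH].
  exists (fun=> 0) => [x|x _]; first exact: cvg_cst.
  by rewrite subrr; exact: modeq_refl.
apply: liftable_eq (liftableD (liftable_segment cX zv) IH) => x _ /=.
by rewrite subrKA; exact: modeq_refl.
Qed.

End Chains.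

(** * Eilenberg's criterion and the number of pieces *)

Section Separation.
Variable R : realType.
Local Notation pt := (R * R)%type.
Implicit Types (p r w : pt) (X Y : set pt) (t : R).

Lemma continuous_sum (V W : normedModType R) (I : Type) (s : seq I) (f : I -> V -> W) :
  (forall i, continuous (f i)) -> continuous (fun x => \sum_(i <- s) f i x).
Proof.
move=> cf; elim: s => [|i s IH] x.
  apply: (@continuous_atP _ _ _ _ _).2 => e e0; exists 1 => // y _.
  by rewrite !big_nil subrr normr0.
have -> : (fun x => \sum_(j <- i :: s) f j x) = (fun x => f i x + \sum_(j <- s) f j x).
  by apply/funext => y; rewrite big_cons.
by apply: cvgD; [exact: cf|exact: IH].
Qed.

Lemma box_compact (L : R) : compact ([set` `[-L, L]] `*` [set` `[-L, L]] : set pt).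
Proof. by apply: compact_setX; exact: segment_compact. Qed.

Lemma boxP (L : R) p : ([set` `[-L, L]] `*` [set` `[-L, L]]) p <-> `|p| <= L.
Proof.
rewrite prod_normE /= ge_max !in_itv /= -!ler_norml; split; last by move/andP.
by move=> [-> ->].
Qed.

(* The coefficient of a point whose component is bounded is the degree on a
   large loop of a function that is liftable on the whole plane: the given lift
   inside the component, a multiple of the angle outside. *)
Lemma liftable_isolated X k (n : 'I_k -> int) (z : 'I_k -> pt) (i0 : 'I_k) (M : R) :
  compact X -> liftable X (fun x => \sum_i (n i)%:~R * angle (x - z i)) ->
  (forall w, chain (~` X) (z i0) w -> `|w| <= M) ->
  (forall i, ~ X (z i)) -> (forall i, i != i0 -> ~ chain (~` X) (z i0) (z i)) ->
  n i0 = 0.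
Proof.
move=> cX [th cth Hth] bz nXz iso.
have clX := compact_closed_norm cX.
have [M' M'0 XM'] := compact_norm_bound cX.
pose F w := chain (~` X) (z i0) w.
pose inner x := th x - \sum_(i < k | i != i0) (n i)%:~R * angle (x - z i).
pose outer x := (n i0)%:~R * angle (x - z i0).
pose g x := if pselect (F x \/ X x) then inner x else outer x.
have gin x : F x \/ X x -> g x = inner x by rewrite /g; case: pselect.
have gout x : ~ (F x \/ X x) -> g x = outer x by rewrite /g; case: pselect.
have innerE x : X x -> modeq (inner x) (outer x).
  move=> Xx; rewrite /inner /outer; apply: modeq_trans (modeqB (Hth x Xx) (modeq_refl _)) _.
  by rewrite (bigD1 i0)//= addrK; exact: modeq_refl.
have inner_cont x : F x \/ X x -> modcont inner x.
  move=> FXx; apply: modcontD; first exact/continuous_modcont/cth.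
  apply: modcontN.
  apply: (@modcont_eq _ _ _ (fun y => \sum_(i <- [seq i <- index_enum 'I_k | i != i0]) (n i)%:~R * angle (y - z i))).
    by move=> y; rewrite big_filter; exact: modeq_refl.
  move: (index_enum _) => s; elim: s => [|i s IH].
    by apply: modcont_eq (@modcont0 _ _ x) => y; rewrite big_nil; exact: modeq_refl.
  rewrite /=; case: ifPn => // ii0.
  apply: modcont_eq (modcontD (a := fun y => (n i)%:~R * angle (y - z i)) _ IH) => [y|].
    by rewrite big_cons; exact: modeq_refl.
  apply: modcontMz; apply: angle_sub_modcont; apply/eqP => xz.
  case: FXx => [|Xx]; last by apply: (nXz i); rewrite -xz.
  by rewrite /F xz; exact: iso.
have outer_cont x : ~ F x -> modcont outer x.
  move=> nFx; apply: modcontMz; apply: angle_sub_modcont; apply/eqP => xz.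
  by apply: nFx; rewrite xz; apply: chain_nil; exact: nXz.
have gcont x : modcont g x.
  have [Xx|nXx] := pselect (X x).
    have nFx : ~ F x by move=> /chain_r.
    move=> e e0; have [d d0 H] := inner_cont x (or_intror Xx) e e0.
    have [d' d'0 H'] := outer_cont x nFx e e0.
    exists (Num.min d d'); first by rewrite lt_min d0.
    move=> y; rewrite lt_min => /andP[/H [j ji hj] /H' [j' j'i hj']].
    rewrite (gin x); last by right.
    have [FXy|FXy] := pselect (F y \/ X y); first by rewrite gin//; exists j.
    rewrite gout//.
    exists (j' - (inner x - outer x)); first by apply: rpredB => //; exact: innerE.
    by rewrite (_ : _ - _ = outer y - outer x - j') //; ring.
  have [Fx|nFx] := pselect (F x).
    have [d d0 H] := chain_open clX Fx.
    apply: modcont_near (inner_cont x (or_introl Fx)); exists d => // y /H Fy.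
    by rewrite gin; [exact: modeq_refl|left].
  have [d d0 H] := chain_open clX (chain_nil nXx : chain (~` X) x x).
  apply: modcont_near (outer_cont x nFx); exists d => // y /H xy.
  rewrite gout; first exact: modeq_refl.
  case=> [Fy|]; last by move: (chain_r xy).
  by exfalso; apply: nFx; apply: chain_trans Fy (chain_sym xy).
have M0 : 0 <= M by rewrite (le_trans _ (bz (z i0) _))//; apply: chain_nil; exact: nXz.
(* The factor 2 makes up for the square loop coming as close as 1/2 to the origin in the sup norm:
   the loop of radius [r] about [z i0] runs outside the balls of radius [M] and [M']. *)
pose r := 2 * (`|z i0| + M + M' + 1); pose L := `|z i0| + r.
have z0 := normr_ge0 (z i0).
have r0 : 0 < r by rewrite /r; lra.
have [|ph cph Hph] := modcont_lift (@box_compact L) _ gcont.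
  move=> x t /boxP xL /andP[t0 t1]; apply/boxP; rewrite normrZ ger0_norm//.
  by rewrite (le_trans _ xL)// ler_piMl.
pose lo t := z i0 + r *: square_loop (clamp 0 1 t).
have c01 t : clamp 0 1 t \in `[0 : R, 1] by apply: clamp_itv.
have nlo t : M < `|lo t| /\ M' < `|lo t| /\ `|lo t| <= L.
  have /andP[h1 h2] := square_loop_norm (c01 t).
  have hr : `|r *: square_loop (clamp 0 1 t)| = r * `|square_loop (clamp 0 1 t)|.
    by rewrite normrZ gtr0_norm.
  have h3 : r * 2^-1 <= r * `|square_loop (clamp 0 1 t)| by rewrite ler_pM2l.
  have h4 : r * `|square_loop (clamp 0 1 t)| <= r * 1 by rewrite ler_pM2l.
  have h5 := lerB_normD (r *: square_loop (clamp 0 1 t)) (z i0).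
  have h6 := ler_normD (z i0) (r *: square_loop (clamp 0 1 t)).
  move: h5 h6; rewrite [_ *: _ + z i0]addrC -/(lo t) hr /L => h5 h6; rewrite /r in h3 h4 h5 h6 *.
  by split; [lra|split; lra].
have Hlo t : {for t, continuous (ph \o lo)}.
  apply: continuous_comp; last by apply: cph; apply/boxP; have [_ []] := nlo t.
  apply: cvgD; first exact: cvg_cst.
  apply: cvgZ; first exact: cvg_cst.
  apply: (@continuous_comp _ _ _ (clamp 0 1) (@square_loop R)).
    exact: clamp_continuous.
  exact: square_loop_continuous.
(* The lift minus [n i0] times the parameter is integer valued, hence constant; the loop closes up,
   so [n i0] vanishes. *)
pose h t := (ph \o lo) t - (n i0)%:~R * clamp 0 1 t.
have := @int_valued_const R h _ _; rewrite /h /= /lo !clamp_id ?in_itv /= ?lexx ?ler01//.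
rewrite square_loop01 mulr0 mulr1 subr0 => H.
apply/eqP; rewrite -(intr_eq0 R); apply/eqP.
suff : ph (z i0 + r *: square_loop 1) = ph (z i0 + r *: square_loop 1) - (n i0)%:~R by lra.
apply: H => t.
  apply: cvgB; first exact: Hlo.
  by apply: cvgM; [exact: cvg_cst|exact: clamp_continuous].
move=> _; have [l1 [l2 l3]] := nlo t.
suff : modeq (ph (lo t)) ((n i0)%:~R * clamp 0 1 t) by [].
apply: modeq_trans (Hph _ _) _; first exact/boxP.
rewrite gout; last first.
  by case=> [/bz/(lt_le_trans l1)|/XM'/(lt_trans l2)]; rewrite ltxx.
rewrite /outer; apply: modeqM; first exact: intr_int.
by rewrite /lo addrAC subrr add0r; exact: angle_square_loop.
Qed.

(** No winding around a point off [X] is possible on [X]. In this form the property passes to unions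
    of sets with one common point, and [acyclic_chain] turns it into connectedness of the
    complement. *)
Definition acyclic X :=
  compact X /\ forall z, ~ X z -> liftable X (fun x => angle (x - z)).

(** On [X] and on [Y] the [m + 1] differences of angles have lifts, whose discrepancies at the
    common points [q j] are integers. Normalized at the first point, these are [m + 1] vectors in
    dimension [m], so some nonzero integer combination has matching lifts and glues. If the [z i]
    were pairwise separated, each nonzero coefficient would belong to an unbounded component; the
    coefficients sum to 0, so at least two are nonzero, and their points lie in the same unbounded
    component. *)
Lemma acyclic_separation (m : nat) X Y (q : 'I_m.+1 -> pt) (z : 'I_m.+2 -> pt) :
  acyclic X -> compact Y -> (forall x, X x -> Y x -> exists j, x = q j) ->
  (forall i, ~ X (z i)) -> (forall i, ~ Y (z i)) ->
  (forall i, liftable Y (fun x => angle (x - z i) - angle (x - z ord0))) ->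
  exists i j, i != j /\ chain (~` (X `|` Y)) (z i) (z j).
Proof.
move=> [cX aX] cY XYq nXz nYz lY.
have /choice[al Hal] : forall i : 'I_m.+1, exists th : pt -> R, continuous th /\
    forall x, X x -> modeq (th x) (angle (x - z (lift ord0 i)) - angle (x - z ord0)).
  move=> i; have [th cth H] := liftableD (aX _ (nXz (lift ord0 i))) (liftableN (aX _ (nXz ord0))).
  by exists th.
have /choice[be Hbe] : forall i : 'I_m.+1, exists th : pt -> R, continuous th /\
    forall x, Y x -> modeq (th x) (angle (x - z (lift ord0 i)) - angle (x - z ord0)).
  by move=> i; have [th cth H] := lY (lift ord0 i); exists th.
(* A [q j] outside the intersection imposes no condition and gets the value 0. *)
pose kk i j : int := if pselect (X (q j) /\ Y (q j)) then Num.floor (al i (q j) - be i (q j)) else 0.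
have kkE i j : X (q j) -> Y (q j) -> (kk i j)%:~R = al i (q j) - be i (q j).
  move=> Xq Yq; have -> : kk i j = Num.floor (al i (q j) - be i (q j)).
    by rewrite /kk; case: pselect => // -[].
  rewrite floorK//.
  exact: modeq_trans ((Hal i).2 _ Xq) (modeq_sym ((Hbe i).2 _ Yq)).
(* Subtracting the column of [ord0] corresponds to shifting the lift on [X] by an integer; that
   column becomes zero, hence so does the determinant. *)
pose K := \matrix_(i < m.+1, j < m.+1) (kk i j - kk i ord0).
have /det0P[n n0 nK] : \det K == 0.
  rewrite -det_tr; apply/det0P; exists (delta_mx 0 ord0).
    by apply/eqP => /matrixP/(_ 0 ord0); rewrite !mxE !eqxx.
  apply/rowP => j; rewrite !mxE (bigD1 ord0)//= !mxE subrr mulr0 add0r big1// => i i0.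
  by rewrite !mxE (negbTE i0) mul0r.
(* The coefficient of [z ord0] makes the sum of all coefficients zero. *)
pose N i : int := if unlift ord0 i is Some j then n 0 j else - \sum_j n 0 j.
have NE x : \sum_i (N i)%:~R * angle (x - z i) =
    \sum_(i < m.+1) (n 0 i)%:~R * (angle (x - z (lift ord0 i)) - angle (x - z ord0)).
  rewrite big_ord_recl {1}/N unlift_none rmorphN rmorph_sum mulNr mulr_suml addrC -sumrB.
  by apply: eq_bigr => i _; rewrite /N liftK mulrBr.
have lXY : liftable (X `|` Y) (fun x => \sum_i (N i)%:~R * angle (x - z i)).
  apply: (@liftable_glue _ _ _ _ _ (fun x => \sum_i (n 0 i)%:~R * (al i x - (kk i ord0)%:~R))
    (fun x => \sum_i (n 0 i)%:~R * be i x)) => //.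
  - apply: continuous_sum => i x; apply: cvgM; first exact: cvg_cst.
    by apply: cvgB; [exact: (Hal i).1|exact: cvg_cst].
  - apply: continuous_sum => i x; apply: cvgM; first exact: cvg_cst.
    exact: (Hbe i).1.
  - move=> x Xx; rewrite NE; apply: modeq_sum => i; apply: modeqM; first exact: intr_int.
    apply: modeq_trans ((Hal i).2 x Xx); rewrite /modeq addrAC subrr sub0r rpredN.
    exact: intr_int.
  - move=> x Yx; rewrite NE; apply: modeq_sum => i; apply: modeqM; first exact: intr_int.
    exact: (Hbe i).2.
  - move=> x Xx Yx; have [j ej] := XYq x Xx Yx; rewrite ej in Xx Yx *.
    apply/eqP; rewrite -subr_eq0 -sumrB; apply/eqP.
    transitivity ((\sum_i n 0 i * K i j)%:~R : R); last first.
      by move/rowP/(_ j): nK; rewrite !mxE => ->.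
    rewrite rmorph_sum /=; apply: eq_bigr => i _.
    by rewrite -mulrBr intrM mxE intrB (kkE i j)//; congr (_ * _); ring.
apply: contrapT => nij.
have sep i j : i != j -> ~ chain (~` (X `|` Y)) (z i) (z j).
  by move=> ij cij; apply: nij; exists i, j.
have nXYz i : ~ (X `|` Y) (z i) by case; [exact: nXz|exact: nYz].
have cXY := compactU cX cY.
have [M M0 XYM] := compact_norm_bound cXY.
have unb i : N i != 0 -> exists2 w, chain (~` (X `|` Y)) (z i) w & M <= `|w|.
  move=> Ni; apply: contrapT => nw; move/eqP: Ni; apply.
  apply: (liftable_isolated (M := M) cXY lXY) => //.
    by move=> w zw; rewrite leNgt; apply/negP => Mw; apply: nw; exists w => //; exact: ltW.
  by move=> j ji; apply: sep; rewrite eq_sym.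
have [i1 ni1] : exists i, n 0 i != 0.
  apply/existsP; apply: contraNT n0; rewrite negb_exists => /forallP n0.
  by apply/eqP/rowP => i; rewrite mxE; have := n0 i; rewrite negbK => /eqP.
have N1 : N (lift ord0 i1) != 0 by rewrite /N liftK.
have [i2 i21 N2] : exists2 i, i != lift ord0 i1 & N i != 0.
  apply: contrapT => H; move/eqP: N1; apply.
  have N0 : \sum_i N i = 0.
    rewrite big_ord_recl {1}/N unlift_none; apply/eqP; rewrite addrC subr_eq0; apply/eqP.
    by apply: eq_bigr => i _; rewrite /N liftK.
  rewrite -[RHS]N0 (bigD1 (lift ord0 i1))//= big1 ?addr0// => i ii1.
  by apply/eqP; apply: contrapT => /negP Ni; apply: H; exists i.
have [w1 c1 Mw1] := unb _ N1; have [w2 c2 Mw2] := unb _ N2.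
apply: (sep _ _ i21); apply: chain_trans c2 _.
apply: chain_trans (chain_sym c1); exact: chain_outside XYM Mw2 Mw1.
Qed.

End Separation.

(** * Building acyclic sets; arcs have empty interior *)

Section AcyclicSets.
Variable R : realType.
Local Notation pt := (R * R)%type.
Implicit Types (p q r z w : pt) (X Y : set pt) (t : R).

Lemma acyclic_curve (g : R -> pt) (s t : R) : continuous g ->
  {in `[s, t] &, injective g} -> acyclic (g @` `[s, t]).
Proof.
move=> cg ig; split.
  by apply: continuous_compact; [exact: continuous_subspaceT|exact: segment_compact].
move=> z nz; apply: liftable_curve => // u ust; apply: angle_sub_modcont.
by apply/eqP => e; apply: nz; exists u.
Qed.

Lemma acyclic0 : acyclic (set0 : set pt).
Proof.
split; first exact: compact0.
by move=> z _; exists (fun=> 0) => // x; exact: cvg_cst.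
Qed.

Lemma acyclic1 p : acyclic [set p].
Proof.
split; first exact: compact_set1.
move=> z _; exists (fun=> angle (p - z)) => [x|x ->]; first exact: cvg_cst.
exact: modeq_refl.
Qed.

(** The two lifts differ by an integer at the common point, and shifting one of them removes it.
    Disjoint sets are included, with any [q]. *)
Lemma acyclicU X Y q : acyclic X -> acyclic Y -> (forall x, X x -> Y x -> x = q) ->
  acyclic (X `|` Y).
Proof.
move=> [cX aX] [cY aY] XYq; split=> [|z nz]; first exact: compactU.
have [|f cf Hf] := aX z; first by move=> Xz; apply: nz; left.
have [|g cg Hg] := aY z; first by move=> Yz; apply: nz; right.
have [[Xq Yq]|nq] := pselect (X q /\ Y q); last first.
  by apply: liftable_glue cX cY cf cg Hf Hg _ => x Xx Yx; case: nq; rewrite -(XYq x).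
apply: (@liftable_glue _ _ _ _ _ f (fun x => g x + (f q - g q))) => //.
- by move=> x; apply: cvgD; [exact: cg|exact: cvg_cst].
- move=> x /Hg; rewrite /modeq addrAC => h; apply: rpredD => //.
  exact: modeq_trans (Hf _ Xq) (modeq_sym (Hg _ Yq)).
- by move=> x Xx Yx; rewrite (XYq x)//; ring.
Qed.

Lemma acyclic_sequence (K : nat -> set pt) (q : nat -> pt) n :
  (forall i, (i < n)%N -> acyclic (K i)) ->
  (forall i j x, (j < i < n)%N -> K i x -> K j x -> x = q i) ->
  acyclic [set x | exists2 i, (i < n)%N & K i x].
Proof.
elim: n => [|n IH] aK Kq.
  rewrite (_ : mkset _ = set0); first exact: acyclic0.
  by apply/seteqP; split=> x // [].
rewrite (_ : mkset _ = [set x | exists2 i, (i < n)%N & K i x] `|` K n).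
  apply: (@acyclicU _ _ (q n)); [|exact: aK|].
    apply: IH => [i /ltnW/aK //|i j x /andP[ji il]]; apply: Kq; rewrite ji /=.
    exact: ltnW.
  by move=> x [i il Ki] Kn; apply: Kq Kn Ki; rewrite il /=.
apply/seteqP; split=> x /=.
  move=> [i]; rewrite ltnS leq_eqVlt => /orP[/eqP->|il] Ki; first by right.
  by left; exists i.
by case=> [[i il Ki]|Kn]; [exists i => //; exact: ltnW|exists n].
Qed.

Lemma acyclic_star (I : finType) (P : pred I) (K : I -> set pt) q :
  (forall i, P i -> acyclic (K i)) ->
  (forall i j x, P i -> P j -> i != j -> K i x -> K j x -> x = q) ->
  acyclic [set x | exists2 i, P i & K i x].
Proof.
move=> aK Kq.
pose K' n x := if pselect (exists2 i : I, P i & nat_of_ord (enum_rank i) = n) is left H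
  then K (s2val (cid2 H)) x else False.
have K'P i x : P i -> K' (enum_rank i) x = K i x.
  move=> Pi; rewrite /K'; case: pselect => [H|[]]; last by exists i.
  by case: (cid2 H) => j Pj /= /ord_inj/enum_rank_inj ->.
rewrite (_ : mkset _ = [set x | exists2 n, (n < #|I|)%N & K' n x]); last first.
  apply/seteqP; split=> x /=; first by move=> [i Pi Ki]; exists (enum_rank i) => //; rewrite K'P.
  move=> [n _]; rewrite /K'; case: pselect => // H; case: (cid2 H) => i Pi _ /= Ki.
  by exists i.
apply: (@acyclic_sequence K' (fun=> q)) => [n _|n m x /andP[mn _]].
  have [[i Pi <-]|H] := pselect (exists2 i : I, P i & nat_of_ord (enum_rank i) = n).
    rewrite (_ : K' _ = K i); first exact: aK.
    by apply/funext => x; exact: K'P.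
  rewrite (_ : K' _ = set0); first exact: acyclic0.
  by apply/funext => x; rewrite /K'; case: pselect.
rewrite {1}/K'; case: pselect => // H; case: (cid2 H) => i Pi /= ein Ki.
rewrite {1}/K'; case: pselect => // H'; case: (cid2 H') => j Pj /= ejm Kj.
apply: (Kq i j) => //; apply/eqP => eij; move: mn; rewrite -ein -ejm eij.
by rewrite ltnn.
Qed.

(** With [Y] empty, the count of pieces says that two points off [X] are not separated. *)
Lemma acyclic_chain X z w : acyclic X -> ~ X z -> ~ X w -> chain (~` X) z w.
Proof.
move=> aX nz nw; pose zw (i : 'I_2) := if i == ord0 then z else w.
have [||||i [j [ij]]] := @acyclic_separation R 0 X set0 (fun=> z) zw aX (@compact0 _).
- by [].
- by move=> i; rewrite /zw; case: ifP.
- by move=> i [].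
- by exists (fun=> 0) => // x; exact: cvg_cst.
rewrite setU0 /zw; case: (eqVneq i ord0) => [i0|i0]; case: (eqVneq j ord0) => [j0|j0] //.
- by rewrite i0 j0 eqxx in ij.
- exact: chain_sym.
- by move: ij i0 j0; case: i j => [[|[|i]] // i2] [[|[|j]] // j2] /=.
Qed.

(** A lift along the loop would return to its initial value, whereas the angle about [p] gains a
    full turn. *)
Lemma acyclic_no_loop X p (r : R) : acyclic X -> 0 < r -> ~ X p ->
  ~ (forall t, t \in `[0, 1] -> X (p + r *: square_loop t)).
Proof.
move=> [_ aX] r0 nXp loopX; have [th cth H] := aX p nXp.
have c01 t : clamp 0 1 t \in `[0 : R, 1] by apply: clamp_itv.
pose h t := th (p + r *: square_loop (clamp 0 1 t)) - clamp 0 1 t.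
have := @int_valued_const R h _ _; rewrite /h /= !clamp_id ?in_itv /= ?lexx ?ler01//.
rewrite square_loop01 subr0 => H'.
suff : th (p + r *: square_loop 1) = th (p + r *: square_loop 1) - 1 by lra.
apply: H' => t.
  apply: cvgB; last exact: clamp_continuous.
  apply: (@continuous_comp _ _ _ (fun t => p + r *: square_loop (clamp 0 1 t)) th); last exact: cth.
  apply: cvgD; first exact: cvg_cst.
  apply: cvgZ; first exact: cvg_cst.
  apply: (@continuous_comp _ _ _ (clamp 0 1) (@square_loop R)).
    exact: clamp_continuous.
  exact: square_loop_continuous.
move=> _; suff : modeq (th (p + r *: square_loop (clamp 0 1 t))) (clamp 0 1 t) by [].
apply: modeq_trans (H _ (loopX _ (c01 t))) _.
by rewrite addrAC subrr add0r; exact: angle_square_loop.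
Qed.

Definition thin X := forall p (d : R), 0 < d -> exists2 q, `|q - p| < d & ~ X q.

Lemma thinU X Y : closed X -> thin X -> thin Y -> thin (X `|` Y).
Proof.
move=> cX tX tY p d d0; have [q qp nXq] := tX p d d0.
have [d' d'0 H] := closed_far cX nXq.
have [|r rq nYr] := tY q (Num.min d' (d - `|q - p|)).
  by rewrite lt_min d'0 subr_gt0.
move: rq; rewrite lt_min => /andP[r1 r2]; exists r; last by case => // Xr; exact: H r1 Xr.
by rewrite -(subrKA q) (le_lt_trans (ler_normD _ _))//; lra.
Qed.

Lemma thin1 p : thin [set p].
Proof.
move=> q d d0; have [->|pq] := eqVneq q p; last first.
  by exists q; rewrite ?subrr ?normr0//= => qp; rewrite qp eqxx in pq.
exists (p + (d / 2, 0)).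
  rewrite addrAC subrr add0r prod_normE /= normr0 gtr0_norm; last lra.
  by rewrite max_l; lra.
move=> /(congr1 fst) /=; lra.
Qed.

Lemma curve_near (g : R -> pt) (t0 d : R) : continuous g -> 0 < d ->
  exists2 e : R, 0 < e & forall t, `|t - t0| < e -> `|g t - g t0| < d.
Proof. by move=> cg d0; have /continuous_atP := cg t0; apply. Qed.

(** Suppose the arc filled a ball about [g t0]. Without the parameters near [t0] it splits into two
    disjoint arcs, together acyclic and missing the centre, which still cover a square loop around
    the centre. *)
Lemma thin_curve (g : R -> pt) : continuous g -> {in `[0, 1] &, injective g} ->
  thin (g @` `[0, 1]).
Proof.
move=> cg ig p0 d0 d00; apply: contrapT => H.
have full q : `|q - p0| < d0 -> (g @` `[0, 1]) q.
  by move=> qp; apply: contrapT => nq; apply: H; exists q.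
have [t0 t001 gt0] : (g @` `[0, 1]) p0 by apply: full; rewrite subrr normr0.
(* The removed parameters stay within [d0 / 4] of the centre, while the loop of radius [d0 / 2]
   keeps at least that distance from it. *)
have d40 : 0 < d0 / 4 by lra.
have [e e0 He] := curve_near t0 cg d40.
have sub a b : 0 <= a -> b <= 1 -> {in `[a, b] &, injective g}.
  move=> a0 b1 x y; rewrite !in_itv /= => /andP[h1 h2] /andP[h3 h4]; apply: ig.
    by rewrite in_itv /=; apply/andP; split; lra.
  by rewrite in_itv /=; apply/andP; split; lra.
move: (t001); rewrite /= in_itv /= => /andP[t00 t01].
have aX : acyclic ((g @` `[0, t0 - e]) `|` (g @` `[t0 + e, 1])).
  apply: (@acyclicU _ _ 0).
  - by apply: acyclic_curve => //; apply: sub; lra.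
  - by apply: acyclic_curve => //; apply: sub; lra.
  move=> x [u] /=; rewrite in_itv /= => /andP[u0 ut] <- [v]; rewrite /= in_itv /= => /andP[tv v1].
  move=> /ig; rewrite !in_itv /= => vu.
  suff e1 : v = u by exfalso; lra.
  by apply: vu; apply/andP; split; lra.
have d20 : 0 < d0 / 2 by lra.
apply: (acyclic_no_loop aX d20 (p := p0)).
  move=> [] [u] /=; rewrite in_itv /= => /andP[h1 h2]; rewrite -gt0 => /ig.
    move=> H'; suff : u = t0 by lra.
    by apply: H' => //; rewrite in_itv /=; apply/andP; split; lra.
  move=> H'; suff : u = t0 by lra.
  by apply: H' => //; rewrite in_itv /=; apply/andP; split; lra.
move=> t /square_loop_norm /andP[l1 l2].
have nl : `|p0 + (d0 / 2) *: square_loop t - p0| = d0 / 2 * `|square_loop t|.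
  by rewrite addrAC subrr add0r normrZ gtr0_norm.
have m1 : d0 / 2 * 2^-1 <= d0 / 2 * `|square_loop t| by rewrite ler_pM2l.
have m2 : d0 / 2 * `|square_loop t| <= d0 / 2 * 1 by rewrite ler_pM2l.
have [|u u01 gu] := full (p0 + (d0 / 2) *: square_loop t).
  by rewrite nl; lra.
move: (u01); rewrite /= in_itv /= => /andP[u0 u1].
have [ue|ue] := leP u (t0 - e).
  by left; exists u => //; rewrite /= in_itv /= u0.
have [eu|eu] := leP (t0 + e) u.
  by right; exists u => //; rewrite /= in_itv /= u1 eu.
have /He : `|u - t0| < e by rewrite ltr_norml; apply/andP; split; lra.
by rewrite gu gt0 nl; lra.
Qed.

End AcyclicSets.

(** * Arcs and accessibility *)

Section Arcs.
Variable R : realType.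
Local Notation pt := (R * R)%type.
Implicit Types (p q r v w : pt) (U V X : set pt) (t s : R).

Definition arc U p q := exists g : R -> pt,
  [/\ continuous g, {in `[0, 1] &, injective g}, g 0 = p, g 1 = q &
      forall t, t \in `[0, 1] -> U (g t)].

Lemma arc_sub U V p q : U `<=` V -> arc U p q -> arc V p q.
Proof. by move=> UV [g [cg ig g0 g1 gU]]; exists g; split => // t /gU /UV. Qed.

Lemma affine_continuous (a b : R) : continuous (fun t => a + t * b).
Proof.
by move=> t; apply: cvgD; [exact: cvg_cst|apply: cvgM; [exact: cvg_id|exact: cvg_cst]].
Qed.

Lemma arc_subcurve (g : R -> pt) (a b : R) : continuous g ->
  {in `[0, 1] &, injective g} -> 0 <= a -> a < b -> b <= 1 ->
  arc (g @` `[a, b]) (g a) (g b).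
Proof.
move=> cg ig a0 ab b1; exists (fun t => g (a + t * (b - a))).
have itv t : t \in `[0, 1] -> a + t * (b - a) \in `[a, b].
  rewrite !in_itv /= => /andP[t0 t1].
  have h1 : 0 <= t * (b - a) by rewrite mulr_ge0//; lra.
  have h2 : t * (b - a) <= 1 * (b - a) by rewrite ler_pM2r//; lra.
  by apply/andP; split; lra.
have itv01 t : t \in `[0, 1] -> a + t * (b - a) \in `[0, 1].
  by move=> /itv; rewrite !in_itv /= => /andP[h1 h2]; apply/andP; split; lra.
split.
- move=> t; apply: (@continuous_comp _ _ _ (fun t => a + t * (b - a)) g).
    exact: affine_continuous.
  exact: cg.
- move=> t s /itv01 ht /itv01 hs /(ig _ _ ht hs) /addrI /mulIf; apply.
  by rewrite subr_eq0 gt_eqF.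
- by rewrite mul0r addr0.
- by rewrite mul1r subrKC.
- by move=> t /itv ht; exists (a + t * (b - a)).
Qed.

Lemma arc_rev U p q : arc U p q -> arc U q p.
Proof.
move=> [g [cg ig g0 g1 gU]]; exists (fun t => g (1 - t)).
have itv t : t \in `[0, 1] -> 1 - t \in `[0, 1].
  by rewrite !in_itv /= => /andP[h1 h2]; apply/andP; split; lra.
split; rewrite ?subr0 ?subrr//; last by move=> t /itv /gU.
  move=> t; apply: (@continuous_comp _ _ _ (fun t => 1 - t) g); last exact: cg.
  by apply: cvgB; [exact: cvg_cst|exact: cvg_id].
by move=> t s /itv ht /itv hs /(ig _ _ ht hs) h; lra.
Qed.

Lemma arc_glue U V p q r : (forall x, U x -> V x -> x = q) ->
  arc U p q -> arc V q r -> arc (U `|` V) p r.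
Proof.
move=> UVq [g [cg ig g0 g1 gU]] [h [ch ih h0 h1 hV]].
pose k t := g (clamp 0 1 (t * 2)) + (h (clamp 0 1 (-1 + t * 2)) - q).
have kl t : 0 <= t <= 2^-1 -> k t = g (t * 2) /\ t * 2 \in `[0, 1].
  move=> /andP[t0 t1]; have i1 : t * 2 \in `[0, 1] by rewrite in_itv /=; apply/andP; split; lra.
  split=> //; rewrite /k clamp_id// (_ : clamp 0 1 (-1 + t * 2) = 0) ?h0 ?subrr ?addr0//.
  by rewrite /clamp min_r ?max_l//; lra.
have kr t : 2^-1 <= t <= 1 -> k t = h (-1 + t * 2) /\ -1 + t * 2 \in `[0, 1].
  move=> /andP[t0 t1]; have i1 : -1 + t * 2 \in `[0, 1] by rewrite in_itv /=; apply/andP; split; lra.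
  split=> //; rewrite /k (clamp_id (x := -1 + t * 2))// (_ : clamp 0 1 (t * 2) = 1) ?g1 ?subrKC//.
  by rewrite /clamp min_l ?max_r//; lra.
have aff (a : R) : continuous (fun t => a + t * 2) by exact: affine_continuous.
exists k; split.
- move=> t; apply: cvgD.
    apply: (@continuous_comp _ _ _ (fun t => clamp 0 1 (t * 2)) g); last exact: cg.
    apply: (@continuous_comp _ _ _ (fun t => t * 2) (clamp 0 1)); last exact: clamp_continuous.
    by apply: cvgM; [exact: cvg_id|exact: cvg_cst].
  apply: cvgB; last exact: cvg_cst.
  apply: (@continuous_comp _ _ _ (fun t => clamp 0 1 (-1 + t * 2)) h); last exact: ch.
  by apply: (@continuous_comp _ _ _ (fun t => -1 + t * 2) (clamp 0 1)); [exact: aff|exact: clamp_continuous].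
- suff H t s : 0 <= t -> t <= s -> s <= 1 -> k t = k s -> t = s.
    move=> t s; rewrite !in_itv /= => /andP[t0 t1] /andP[s0 s1] e.
    by have [ts|st] := leP t s; [exact: H|apply/esym/H => //; exact: ltW].
  move=> t0 ts s1; have [s2|s2] := leP s 2^-1.
    have [|-> it] := kl t; first by apply/andP; split; lra.
    have [|-> is_] := kl s; first by apply/andP; split; lra.
    by move=> /(ig _ _ it is_); lra.
  have [t2|t2] := leP t 2^-1; last first.
    have [|-> it] := kr t; first by apply/andP; split; lra.
    have [|-> is_] := kr s; first by apply/andP; split; lra.
    by move=> /(ih _ _ it is_); lra.
  have [|-> it] := kl t; first by apply/andP; split; lra.
  have [|-> is_] := kr s; first by apply/andP; split; lra.
  move=> e; have e2 : h (-1 + s * 2) = h 0.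
    by rewrite h0; apply: UVq; [rewrite -e; exact: gU|exact: hV].
  have := ih _ _ is_ _ e2; rewrite in_itv /= lexx ler01 => /(_ isT); lra.
- have [|-> _] := kl 0; first by apply/andP; split; lra.
  by rewrite mul0r.
- have [|-> _] := kr 1; first by apply/andP; split; lra.
  by rewrite mul1r (_ : -1 + 2 = 1)//; lra.
- move=> t; rewrite in_itv /= => /andP[t0 t1]; have [t2|t2] := leP t 2^-1.
    have [|-> it] := kl t; first by apply/andP; split; lra.
    by left; exact: gU.
  have [|-> it] := kr t; first by apply/andP; split; lra.
  by right; exact: hV.
Qed.

Lemma first_hit (g : R -> pt) (Y : set pt) (a : R) : continuous g -> closed Y ->
  a <= 1 -> Y (g 1) -> exists s, [/\ a <= s, s <= 1, Y (g s) &
    forall t, a <= t -> t <= 1 -> Y (g t) -> s <= t].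
Proof.
move=> cg cY a1 Y1; pose T := [set t | a <= t <= 1 /\ Y (g t)].
have T1 : T 1 by split; rewrite ?a1 ?lexx.
have lT : has_lbound T by exists a => t [/andP[]].
have iT : has_inf T by split; [exists 1|].
exists (inf T); have ai : a <= inf T.
  by apply: lb_le_inf; [exists 1|move=> t [/andP[]]].
have i1 : inf T <= 1 by exact: ge_inf.
split=> //; last by move=> t at_ t1 Yt; apply: ge_inf => //; split; rewrite ?at_.
apply: contrapT => nY; have cgY : closed (g @^-1` Y) by apply: closed_comp => // x _; exact: cg.
have [d d0 H] := closed_far cgY nY.
have [t [/andP[at_ t1] Yt] ti] := inf_adherent d0 iT.
apply: (H t) => //; rewrite ger0_norm ?ltrBlDl//.
by rewrite subr_ge0; apply: ge_inf => //; split; rewrite ?at_.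
Qed.

Lemma curve_closed (g : R -> pt) (a b : R) : continuous g -> closed (g @` `[a, b]).
Proof.
move=> cg; apply: compact_closed_norm; apply: continuous_compact.
  exact: continuous_subspaceT.
exact: segment_compact.
Qed.

(** Switching at the first point of the first arc that lies on the second keeps the curve simple. *)
Lemma arc_concat U p q r : p != r -> arc U p q -> arc U q r -> arc U p r.
Proof.
move=> pr [g [cg ig g0 g1 gU]] [h [ch ih h0 h1 hU]].
have [|s [s0 s1 [t t01 ht] smin]] := @first_hit g (h @` `[0, 1]) 0 cg (curve_closed ch) ler01.
  by exists 0; rewrite ?g1 ?h0//= in_itv /= lexx ler01.
move: (t01); rewrite /= in_itv /= => /andP[t0 t1].
have subU (k : R -> pt) a b : (forall u, u \in `[0, 1] -> U (k u)) -> 0 <= a -> b <= 1 ->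
    (k @` `[a, b]) `<=` U.
  move=> kU a0 b1 x [u] /=; rewrite in_itv /= => /andP[h2 h3] <-; apply: kU.
  by rewrite in_itv /=; apply/andP; split; lra.
have [t1'|t1'] := eqVneq t 1.
  have s0' : 0 < s.
    rewrite lt_def s0 andbT; apply: contraNneq pr => s00.
    by rewrite -g0 -h1 -t1' ht s00.
  by rewrite -g0 -h1 -t1' ht; apply: arc_sub (arc_subcurve cg ig (lexx 0) s0' s1); exact: subU.
have {t1 t1'}t1 : t < 1 by rewrite lt_neqAle t1'.
have hr := arc_subcurve ch ih t0 t1 (lexx 1); rewrite h1 in hr.
have [s00|s00] := eqVneq s 0.
  by move: hr; rewrite ht s00 g0; apply: arc_sub; exact: subU.
have {s00}s0' : 0 < s by rewrite lt_def s00.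
have gl := arc_subcurve cg ig (lexx 0) s0' s1; rewrite g0 in gl.
rewrite ht in hr.
apply: arc_sub (arc_glue _ gl hr); first by move=> x [|]; apply: subU.
move=> x [u] /=; rewrite in_itv /= => /andP[u0 us] <- [w] /= wt1 ew.
have su : s <= u.
  apply: smin => //; first exact: le_trans us s1.
  by exists w => //=; move: wt1; rewrite !in_itv /= => /andP[h2 ->]; rewrite (le_trans t0).
by congr (g _); apply/eqP; rewrite eq_le us su.
Qed.

Lemma arc_segment U p q : p != q -> segment_in U p q -> arc U p q.
Proof.
move=> pq H; exists (fun t => p + t *: (q - p)); split.
- move=> t; apply: cvgD; first exact: cvg_cst.
  by apply: cvgZ; [exact: cvg_id|exact: cvg_cst].
- move=> t s _ _ /addrI; move/eqP; rewrite -subr_eq0 -scalerBl scaler_eq0 subr_eq0.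
  by move=> /orP[/eqP//|]; rewrite subr_eq0 eq_sym (negbTE pq).
- by rewrite scale0r addr0.
- by rewrite scale1r subrKC.
- by move=> t; rewrite in_itv /=; exact: H.
Qed.

Lemma chain_arc U p q : p != q -> chain U p q -> arc U p q.
Proof.
move=> pq c; elim: c pq => [{}p _|{}p r {}q pr _ IH] pq; first by case/eqP: pq.
have [e|npr] := eqVneq p r; first by rewrite e; apply: IH; rewrite -e.
have [e|nrq] := eqVneq r q; first by rewrite -e; exact: arc_segment.
exact: arc_concat pq (arc_segment npr pr) (IH nrq).
Qed.

(** An infinite concatenation closed up by its limit [v]: the piece [de n] is run during the time
    [n, n + 1], and time is compressed by [t / (1 - t)]. The result is simple since a piece can meet
    later ones only at its end. *)
Lemma arc_infinite (de : nat -> R -> pt) (rho : nat -> R) v :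
  (forall n, continuous (de n)) -> (forall n, {in `[0, 1] &, injective (de n)}) ->
  (forall n, de n 1 = de n.+1 0) ->
  (forall n m t s, t \in `[0, 1] -> s \in `[0, 1] -> (n < m)%N ->
     de n t = de m s -> t = 1) ->
  (forall n t, t \in `[0, 1] -> de n t != v /\ `|de n t - v| < rho n) ->
  (forall e : R, 0 < e -> exists N, forall n, (N <= n)%N -> rho n < e) ->
  arc [set x | x = v \/ exists n t, t \in `[0, 1] /\ x = de n t] (de 0 0) v.
Proof.
move=> cde ide mde dde vde rho0.
(* Clamped increments telescope: this is the concatenation of the first [N] pieces, defined and
   continuous for all times. *)
pose G N u := de 0 0 + \sum_(n < N) (de n (clamp 0 1 (u - n%:R)) - de n 0).
have cG N : continuous (G N).
  have cS : continuous (fun u : R => \sum_(n < N) (de n (clamp 0 1 (u - n%:R)) - de n 0)).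
    apply: continuous_sum => n u.
    apply: cvgB; last exact: cvg_cst.
    apply: (@continuous_comp _ _ _ (fun u : R => clamp 0 1 (u - n%:R)) (de n)); last exact: cde.
    apply: (@continuous_comp _ _ _ (fun u : R => u - n%:R) (clamp 0 1)); last exact: clamp_continuous.
    by apply: cvgB; [exact: cvg_id|exact: cvg_cst].
  by move=> u; apply: cvgD; [exact: cvg_cst|exact: cS].
have Gl n u : n%:R <= u -> G n u = de n 0.
  elim: n => [|n IH] nu; first by rewrite /G big_ord0 addr0.
  rewrite /G big_ord_recr /= addrA -/(G n u) IH; last first.
    by rewrite (le_trans _ nu)// ler_nat.
  rewrite subrKC -mde; congr (de n _); rewrite /clamp min_l ?max_r//.
  by move: nu; rewrite -natr1; lra.
have GE n N u : n%:R <= u -> u <= n.+1%:R -> (n < N)%N -> G N u = de n (u - n%:R).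
  move=> nu un; elim: N => // N IH; rewrite ltnS leq_eqVlt => /orP[/eqP<-|nN].
    rewrite /G big_ord_recr /= addrA -/(G n u) Gl// subrKC clamp_id//.
    by rewrite in_itv /=; move: un; rewrite -natr1 => un; apply/andP; split; lra.
  rewrite /G big_ord_recr /= addrA -/(G N u) IH// (_ : clamp 0 1 (u - N%:R) = 0) ?subrr ?addr0//.
  have : u <= N%:R by rewrite (le_trans un)// ler_nat.
  by move=> uN; rewrite /clamp min_r ?max_l//; lra.
have G0 N u : u <= 0 -> G N u = de 0 0.
  move=> u0; rewrite /G big1 ?addr0// => n _.
  have := ler0n R n => n0.
  by rewrite (_ : clamp 0 1 (u - n%:R) = 0) ?subrr// /clamp min_r ?max_l//; lra.
pose ta t := t / (1 - t).
pose h t := if t < 1 then G (Num.truncn (ta t)).+1 (ta t) else v.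
have hG N t : t < 1 -> ta t < N%:R -> h t = G N (ta t).
  move=> t1 tN; rewrite /h t1; have [u0|u0] := ltP (ta t) 0.
    by rewrite !G0// ltW.
  have /andP[h1 h2] := truncn_itv u0.
  rewrite (@GE (Num.truncn (ta t)))//; last exact: ltW.
  rewrite (@GE (Num.truncn (ta t)) N)//; first exact: ltW.
  by rewrite -(ltr_nat R) (le_lt_trans h1).
have ta0 t : 0 <= t -> t < 1 -> 0 <= ta t by move=> t0 t1; rewrite divr_ge0//; lra.
have hE t : 0 <= t -> t < 1 -> exists n s, [/\ 0 <= s < 1, ta t = n%:R + s & h t = de n s].
  move=> t0 t1; have /andP[h1 h2] := truncn_itv (ta0 t t0 t1).
  exists (Num.truncn (ta t)), (ta t - (Num.truncn (ta t))%:R); split.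
  - by move: h2; rewrite -natr1 => h2; apply/andP; split; lra.
  - by ring.
  - by rewrite /h t1 (@GE (Num.truncn (ta t)))// ltW.
have cta t : t < 1 -> {for t, continuous ta}.
  move=> t1; apply: cvgM; first exact: cvg_id.
  apply: cvgV; first by rewrite gt_eqF//; lra.
  by apply: cvgB; [exact: cvg_cst|exact: cvg_id].
have i01 s : 0 <= s < 1 -> s \in `[0, 1].
  by move=> /andP[s0 s1]; rewrite in_itv /= s0 ltW.
exists h; split.
- move=> t; have [t1|t1] := ltP t 1.
    pose N := (Num.truncn (`|ta t|)).+2.
    have tN : ta t + 1 <= N%:R.
      have := truncnS_gt `|ta t|; have := ler_norm (ta t).
      by rewrite /N -[X in _ -> _ -> _ <= X]natr1; lra.
    apply/continuous_atP => e e0.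
    have /continuous_atP := cta t t1 => /(_ 1 ltr01)[d1 d10 H1].
    have /continuous_atP : {for t, continuous (G N \o ta)}.
      by apply: continuous_comp; [exact: cta|exact: cG].
    move=> /(_ e e0)[d2 d20 H2].
    exists (Num.min (1 - t) (Num.min d1 d2)); first by rewrite !lt_min d10 d20 subr_gt0 t1.
    move=> s; rewrite !lt_min => /and3P[s1 /H1 s2 /H2 s3].
    have ht : h t = G N (ta t) by apply: hG => //; lra.
    have hs : h s = G N (ta s).
      apply: hG; first by move: s1; rewrite ltr_norml => /andP[_]; lra.
      by move: s2; rewrite ltr_norml => /andP[_]; lra.
    by rewrite ht hs.
  apply/continuous_atP => e e0; have [N HN] := rho0 e e0.
  have N2 : 0 < N.+2%:R :> R by rewrite ltr0n.
  (* Closer to 1 than this, the time exceeds [N + 1], so the current piece has index at least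
     [N]. *)
  exists (N.+2%:R^-1); first by rewrite invr_gt0.
  have -> : h t = v by rewrite /h ltNge t1.
  move=> s; rewrite ltr_norml => /andP[s1 _].
  have [s2|s2] := ltP s 1; last first.
    have -> : h s = v by rewrite /h ltNge s2.
    by rewrite subrr normr0.
  have iN : N.+2%:R^-1 <= 1 :> R by rewrite invf_le1// ler1n.
  have s0 : 0 <= s.
    by move: s1 iN; set k := N.+2%:R^-1; lra.
  have [n [u [u01 tan ->]]] := hE s s0 s2.
  apply: lt_trans ((vde n u (i01 u u01)).2) _; apply: HN.
  rewrite leqNgt; apply/negP => nN.
  have n1 : n%:R + 1 <= N%:R :> R by rewrite natr1 ler_nat.
  move: u01 => /andP[u0 u1].
  have taN : ta s < N.+2%:R - 1.
    by rewrite -[N.+2%:R]natr1 -[N.+1%:R]natr1; lra.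
  move: taN; rewrite /ta ltr_pdivrMr; last lra.
  have : (1 - s) * N.+2%:R < N.+2%:R^-1 * N.+2%:R.
    by rewrite ltr_pM2r//; move: s1; set k := N.+2%:R^-1; lra.
  rewrite mulVf ?gt_eqF//.
  by lra.
- suff H t s : 0 <= t -> t <= s -> s <= 1 -> h t = h s -> t = s.
    move=> t s; rewrite !in_itv /= => /andP[t0 t1] /andP[s0 s1] e.
    by have [ts|st] := leP t s; [exact: H|apply/esym/H => //; exact: ltW].
  move=> t0 ts s1 e; have [s1'|s1'] := ltP s 1; last first.
    have es : s = 1 by lra.
    have [t1'|t1'] := ltP t 1; last lra.
    have [n [u [u01 _ hu]]] := hE t t0 t1'.
    have := (vde n u (i01 u u01)).1; rewrite -hu e /h ltNge s1' /= eqxx //.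
  have t1 : t < 1 by lra.
  have s0 : 0 <= s by lra.
  have [n [u [u01 tu hu]]] := hE t t0 t1.
  have [m [w [w01 sw hw]]] := hE s s0 s1'.
  have tts : ta t = ta s; last first.
    have nt : 1 - t != 0 by rewrite gt_eqF//; lra.
    have ns : 1 - s != 0 by rewrite gt_eqF//; lra.
    by move: tts; rewrite /ta => /eqP; rewrite eqr_div// => /eqP; lra.
  have edd : de n u = de m w by rewrite -hu -hw.
  have [nm|mn|nm] := ltngtP n m.
  + have := dde n m u w (i01 _ u01) (i01 _ w01) nm edd.
    by move: u01 => /andP[]; lra.
  + have := dde m n w u (i01 _ w01) (i01 _ u01) mn (esym edd).
    by move: w01 => /andP[]; lra.
  + by rewrite tu sw nm; congr (_ + _); apply: (ide n); rewrite ?i01// edd nm.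
- by rewrite (@hG 1%N) ?ltr01 ?/ta ?mul0r// G0.
- by rewrite /h ltxx.
- move=> t; rewrite in_itv /= => /andP[t0 t1].
  have [t1'|t1'] := ltP t 1; last by left; rewrite /h ltNge t1'.
  have [n [u [u01 _ ->]]] := hE t t0 t1'; right; exists n, u; split => //.
  exact: i01.
Qed.

End Arcs.

(** * Accessibility of boundary points by arcs *)

Section Access.
Variable R : realType.
Local Notation pt := (R * R)%type.
Implicit Types (p q r v w : pt) (U V X A : set pt) (t s : R).

Definition adherent A v := forall d : R, 0 < d -> exists2 z, A z & `|z - v| < d.

Definition punctured_near X v (e : R) : set pt := [set x | `|x - v| < e /\ ~ X x].

(* Among the points of [A] close to [v], those lying in a single component of
   the complement of [X] in a small ball still accumulate at [v]. *)
Definition locally_accessible X v := forall (e : R) A, 0 < e -> A `<=` ~` X ->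
  adherent A v -> exists c, [/\ A c, `|c - v| < e &
    adherent [set z | A z /\ chain (punctured_near X v e) c z] v].

Lemma adherent_sub A B v : A `<=` B -> adherent A v -> adherent B v.
Proof. by move=> AB aA d /aA[z /AB Bz zv]; exists z. Qed.

Lemma adherent_remove A v c : c != v -> adherent A v -> adherent (A `\ c) v.
Proof.
move=> cv aA d d0; have ncv : 0 < `|c - v| by rewrite normr_gt0 subr_eq0.
have [|z Az] := aA (Num.min d `|c - v|); first by rewrite lt_min d0.
rewrite lt_min => /andP[zd zc]; exists z => //; split=> // /= zc'.
by rewrite zc' ltxx in zc.
Qed.

(** Local accessibility is iterated with shrinking radii: each arc stays in its ball and ends at a
    point of the next ball whose component still accumulates at [v]. The radius two steps ahead is
    chosen at most the distance of the arc to [v], so that only consecutive arcs can meet. *)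
Lemma locally_accessible_arcs X v A : X v -> locally_accessible X v ->
  A `<=` ~` X -> adherent A v ->
  exists (al : nat -> R -> pt) (r : nat -> R),
  [/\ exists2 a, A a & chain (~` X) a (al 1%N 0),
      forall n, [/\ continuous (al n), {in `[0, 1] &, injective (al n)} & al n 1 = al n.+1 0],
      forall n t, t \in `[0, 1] -> punctured_near X v (r n) (al n t) /\ r n.+2 <= `|al n t - v| &
      (r 1%N <= 1) /\ forall n, 0 < r n.+1 /\ r n.+2 <= r n.+1 / 2].
Proof.
move=> Xv lXv AX aA.
have [c0 [Ac0 _ ac0]] := lXv _ A ltr01 AX aA.
pose good (st : pt * (R * R)) := [/\ 0 < st.2.1, 0 < st.2.2 &
  adherent [set z | chain (punctured_near X v st.2.1) st.1 z] v].
pose step (st st' : pt * (R * R)) := [/\ st'.2.1 = st.2.2, st'.2.2 <= st.2.2 / 2,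
  chain (~` X) st.1 st'.1 & exists g : R -> pt, [/\ continuous g, {in `[0, 1] &, injective g},
   g 0 = st.1, g 1 = st'.1 & forall t, t \in `[0, 1] ->
     punctured_near X v st.2.1 (g t) /\ st'.2.2 <= `|g t - v| ]].
have near_sub e : punctured_near X v e `<=` ~` X by move=> x [].
have [st|f [f0 fS]] := @dependent_choice (pt * (R * R)) (fun st st' => good st -> good st' /\ step st st') _ (c0, (1, 1)).
  apply: cid; have [gst|ngst] := pselect (good st); last by exists st.
  case: st gst => c [r r'] [/= r0 r'0 ac].
  have nXc : ~ X c by have [z /= cz _] := ac 1 ltr01; have [] := chain_l cz.
  have cv : c != v by apply/eqP => e; apply: nXc; rewrite e.
  (* Removing [c] from the candidates makes the next point different, so that a nondegenerate arc
     joins the two. *)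
  have [|c' [[cc' c'c] c'v ac']] := lXv r' _ r'0 _ (adherent_remove cv ac).
    by move=> z [/= /chain_r[]].
  have cc'' : c != c' by apply/eqP => e; apply: c'c; rewrite /= e.
  have [g [cg ig g0 g1 gU]] := chain_arc cc'' cc'.
  have [|d d0 H] := closed_far (@curve_closed R g 0 1 cg) (w := v).
    move=> [t t01 gt]; have [_] := gU t t01; by rewrite gt.
  exists (c', (r', Num.min d (r' / 2))) => _; split.
    split=> //=; first by rewrite lt_min d0; lra.
    by apply: adherent_sub ac' => z [].
  split=> //=; first by rewrite ge_min lexx orbT.
    exact: chain_sub (near_sub r) cc'.
  exists g; split=> // t t01; split; first exact: gU.
  rewrite ge_min leNgt; apply/orP; left; apply/negP => /H; apply.
  by exists t.
have gf n : good (f n).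
  elim: n => [|n /fS[]//]; rewrite f0; split; rewrite /= ?ltr01//.
  by apply: adherent_sub ac0 => z [].
have stf n : step (f n) (f n.+1) by have [] := fS n (gf n).
have /choice[al Hal] : forall n, exists g : R -> pt, [/\ continuous g, {in `[0, 1] &, injective g},
   g 0 = (f n).1, g 1 = (f n.+1).1 & forall t, t \in `[0, 1] ->
     punctured_near X v (f n).2.1 (g t) /\ (f n.+1).2.2 <= `|g t - v| ].
  by move=> n; have [] := stf n.
exists al, (fun n => (f n).2.1); split.
- exists c0 => //; have [_ _] := stf 0%N; rewrite f0 /= => c01 _.
  by have [_ _ -> _ _] := Hal 1%N.
- by move=> n; have [? ? _ -> _] := Hal n; have [_ _ -> _ _] := Hal n.+1.
- move=> n t /[dup] t01; have [_ _ _ _ H] := Hal n => /H[? ?]; split => //.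
  by have [-> _ _ _] := stf n.+1.
- split; first by have [-> _ _ _] := stf 0%N; rewrite f0.
  move=> n; have [-> h _ _] := stf n.+1; have [-> h' _ _] := stf n.
  by have [? ? _] := gf n.
Qed.

(** Consecutive arcs may cross, so each is left at its first point on the following one;
    nonconsecutive arcs are disjoint, and the trimmed pieces satisfy the hypotheses of
    [arc_infinite]. *)
Lemma locally_accessible_arc X v A : X v -> locally_accessible X v ->
  A `<=` ~` X -> adherent A v ->
  exists a c, [/\ A a, chain (~` X) a c & arc [set x | x = v \/ ~ X x] c v].
Proof.
move=> Xv lXv AX aA.
have [al [r [[a Aa ca] Hal nal [r1 rS]]]] := locally_accessible_arcs Xv lXv AX aA.
have rmono n m : (n <= m)%N -> r m.+1 <= r n.+1.
  elim: m => [|m IH]; first by rewrite leqn0 => /eqP->.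
  rewrite leq_eqVlt => /orP[/eqP->//|/IH]; have [] := rS m; lra.
have disj n m t s : t \in `[0, 1] -> s \in `[0, 1] -> (n.+1 < m)%N -> al n t != al m s.
  move=> t01 s01 nm; apply/eqP => e.
  have [_ h1] := nal n t t01; have [[h2 _] _] := nal m s s01.
  case: m nm e h2 => // m nm e h2; have := rmono n.+1 m nm.
  by rewrite -e in h2; lra.
(* Each piece starts on the preceding arc, which is disjoint from the following one; hence the piece
   has positive length. Numbering from 1 provides a preceding arc for the first piece. *)
pose good (st : nat * R) := [/\ (0 < st.1)%N, st.2 \in `[0, 1] &
  exists2 s, s \in `[0, 1] & al st.1 st.2 = al st.1.-1 s].
pose step (st st' : nat * R) := st'.1 = st.1.+1 /\ exists b, [/\ st.2 < b, b <= 1,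
  al st.1 b = al st'.1 st'.2 & forall t, st.2 <= t -> t <= 1 ->
    (exists2 s, s \in `[0, 1] & al st.1 t = al st'.1 s) -> b <= t].
have [st|f [f0 fS]] := @dependent_choice (nat * R) (fun st st' => good st -> good st' /\ step st st') _ (1%N, 0).
  apply: cid; have [gst|ngst] := pselect (good st); last by exists st.
  case: st gst => n u [/= n0 u01 [s s01 es]].
  have [cn inn en] := Hal n; have [cn1 inn1 _] := Hal n.+1.
  move: (u01); rewrite in_itv /= => /andP[u0 u1].
  have [|b [ub b1 [u' u'01 eb] bmin]] := @first_hit R (al n) (al n.+1 @` `[0, 1]) u cn (curve_closed cn1) u1.
    by exists 0; rewrite ?en//= in_itv /= lexx ler01.
  exists (n.+1, u') => _; split.
    split=> //=; exists b; last by rewrite eb.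
    by rewrite in_itv /= b1 (le_trans u0).
  split=> //=; exists b; split => //=; last first.
    by move=> t ut t1 [w w01 ew]; apply: bmin => //; exists w.
  rewrite lt_neqAle ub andbT; apply/eqP => e.
  have := @disj n.-1 n.+1 s u' s01 u'01; rewrite -es prednK// ltnSn => /(_ isT).
  by rewrite eb -e eqxx.
have gf n : good (f n).
  elim: n => [|n /fS[]//]; rewrite f0; split; rewrite ?in_itv /= ?lexx ?ler01//.
  have [_ _ <-] := Hal 0%N; exists 1 => //; by rewrite in_itv /= lexx ler01.
have stf n : step (f n) (f n.+1) by have [] := fS n (gf n).
have f1 n : (f n).1 = n.+1.
  by elim: n => [|n IH]; [rewrite f0|have [-> _] := stf n; rewrite IH].
have /choice[b Hb] : forall n, exists b, [/\ (f n).2 < b, b <= 1,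
  al n.+1 b = al n.+2 (f n.+1).2 & forall t, (f n).2 <= t -> t <= 1 ->
    (exists2 s, s \in `[0, 1] & al n.+1 t = al n.+2 s) -> b <= t].
  by move=> n; have [_] := stf n; rewrite !f1.
pose a_ n := (f n).2.
have a01 n : 0 <= a_ n by have [_ + _] := gf n; rewrite in_itv /= => /andP[].
pose de n t := al n.+1 (a_ n + t * (b n - a_ n)).
have ditv n t : t \in `[0, 1] -> a_ n + t * (b n - a_ n) \in `[a_ n, b n].
  have [ab _ _ _] := Hb n; rewrite !in_itv /= => /andP[t0 t1].
  have h1 : 0 <= t * (b n - a_ n) by rewrite mulr_ge0// subr_ge0 ltW.
  have h2 : t * (b n - a_ n) <= 1 * (b n - a_ n) by rewrite ler_pM2r// subr_gt0.
  by apply/andP; split; lra.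
have ditv01 n t : t \in `[0, 1] -> a_ n + t * (b n - a_ n) \in `[0, 1].
  have [_ b1 _ _] := Hb n => /(ditv n); rewrite !in_itv /= => /andP[h1 h2].
  by rewrite (le_trans (a01 n))//= (le_trans h2).
have rle n : r n.+1 <= n.+1%:R^-1.
  suff H : n.+1%:R * r n.+1 <= 1 by rewrite -[_^-1]mul1r ler_pdivlMr 1?mulrC// ltr0n.
  elim: n => [|n IH]; first by rewrite mul1r.
  have [h0 h] := rS n; have [h0' _] := rS n.+1.
  have k1 : n.+2%:R * r n.+2 <= n.+2%:R * (r n.+1 / 2) by rewrite ler_pM2l ?ltr0n.
  apply: le_trans k1 _; apply: le_trans IH.
  rewrite mulrA mulrAC ler_pM2r// ler_pdivrMr// -natrM ler_nat; lia.
exists a, (de 0%N 0); split => //.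
  by rewrite /de mul0r addr0 /a_ f0.
apply: arc_sub (@arc_infinite R de (fun n => r n.+1) v _ _ _ _ _ _).
- move=> x [->|[n [t [t01 ->]]]]; [by left|right].
  by have [[]] := nal n.+1 _ (ditv01 n t t01).
- move=> n t; apply: (@continuous_comp _ _ _ (fun t => a_ n + t * (b n - a_ n)) (al n.+1)).
    exact: affine_continuous.
  by have [cn _ _] := Hal n.+1; exact: cn.
- move=> n t s /ditv01 ht /ditv01 hs; have [_ inn _] := Hal n.+1.
  move=> /(inn _ _ (ht n) (hs n)) /addrI /mulIf; apply.
  by have [ab _ _ _] := Hb n; rewrite subr_eq0 gt_eqF.
- by move=> n; rewrite /de mul1r subrKC mul0r addr0; have [_ _ -> _] := Hb n.
- move=> n m t s t01 s01; rewrite leq_eqVlt => /orP[/eqP<-|nm] e; last first.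
    have := @disj n.+1 m.+1 _ _ (ditv01 n t t01) (ditv01 m s s01).
    by rewrite ltnS nm -/(de m s) -e eqxx => /(_ isT).
  have [ab b1 _ bmin] := Hb n.
  have : b n <= a_ n + t * (b n - a_ n).
    have := ditv n t t01; rewrite in_itv /= => /andP[h1 h2].
    apply: bmin => //; first by rewrite (le_trans h2).
    by exists (a_ n.+1 + s * (b n.+1 - a_ n.+1)) => //; exact: ditv01.
  move: t01; rewrite in_itv /= => /andP[t0 t1].
  rewrite -lerBlDl -{1}[b n - a_ n]mul1r ler_pM2r ?subr_gt0// => h.
  by apply/eqP; rewrite eq_le t1.
- move=> n t t01; have [[h1 nX] _] := nal n.+1 _ (ditv01 n t t01); split => //.
  by apply/eqP => e; apply: nX; rewrite -/(de n t) e.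
- move=> e e0; exists (Num.truncn e^-1) => n ne; apply: le_lt_trans (rle n) _.
  rewrite invf_plt ?posrE ?ltr0n//; apply: lt_le_trans (truncnS_gt _) _.
  by rewrite ler_nat.
Qed.

End Access.

(** * Plane graphs *)

Section PlaneGraphs.
Variable R : realType.
Local Notation pt := (R * R)%type.
Implicit Types (p q : pt) (U X Y A : set pt) (t s : R).

Lemma finite_union_ind (Q : set pt -> Prop) : Q set0 ->
  (forall A B, Q A -> Q B -> Q (A `|` B)) ->
  forall (I : finType) (P : pred I) (K : I -> set pt), (forall i, P i -> Q (K i)) ->
  Q [set x | exists2 i, P i & K i x].
Proof.
move=> Q0 QU I P K QK.
suff H (s : seq I) : Q [set x | exists2 i, P i && (i \in s) & K i x].
  rewrite (_ : mkset _ = [set x | exists2 i, P i && (i \in enum I) & K i x]) //.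
  by apply/seteqP; split=> x [i Pi Ki]; exists i => //; [rewrite Pi mem_enum|case/andP: Pi].
elim: s => [|j s IH].
  by rewrite (_ : mkset _ = set0)//; apply/seteqP; split=> x // [i]; rewrite andbF.
have [Pj|nPj] := boolP (P j).
  rewrite (_ : mkset _ = K j `|` [set x | exists2 i, P i && (i \in s) & K i x]).
    exact: QU (QK _ Pj) IH.
  apply/seteqP; split=> x /=.
    move=> [i]; rewrite in_cons => /andP[Pi /orP[/eqP->|js]] Ki; [by left|right].
    by exists i => //; rewrite Pi.
  move=> [Kj|[i /andP[Pi js] Ki]]; first by exists j => //; rewrite Pj mem_head.
  by exists i => //; rewrite Pi in_cons js orbT.
rewrite (_ : mkset _ = [set x | exists2 i, P i && (i \in s) & K i x]) //.
apply/seteqP; split=> x [i /andP[Pi js] Ki]; exists i => //.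
  by rewrite Pi; move: js nPj; rewrite in_cons => /orP[/eqP <-|//]; rewrite Pi.
by rewrite Pi in_cons js orbT.
Qed.

Lemma segment_stay U p q v (e : R) : (forall x, U x -> `|x - v| != e) ->
  `|p - v| < e -> segment_in U p q -> segment_in [set x | `|x - v| < e /\ U x] p q.
Proof.
move=> Ue pe pq t /andP[t0 t1]; split; last by apply: pq; rewrite t0.
rewrite ltNge; apply/negP => et.
pose f s := `|p + s *: (q - p) - v|.
have cf : continuous f.
  move=> s; apply: cvg_norm; apply: cvgB; last exact: cvg_cst.
  by apply: cvgD; [exact: cvg_cst|apply: cvgZ; [exact: cvg_id|exact: cvg_cst]].
have [||s s01 fs] := @IVT R f 0 t e t0.
- exact: continuous_subspaceT.
- rewrite ge_min le_max; apply/andP; split; apply/orP; last by right.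
  by left; rewrite /f scale0r addr0 ltW.
move: s01; rewrite in_itv /= => /andP[s0 st].
have /Ue : U (p + s *: (q - p)) by apply: pq; rewrite s0 (le_trans st).
by rewrite -/(f s) fs eqxx.
Qed.

Lemma chain_stay U p q v (e : R) : (forall x, U x -> `|x - v| != e) ->
  `|p - v| < e -> chain U p q -> chain [set x | `|x - v| < e /\ U x] p q.
Proof.
move=> Ue + c; elim: c => [{}p Up|{}p r {}q pr _ IH] pe; first exact: chain_nil.
have H := segment_stay Ue pe pr.
by apply: (chain_cons H); apply: IH; have [] := segment_in_r H.
Qed.

(** If no class accumulated at [v], points of [A] could be chosen one after another, each closer to
    [v] than the classes of all the previous ones; [m] such points would be pairwise unrelated. *)
Lemma adherent_pigeonhole (A : set pt) v (rel : pt -> pt -> Prop) (m : nat) (de : R) :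
  0 < de -> adherent A v -> (forall p q, rel p q -> rel q p) ->
  (forall z : 'I_m -> pt, (forall i, A (z i) /\ `|z i - v| < de) ->
     exists i j, i != j /\ rel (z i) (z j)) ->
  exists c, [/\ A c, `|c - v| < de & adherent [set z | A z /\ rel c z] v].
Proof.
move=> de0 aA rel_sym H; apply: contrapT => nH.
have /choice[dc Hdc] : forall c, exists d : R, 0 < d /\
    (A c -> `|c - v| < de -> forall z, A z -> rel c z -> d <= `|z - v|).
  move=> c; have [Ac|nAc] := pselect (A c /\ `|c - v| < de); last first.
    by exists 1; split => // Ac cv; case: nAc.
  case: Ac => Ac cv; apply: contrapT => nd; apply: nH; exists c; split => // d d0.
  apply: contrapT => nz; apply: nd; exists d; split => // _ _ z Az cz.
  by rewrite leNgt; apply/negP => zd; apply: nz; exists z.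
have /choice[zf Hzf] : forall d : R, exists z, 0 < d -> A z /\ `|z - v| < d.
  move=> d; have [d0|d0] := ltP 0 d; last by exists v.
  by have [z Az zv] := aA d d0; exists z.
pose d := fix d n : R := if n is n'.+1 then Num.min (d n') (dc (zf (d n'))) else de.
have d0 n : 0 < d n by elim: n => //= n IH; rewrite lt_min IH; case: (Hdc (zf (d n))).
have dmono i j : (i <= j)%N -> d j <= d i.
  elim: j => [|j IH]; first by rewrite leqn0 => /eqP->.
  rewrite leq_eqVlt => /orP[/eqP->//|/IH h]; apply: le_trans h.
  by rewrite /= ge_min lexx.
have nrel i j : (i < j)%N -> ~ rel (zf (d i)) (zf (d j)).
  move=> ij rij; have [Ai iv] := Hzf _ (d0 i); have [Aj jv] := Hzf _ (d0 j).
  have [_ h] := Hdc (zf (d i)).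
  have {}h := h Ai (lt_le_trans iv (dmono 0%N i isT)) _ Aj rij.
  have : d j <= dc (zf (d i)).
    by apply: le_trans (dmono _ _ ij) _; rewrite /= ge_min lexx orbT.
  by move=> h2; have := lt_le_trans jv (le_trans h2 h); rewrite ltxx.
have [|i [j [ij rij]]] := H (fun i => zf (d i)).
  move=> i; have [Ai iv] := Hzf _ (d0 i); split => //.
  exact: lt_le_trans iv (dmono 0%N i isT).
move: ij; rewrite neq_ltn => /orP[ij|ij]; first exact: nrel ij rij.
exact: nrel ij (rel_sym _ _ rij).
Qed.

Variables (W : finType) (H : sgraph W) (D : drawing R W).

(** The vertices are listed separately because of the isolated ones. *)
Definition drawn : set pt :=
  [set x | exists2 e, e \in edges H & curve_image D e x] `|`
  [set x | exists2 v : W, predT v & [set vertex_pos D v] x].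

Lemma drawn_edge e : e \in edges H -> curve_image D e `<=` drawn.
Proof. by move=> eH x ex; left; exists e. Qed.

Lemma drawn_vertex v : drawn (vertex_pos D v).
Proof. by right; exists v. Qed.

Lemma edge_ends e u : e \in edges H -> u \in e ->
  exists2 w, u != w & e = [set u; w]%SET.
Proof.
move=> eH ue; have /eqP/cards2P[x [y [xy exy]]] := card_edge eH.
move: ue; rewrite exy in_set2 => /orP[/eqP->|/eqP->]; first by exists y.
by exists x; [rewrite eq_sym|rewrite finset.setUC].
Qed.

Lemma edge_neq u w : [set u; w]%SET \in edges H -> u != w.
Proof. by move=> /card_edge; rewrite cards2; case: (u != w). Qed.

Hypothesis plHD : plane H D.

(** The drawing fixes neither the direction of a curve nor its values outside [0, 1]; this supplies
    a total continuous parametrization that starts at [u]. *)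
Lemma edge_curve_from u w : [set u; w]%SET \in edges H -> exists g : R -> pt,
  [/\ continuous g, {in `[0, 1] &, injective g}, g 0 = vertex_pos D u,
      g 1 = vertex_pos D w & g @` `[0, 1] = curve_image D [set u; w]%SET].
Proof.
move=> eH; have uw := edge_neq eH; set e := [set u; w]%SET in eH *.
have [m [i01 [i0 i1]]] : (0 <= 1 :> R) /\ (forall t, t \in `[0 : R, 1] -> clamp 0 1 t = t) /\
    (0 : R) \in `[0 : R, 1] /\ (1 : R) \in `[0 : R, 1].
  by split=> //; split; [move=> t; exact: clamp_id|rewrite !in_itv /= !lexx !ler01].
pose g := edge_curve D e \o clamp 0 1.
have cg : continuous g.
  have := plane_continuous plHD eH => /subspace_continuousP cge t.
  apply/continuous_atP => d d0.
  have c01 := clamp_itv (a := 0) (b := 1) t m.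
  have := cge _ c01 => /cvgrPdist_lt /(_ d d0); rewrite near_withinE => /nbhs_ballP[d' /= d'0 Hd'].
  have /continuous_atP := @clamp_continuous R 0 1 t => /(_ d' d'0)[d'' d''0 Hd''].
  exists d'' => // s /Hd'' sd; rewrite distrC; apply: Hd'; last by apply: clamp_itv.
  by rewrite -ball_normE /= distrC.
have ig : {in `[0, 1] &, injective g}.
  move=> t s t01 s01; rewrite /g /= !i01//; exact: (plane_simple plHD eH).
have gim : g @` `[0, 1] = curve_image D e.
  apply/seteqP; split=> x [t t01 <-]; exists t => //; rewrite /g /= ?i01//.
have ends x : (x = g 0 \/ x = g 1) <-> (x = vertex_pos D u \/ x = vertex_pos D w).
  have := plane_ends plHD eH; rewrite /g /= !i01// => E.
  have -> : (x = edge_curve D e 0 \/ x = edge_curve D e 1) =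
    [set edge_curve D e 0; edge_curve D e 1] x by [].
  rewrite E; split=> [[y /= ye <-]|[->|->]].
  - by move: ye; rewrite /e in_set2 => /orP[/eqP->|/eqP->]; [left|right].
  - by exists u => //=; rewrite /e in_set2 eqxx.
  - by exists w => //=; rewrite /e in_set2 eqxx orbT.
have g01 : g 0 <> g 1 by move=> /(ig _ _ i0 i1) => h; have := ltr01 (R := R); rewrite -h ltxx.
have pu : vertex_pos D u <> vertex_pos D w by move=> /(plane_pos plHD) h; rewrite h eqxx in uw.
have [h|h] := (ends (vertex_pos D u)).2 (or_introl erefl).
  exists g; split => //.
  have [h'|//] := (ends (g 1)).1 (or_intror erefl).
  by case: g01; rewrite -h -h'.
exists (fun t => g (1 - t)).
have itv t : t \in `[0, 1] -> 1 - t \in `[0, 1].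
  by rewrite !in_itv /= => /andP[h1 h2]; apply/andP; split; lra.
split.
- move=> t; apply: (@continuous_comp _ _ _ (fun t => 1 - t) g); last exact: cg.
  by apply: cvgB; [exact: cvg_cst|exact: cvg_id].
- by move=> t s /itv ht /itv hs /(ig _ _ ht hs) hh; lra.
- by rewrite subr0.
- rewrite subrr; have [h'|//] := (ends (g 0)).1 (or_introl erefl).
  by case: g01; rewrite -h -h'.
- rewrite -gim; apply/seteqP; split=> x [t t01 <-]; first by exists (1 - t) => //; exact: itv.
  by exists (1 - t); [exact: itv|rewrite /= subKr].
Qed.

Lemma curve_image_compact e : e \in edges H -> compact (curve_image D e).
Proof.
move=> eH; apply: continuous_compact; last exact: segment_compact.
exact: (plane_continuous plHD eH).
Qed.

Lemma drawn_compact : compact drawn.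
Proof.
apply: compactU.
  by apply: finite_union_ind => [||e]; [exact: compact0|exact: compactU|exact: curve_image_compact].
by apply: finite_union_ind => [||v _]; [exact: compact0|exact: compactU|exact: compact_set1].
Qed.

Lemma drawn_closed : closed drawn.
Proof. by apply: compact_closed_norm; exact: drawn_compact. Qed.

Lemma drawn_thin : thin drawn.
Proof.
suff : closed drawn /\ thin drawn by case.
pose Q X := closed X /\ thin X.
have Q0 : Q set0.
  by split; [exact: closed0|move=> p d d0; exists p => //; rewrite subrr normr0].
have QU A B : Q A -> Q B -> Q (A `|` B).
  by move=> [cA tA] [cB tB]; split; [exact: closedU|exact: thinU].
apply: (QU _ _).
  apply: (finite_union_ind Q0 QU) => e eH; split; first by apply: compact_closed_norm; exact: curve_image_compact.
  have /eqP/cards2P[x [y [xy exy]]] := card_edge eH; rewrite exy in eH *.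
  have [g [cg ig _ _ <-]] := edge_curve_from eH; exact: thin_curve.
apply: (finite_union_ind Q0 QU) => v _; split; last exact: thin1.
by apply: compact_closed_norm; exact: compact_set1.
Qed.

Lemma curves_meet e f x : e \in edges H -> f \in edges H -> e != f ->
  curve_image D e x -> curve_image D f x ->
  exists2 y, y \in (e :&: f)%SET & x = vertex_pos D y.
Proof.
move=> eH fH ef ex fx; have [y yef <-] := plane_disjoint plHD eH fH ef (conj ex fx).
by exists y.
Qed.

End PlaneGraphs.

(** * Adding an edge inside a face *)

Section EdgeAddition.
Variable R : realType.
Local Notation pt := (R * R)%type.
Implicit Types (p q : pt) (U X Y A : set pt) (t s : R).
Variables (W : finType) (H : sgraph W) (D : drawing R W).
Hypothesis plHD : plane H D.
Local Notation pos := (vertex_pos D).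
Local Notation X := (drawn H D).

Lemma sphere_compact v (e : R) : compact [set x : pt | `|x - v| = e].
Proof.
apply: (subclosed_compact _ (@box_compact R (`|v| + e))).
  rewrite (_ : mkset _ = (fun x : pt => `|x - v|) @^-1` [set e]) //.
  apply: closed_comp; last exact: closed_eq.
  by move=> x _; apply: cvg_norm; apply: cvgB; [exact: cvg_id|exact: cvg_cst].
move=> x /= xv; apply/boxP; rewrite -(subrK v x) addrC.
by rewrite (le_trans (ler_normD _ _))// xv.
Qed.

(* The arcs issued from a vertex, cut inside a small disk, form an acyclic star;
   the star meets the rest of the drawing and the boundary of the disk in at most
   one point for each neighbour, so at most [#|W| + 1] components of the
   complement come close to the vertex. *)
Lemma vertex_locally_accessible v : locally_accessible X (pos v).
Proof.
move=> e A e0 AX aA.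
have /choice[gs Hgs] : forall w, exists gs : (R -> pt) * R, [set v; w]%SET \in edges H ->
    [/\ continuous gs.1, {in `[0, 1] &, injective gs.1}, gs.1 0 = pos v,
      gs.1 @` `[0, 1] = curve_image D [set v; w]%SET &
      [/\ 0 < gs.2, gs.2 <= 1, gs.1 1 = pos w &
        forall t, 0 <= t -> t <= gs.2 -> `|gs.1 t - pos v| < e]].
  move=> w; have [eH|eH] := boolP ([set v; w]%SET \in edges H); last by exists (fun=> 0, 0).
  have [g [cg ig g0 g1 gim]] := edge_curve_from plHD eH.
  have [d d0 Hd] := curve_near 0 cg e0.
  exists (g, Num.min 1 (d / 2)) => _; split=> //=; split.
  - by rewrite lt_min ltr01; lra.
  - by rewrite ge_min lexx.
  - exact: g1.
  - move=> t t0; rewrite le_min => /andP[_ td]; rewrite -g0; apply: Hd.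
    by rewrite subr0 ger0_norm//; lra.
pose N w := [set v; w]%SET \in edges H.
pose g w := (gs w).1; pose s w := (gs w).2.
pose S := [set x | exists2 w, N w & (g w @` `[0, s w]) x] `|` [set pos v].
(* [Y] avoids [v]: it consists of the sphere of radius [e], the outer parts of the cut edges, the
   edges not at [v] and the other vertices. *)
pose Y := [set x : pt | `|x - pos v| = e] `|`
  ([set x | exists2 w, N w & (g w @` `[s w, 1]) x] `|`
  ([set x | exists2 f, (f \in edges H) && (v \notin f) & curve_image D f x] `|`
   [set x | exists2 w, w != v & [set pos w] x])).
have gE w t : N w -> t \in `[0, 1] -> curve_image D [set v; w]%SET (g w t).
  by move=> Nw t01; have [_ _ _ <- _] := Hgs w Nw; exists t.
have s01 w t : N w -> t \in `[0, s w] -> t \in `[0, 1].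
  move=> Nw; have [_ _ _ _ [_ s1 _ _]] := Hgs w Nw.
  by rewrite !in_itv /= => /andP[-> /le_trans]; exact.
have s01' w t : N w -> t \in `[s w, 1] -> t \in `[0, 1].
  move=> Nw; have [_ _ _ _ [s0 _ _ _]] := Hgs w Nw.
  by rewrite !in_itv /= => /andP[h ->]; rewrite andbT (le_trans (ltW s0)).
have meet w w' t t' : N w -> N w' -> w != w' -> t \in `[0, 1] -> t' \in `[0, 1] ->
    g w t = g w' t' -> g w t = pos v.
  move=> Nw Nw' ww' t01 t'01 E.
  have [||y yef ->] := curves_meet plHD Nw Nw' _ (gE _ _ Nw t01).
  - apply/eqP => /setP/(_ w); rewrite !in_set2 eqxx orbT => /esym/orP[/eqP wv|/eqP wv].
      by have := edge_neq Nw; rewrite wv eqxx.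
    by rewrite wv eqxx in ww'.
  - by rewrite E; exact: gE.
  move: yef; rewrite inE !in_set2 => /andP[/orP[/eqP->//|/eqP->] /orP[/eqP->//|/eqP ww]].
  by rewrite ww eqxx in ww'.
have g0 w t : N w -> t \in `[0, 1] -> g w t = pos v -> t = 0.
  move=> Nw t01; have [_ ig <- _ _] := Hgs w Nw; apply: ig => //.
  by rewrite in_itv /= lexx ler01.
have aS : acyclic S.
  apply: (@acyclicU _ _ _ (pos v)); last by move=> x _ ->.
    apply: (@acyclic_star _ _ _ _ (pos v)).
      move=> w Nw; have [cg ig _ _ _] := Hgs w Nw; apply: acyclic_curve => //.
      by move=> t t' /(s01 _ _ Nw) h /(s01 _ _ Nw) h'; exact: ig.
    move=> w w' x Nw Nw' ww' [t ts <-] [t' ts' E].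
    exact: (meet w w' t t' Nw Nw' ww' (s01 _ _ Nw ts) (s01 _ _ Nw' ts') (esym E)).
  exact: acyclic1.
have cY : compact Y.
  apply: compactU; first exact: sphere_compact.
  apply: compactU.
    apply: finite_union_ind => [||w Nw]; [exact: compact0|exact: compactU|].
    have [cg _ _ _ _] := Hgs w Nw; apply: continuous_compact; last exact: segment_compact.
    exact: continuous_subspaceT.
  apply: compactU.
    by apply: finite_union_ind => [||f /andP[fH _]]; [exact: compact0|exact: compactU|exact: curve_image_compact fH].
  by apply: finite_union_ind => [||w _]; [exact: compact0|exact: compactU|exact: compact_set1].
have nYv : ~ Y (pos v).
  case=> [/=|[[w Nw [t ts E]]|[[f /andP[fH vf] fv]|[w wv E]]]].
  - by rewrite subrr normr0 => e00; rewrite e00 ltxx in e0.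
  - have t0 := g0 w t Nw (s01' _ _ Nw ts) E; have [_ _ _ _ [s0 _ _ _]] := Hgs w Nw.
    by move: ts; rewrite t0 /= in_itv /= leNgt s0.
  - by move: vf; rewrite (plane_vertex plHD fH fv).
  - by move/(plane_pos plHD): E wv => ->; rewrite eqxx.
have XSY : X `<=` S `|` Y.
  move=> x [[f fH fx]|[w _ ->]]; last first.
    have [->|wv] := eqVneq w v; first by left; right.
    by right; right; right; right; exists w.
  have [vf|vf] := boolP (v \in f); last first.
    by right; right; right; left; exists f => //; rewrite fH.
  have [w _ fE] := edge_ends fH vf; rewrite fE in fH fx.
  have [_ _ _ gim _] := Hgs w fH; move: fx; rewrite -gim => -[t t01 <-].
  move: (t01); rewrite /= in_itv /= => /andP[t0 t1].
  have [ts|ts] := leP t (s w).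
    by left; left; exists w => //; exists t => //=; rewrite in_itv /= t0.
  by right; right; left; exists w => //; exists t => //=; rewrite in_itv /= t1 ltW.
have SX : S `<=` X.
  move=> x [[w Nw [t ts <-]]|->]; last exact: drawn_vertex.
  by apply: (drawn_edge Nw); apply: gE => //; exact: (s01 _ _ Nw ts).
(* The last index falls on the default vertex and gives the index set the form [m + 1]. *)
pose q (i : 'I_(#|W|.+1)) := let w := nth v (enum W) i in g w (s w).
have SYq x : S x -> Y x -> exists j, x = q j.
  have qw w : exists j, g w (s w) = q j.
    have wi : (index w (enum W) < #|W|.+1)%N by rewrite ltnS cardE index_size.
    by exists (Ordinal wi); rewrite /q /= nth_index// mem_enum.
  move=> [[w Nw [t ts <-]]|->] // Yx.
  have [_ ig _ _ [s0 s1 g1 sb]] := Hgs w Nw.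
  suff -> : t = s w by exact: qw.
  move: (ts); rewrite /= in_itv /= => /andP[t0 tsw].
  have t01 := s01 _ _ Nw ts.
  case: Yx => [/= E|[[w' Nw' [t' ts' E]]|[[f /andP[fH vf] fx]|[w' w'v E]]]].
  - by have := sb t t0 tsw; rewrite -E ltxx.
  - have t'01 := s01' _ _ Nw' ts'.
    have [ww|ww] := eqVneq w w'.
      move: ts'; rewrite -ww in E t'01 *; rewrite /= in_itv /= (ig _ _ t'01 t01 E) => /andP[h _].
      by apply/eqP; rewrite eq_le tsw.
    have := meet w w' t t' Nw Nw' ww t01 t'01 (esym E); rewrite -E => /(g0 _ _ Nw' t'01) t'0.
    have [_ _ _ _ [s0' _ _ _]] := Hgs w' Nw'.
    by move: ts'; rewrite t'0 /= in_itv /= leNgt s0'.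
  - have vw : [set v; w]%SET != f by apply: contraNneq vf => <-; rewrite in_set2 eqxx.
    have [y yef E] := curves_meet plHD Nw fH vw (gE _ _ Nw t01) fx.
    move: yef; rewrite inE in_set2 => /andP[/orP[/eqP yv|/eqP yw] yf].
      by rewrite -yv yf in vf.
    have t1 : t = 1; last by apply/eqP; rewrite eq_le tsw t1 s1.
    by apply: ig => //; rewrite ?in_itv /= ?lexx ?ler01//= g1 -/(g w t) E yw.
  - have t1 : t = 1; last by apply/eqP; rewrite eq_le tsw t1 s1.
    apply: ig => //; rewrite ?in_itv /= ?lexx ?ler01//= g1 -/(g w t).
    have := gE _ _ Nw t01; rewrite E => /(plane_vertex plHD Nw).
    by rewrite in_set2 (negbTE w'v) /= => /eqP ->.
(* Points within [d] of the vertex lie in a disk free of [Y], so the differences of their angles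
   lift on [Y]; from points within [e], chains stay in the ball, since its sphere belongs to [Y]. *)
have [d d0 Hd] := closed_far (compact_closed_norm cY) nYv.
have [|||c [Ac cd ac]] := @adherent_pigeonhole R A (pos v)
    (chain (punctured_near X (pos v) e)) #|W|.+2 (Num.min d e) _ aA;
  last by exists c; split => //; move: cd; rewrite lt_min => /andP[].
- by rewrite lt_min d0.
- by move=> p r; exact: chain_sym.
move=> z Hz.
have zA i : A (z i) by have [] := Hz i.
have zd i : `|z i - pos v| < d by have [_] := Hz i; rewrite lt_min => /andP[].
have ze i : `|z i - pos v| < e by have [_] := Hz i; rewrite lt_min => /andP[].
have nSz i : ~ S (z i) by move=> /SX; exact: AX.
have nYz i : ~ Y (z i) by apply: Hd.
have [i|i [j [ij cij]]] := acyclic_separation aS cY SYq nSz nYz.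
  apply: liftable_chain => //; apply: chain_segment => t t01; apply: Hd.
  exact: (segment_ball (zd i) (zd ord0)).
exists i, j; split => //.
apply: chain_sub (chain_stay (v := pos v) (e := e) _ (ze i) cij).
  by move=> x [xe nSYx]; split => // /XSY.
by move=> x nSYx; apply/eqP => xe; apply: nSYx; right; left.
Qed.

(** Both vertices are accessible by arcs from the face of [c]; a polygonal path in the face joins
    the two arcs, and [arc_concat] makes the result simple. It can meet the drawing only at [u] and
    [w]. *)
Lemma plane_add_edge u w c : u != w -> [set u; w]%SET \notin edges H -> ~ X c ->
  adherent (chain (~` X) c) (pos u) -> adherent (chain (~` X) c) (pos w) ->
  exists (H' : sgraph W) (D' : drawing R W),
    [/\ adds_edge H [set u; w]%SET H', extends H D D' & plane H' D'].
Proof.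
move=> uw nuw nXc au aw.
have puw : pos u != pos w by apply: contra_neq uw => /(plane_pos plHD).
have cX : chain (~` X) c `<=` ~` X by move=> x /chain_r.
have [a1 [c1 [ca1 ac1 arc1]]] := locally_accessible_arc (drawn_vertex _ _ u)
  (@vertex_locally_accessible u) cX au.
have [a2 [c2 [ca2 ac2 arc2]]] := locally_accessible_arc (drawn_vertex _ _ w)
  (@vertex_locally_accessible w) cX aw.
pose U := [set x : pt | X x -> x = pos u \/ x = pos w].
have U1 : [set x | x = pos u \/ ~ X x] `<=` U by move=> x [->|nXx Xx] //=; left.
have U2 : [set x | x = pos w \/ ~ X x] `<=` U by move=> x [->|nXx Xx] //=; right.
have nX x y : chain (~` X) x y -> forall v, pos v != y.
  by move=> /chain_r nXy v; apply/eqP => vy; apply: nXy; rewrite -vy; exact: drawn_vertex.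
have c12 : chain (~` X) c1 c2.
  exact: chain_trans (chain_sym ac1) (chain_trans (chain_sym ca1) (chain_trans ca2 ac2)).
have arcu : arc U (pos u) c2.
  have arcu1 := arc_sub U1 (arc_rev arc1).
  have [<-//|c12'] := eqVneq c1 c2.
  apply: arc_concat arcu1 (arc_sub _ (chain_arc c12' c12)); first exact: nX ac2 u.
  by move=> x nXx.
have [g [cg ig g0 g1 gU]] := arc_concat puw arcu (arc_sub U2 arc2).
have card_new e : e \in ([set u; w] |: edges H)%SET -> #|e| = 2%N.
  by rewrite in_setU1 => /orP[/eqP->|]; [rewrite cards2 uw|exact: card_edge].
pose H' := SGraph card_new.
pose D' := Drawing pos (fun e => if e == [set u; w]%SET then g else edge_curve D e).
have oldN e : e \in edges H -> (e == [set u; w]%SET) = false.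
  by move=> eH; apply: contraNF nuw => /eqP<-.
have oldE e : e \in edges H -> curve_image D' e = curve_image D e.
  by move=> eH; rewrite /curve_image /= oldN.
have newE : curve_image D' [set u; w]%SET = g @` `[0, 1].
  by rewrite /curve_image /= eqxx.
have edgesH' e : e \in edges H' -> e = [set u; w]%SET \/ e \in edges H.
  by rewrite /H' /= in_setU1 => /orP[/eqP->|]; [left|right].
have gvertex v t : t \in `[0, 1] -> g t = pos v -> v \in [set u; w]%SET.
  move=> t01 gt; have := gU t t01; rewrite gt => /(_ (drawn_vertex _ _ v)).
  by rewrite in_set2 => -[] /(plane_pos plHD) ->; rewrite eqxx ?orbT.
have meet_new f x : f \in edges H -> (g @` `[0, 1]) x -> curve_image D f x ->
    (pos @` [set` ([set u; w] :&: f)%SET]) x.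
  move=> fH [t t01 <-] fx; have := gU t t01 (drawn_edge fH fx).
  case=> gt; [exists u|exists w]; rewrite //= finset.in_setI in_set2 eqxx ?orbT /=;
    by apply: (plane_vertex plHD fH); rewrite -gt.
exists H', D'; split.
- by split.
- split=> // e eH t t01; by rewrite /= oldN.
split.
- exact: (plane_pos plHD).
- move=> e /edgesH'[->|eH] /=; first by rewrite eqxx; exact: continuous_subspaceT.
  by rewrite oldN//; exact: (plane_continuous plHD eH).
- move=> e /edgesH'[->|eH] /=; first by rewrite eqxx.
  by rewrite oldN//; exact: (plane_simple plHD eH).
- move=> e /edgesH'[->|eH] /=; last by rewrite oldN//; exact: (plane_ends plHD eH).
  rewrite eqxx g0 g1; apply/seteqP; split=> x.
    by move=> [->|->]; [exists u|exists w]; rewrite //= in_set2 eqxx ?orbT.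
  by move=> [y /=]; rewrite in_set2 => /orP[/eqP->|/eqP->] <-; [left|right].
- move=> e v /edgesH'[->|eH]; last by rewrite oldE//; exact: (plane_vertex plHD eH).
  by rewrite newE => -[t t01]; exact: gvertex.
- move=> e f /edgesH'[->|eH] /edgesH'[->|fH]; rewrite ?eqxx//.
  + by move=> _; rewrite newE oldE// => x [gx fx]; exact: meet_new.
  + by move=> _; rewrite newE oldE// => x [ex gx]; rewrite finset.setIC; exact: meet_new.
  + by rewrite !oldE//; exact: (plane_disjoint plHD eH fH).
Qed.

End EdgeAddition.

(** * Faces and forests *)

Section Faces.
Variable R : realType.
Local Notation pt := (R * R)%type.
Implicit Types (p q : pt) (U X Y A F : set pt) (t s : R).
Variables (W : finType) (H : sgraph W) (D : drawing R W).
Hypothesis plHD : plane H D.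
Local Notation pos := (vertex_pos D).
Local Notation X := (drawn H D).

Lemma vertex_face v : exists2 c, ~ X c & adherent (chain (~` X) c) (pos v).
Proof.
have aX : adherent (~` X) (pos v).
  by move=> d d0; have [q qv nXq] := drawn_thin plHD (pos v) d0; exists q.
have [c [nXc _ ac]] := vertex_locally_accessible plHD ltr01 (fun x h => h) aX.
exists c => //; apply: adherent_sub ac => z [_]; apply: chain_sub => x [] //.
Qed.

Lemma adherent_closed A x : ~ adherent A x ->
  exists2 d : R, 0 < d & forall y, `|y - x| < d -> ~ adherent A y.
Proof.
move=> nA; have [d d0 Hd] : exists2 d : R, 0 < d & forall z, A z -> d <= `|z - x|.
  apply: contrapT => H'; apply: nA => d d0; apply: contrapT => nz; apply: H'.
  by exists d => // z Az; rewrite leNgt; apply/negP => zx; apply: nz; exists z.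
exists (d / 2) => [|y yx ay]; first lra.
have d20 : 0 < d / 2 by lra.
have [z Az zy] := ay _ d20; have := Hd z Az.
have := ler_normD (z - y) (y - x); rewrite subrKA; lra.
Qed.

Definition union_of_faces F :=
  F `<=` ~` X /\ forall z w, F z -> chain (~` X) z w -> F w.

Lemma union_of_faces_chain c : union_of_faces (chain (~` X) c).
Proof. by split=> [x /chain_r//|z w]; exact: chain_trans. Qed.

Lemma union_of_faces_closedC F : union_of_faces F -> closed (~` F).
Proof.
move=> [FX Fsat]; apply: open_closedC; rewrite openE => z Fz.
have [d d0 Hd] := chain_open (drawn_closed plHD) (chain_nil (FX z Fz)).
apply/nbhs_ballP; exists d => //= y; rewrite -ball_normE /= distrC => /Hd.
exact: Fsat.
Qed.

(* [F] is closed and open in the complement of any set that contains the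
   boundary of [F]. *)
Lemma union_of_faces_boundary F (Z : set pt) c z : union_of_faces F ->
  (forall x, X x -> adherent F x -> Z x) -> F c -> chain (~` Z) c z -> F z.
Proof.
move=> uF XZ Fc cz; elim: cz Fc => // p q {}z pq _ IH Fp; apply: IH.
apply: contrapT => nFq; have [FX Fsat] := uF.
pose g t := p + t *: (q - p).
have cg : continuous g.
  move=> t; apply: cvgD; first exact: cvg_cst.
  by apply: cvgZ; [exact: cvg_id|exact: cvg_cst].
(* The first point outside [F] is adherent to [F]. On [X] it would belong to [Z]; off [X] it would
   lie in a face that meets [F], hence in [F]. *)
have [|s [s0 s1 nFs smin]] := first_hit cg (union_of_faces_closedC uF) ler01.
  by rewrite /g scale1r subrKC.
have {}s0 : 0 < s.
  by rewrite lt_def s0 andbT; apply/eqP => s00; apply: nFs; rewrite s00 /g scale0r addr0.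
have as_ : adherent F (g s).
  move=> d d0; have [e e0 He] := curve_near s cg d0.
  pose t := Num.max 0 (s - e / 2).
  have t0 : 0 <= t by rewrite le_max lexx.
  have ts : t < s by rewrite gt_max s0; lra.
  have ets : s - e / 2 <= t by rewrite le_max lexx orbT.
  exists (g t); last by apply: He; rewrite ltr_norml; apply/andP; split; lra.
  have t1 : t <= 1 by lra.
  by apply: contrapT => nFt; have := smin t t0 t1 nFt; lra.
have nXs : ~ X (g s).
  by move=> Xs; apply: (pq s); [rewrite s1 ltW|exact: XZ].
have [d d0 Hd] := chain_open (drawn_closed plHD) (chain_nil nXs : chain (~` X) _ _).
by have [y Fy /Hd /chain_sym yz] := as_ d d0; apply: nFs; exact: Fsat yz.
Qed.

(** An end that is not in the closure of [F] has a neighbourhood free of that closure, so the edge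
    can be cut there without losing boundary points. *)
Lemma truncated_edge F e : e \in edges H -> exists T : set pt,
  [/\ acyclic T, T `<=` curve_image D e,
      forall x, curve_image D e x -> adherent F x -> T x &
      forall v, T (pos v) -> adherent F (pos v)].
Proof.
move=> eH; have /eqP/cards2P[u [w [uw euw]]] := card_edge eH.
rewrite euw in eH *; have [g [cg ig g0 g1 gim]] := edge_curve_from plHD eH.
have cut (h : R -> pt) : continuous h -> exists s, [/\ 0 <= s, s < 2^-1,
    (forall t, 0 <= t -> t < s -> ~ adherent F (h t)) & s = 0 -> adherent F (h 0)].
  move=> ch; have [ah|nah] := pselect (adherent F (h 0)).
    by exists 0; split => // t t0; rewrite ltNge t0.
  have [d d0 Hd] := adherent_closed nah; have [e' e0 He] := curve_near 0 ch d0.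
  (* The bound 1/4 keeps the cuts at the two ends apart. *)
  pose s := Num.min (4^-1) (e' / 2); have s0 : 0 < s by rewrite lt_min; apply/andP; split; lra.
  have s4 : s <= 4^-1 by rewrite ge_min lexx.
  have se : s <= e' / 2 by rewrite ge_min lexx orbT.
  exists s; split; [exact: ltW|lra| |by move=> s00; rewrite s00 ltxx in s0].
  by move=> t t0 ts; apply/Hd/He; rewrite subr0 ger0_norm//; lra.
have [s [s0 s2 sF sa]] := cut g cg.
have [|r [r0 r2 rF ra]] := cut (fun t => g (1 - t)).
  move=> t; apply: (@continuous_comp _ _ _ (fun t => 1 - t) g); last exact: cg.
  by apply: cvgB; [exact: cvg_cst|exact: cvg_id].
have i01 t : t \in `[s, 1 - r] -> t \in `[0, 1].
  by rewrite !in_itv /= => /andP[h1 h2]; apply/andP; split; lra.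
exists (g @` `[s, 1 - r]); split.
- by apply: acyclic_curve => // t t' /i01 h /i01 h'; exact: ig.
- by move=> x [t /i01 t01 <-]; rewrite -gim; exists t.
- move=> x; rewrite -gim => -[t t01 <-] at_; exists t => //.
  move: t01; rewrite /= !in_itv /= => /andP[t0 t1]; apply/andP; split.
    by rewrite leNgt; apply/negP => /(sF t t0).
  rewrite leNgt; apply/negP => rt; apply: (rF (1 - t)); [lra|lra|].
  by rewrite subKr.
- move=> v [t t01 gt]; have t01' := i01 _ t01.
  have : v \in [set u; w]%SET by apply: (plane_vertex plHD eH); rewrite -gim; exists t.
  rewrite in_set2 => /orP[/eqP vE|/eqP vE]; subst v.
    have t00 : t = 0 by apply: ig; rewrite ?gt ?g0// in_itv /= lexx ler01.
    rewrite -g0; apply: sa; move: t01; rewrite t00 /= in_itv /= => /andP[]; lra.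
  have t00 : t = 1 by apply: ig; rewrite ?gt ?g1// in_itv /= lexx ler01.
  rewrite -g1 -[1](subr0 1); apply: ra; move: t01; rewrite t00 /= in_itv /= => /andP[]; lra.
Qed.

End Faces.

(** * Forests of truncated edges *)

Section Forest.
Variable R : realType.
Local Notation pt := (R * R)%type.
Variables (W : finType) (H : sgraph W) (D : drawing R W).
Hypothesis plHD : plane H D.
Local Notation pos := (vertex_pos D).
Variables (F : set pt) (T : {set W} -> set pt).
Hypothesis TP : forall e, e \in edges H ->
  [/\ acyclic (T e), T e `<=` curve_image D e,
      forall x, curve_image D e x -> adherent F x -> T e x &
      forall v, T e (pos v) -> adherent F (pos v)].

Lemma truncated_meet e f x : e \in edges H -> f \in edges H -> e != f ->
  T e x -> T f x -> exists y, [/\ y \in e, y \in f, x = pos y & adherent F (pos y)].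
Proof.
move=> eH fH ef ex fx; have [_ eT _ ea] := TP eH; have [_ fT _ _] := TP fH.
have [y] := curves_meet plHD eH fH ef (eT _ ex) (fT _ fx).
rewrite finset.in_setI => /andP[ye yf] xy; exists y; split => //.
by apply: ea; rewrite -xy.
Qed.

Lemma truncated_vertex e v : e \in edges H -> T e (pos v) -> v \in e.
Proof. by move=> eH ev; have [_ eT _ _] := TP eH; apply: (plane_vertex plHD eH); exact: eT. Qed.

Lemma truncated_star (v : W) (P : pred W) :
  (forall u, P u -> [set u; v]%SET \in edges H) ->
  acyclic [set x | exists2 u, P u & T [set u; v]%SET x].
Proof.
move=> PH; apply: (@acyclic_star _ _ _ _ (pos v)).
  by move=> u /PH/TP[].
move=> u u' x Pu Pu' uu' ux u'x.
have [|y [yu yu' -> _]] := truncated_meet (PH _ Pu) (PH _ Pu') _ ux u'x.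
  apply: contraNneq uu' => /setP/(_ u); rewrite !in_set2 eqxx /=.
  by move=> /esym/orP[//|/eqP uv]; have := edge_neq (PH _ Pu); rewrite uv eqxx.
move: yu yu'; rewrite !in_set2 => /orP[/eqP->|/eqP->//] /orP[uu|/eqP->//].
by rewrite uu in uu'.
Qed.

Variable lab : W -> nat.
Hypothesis lab_inj : injective lab.

(* Adding the vertices in increasing order, each new star meets the union of the
   previous ones at most in the vertex whose label precedes its own. *)
Lemma truncated_forest (E : pred {set W}) (V : pred W) :
  (forall u v, [set u; v]%SET \in edges H -> E [set u; v]%SET -> (lab u < lab v)%N ->
     adherent F (pos u) -> lab v = (lab u).+1) ->
  acyclic ([set x | exists2 e, (e \in edges H) && E e & T e x] `|`
           [set x | exists2 v, V v & [set pos v] x]).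
Proof.
move=> EF.
(* Every edge is attributed to its end with the larger label; [K i] is the star of truncated edges
   attributed to the vertex labelled [i], with that vertex itself if it is in [V]. *)
pose P v u := [&& [set u; v]%SET \in edges H, E [set u; v]%SET & (lab u < lab v)%N].
pose K i := [set x | exists v, lab v = i /\
  ((exists2 u, P v u & T [set u; v]%SET x) \/ (V v /\ x = pos v))].
pose N := (\max_v lab v).+1.
have labN v : (lab v < N)%N by rewrite ltnS; exact: (leq_bigmax v).
(* [q i] is the vertex labelled [i - 1], or 0 if there is none. *)
have /choice[q Hq] : forall i, exists q : pt, forall v, i = (lab v).+1 -> q = pos v.
  move=> i; have [[v ->]|nv] := pselect (exists v, i = (lab v).+1).
    by exists (pos v) => v' /eqP; rewrite eqSS => /eqP/lab_inj ->.
  by exists 0 => v iv; case: nv; exists v.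
rewrite (_ : _ `|` _ = [set x | exists2 i, (i < N)%N & K i x]); last first.
  apply/seteqP; split=> x.
    case=> [[e /andP[eH Ee] ex]|[v Vv ->]]; last first.
      by exists (lab v) => //; exists v; split => //; right.
    have /eqP/cards2P[u [v [uv euv]]] := card_edge eH.
    wlog luv : u v uv euv / (lab u < lab v)%N.
      move=> hw; have [luv|lvu|luv] := ltngtP (lab u) (lab v).
      - exact: hw luv.
      - by apply: hw lvu; [rewrite eq_sym|rewrite euv finset.setUC].
      - by move: uv; rewrite (lab_inj luv) eqxx.
    exists (lab v) => //; exists v; split => //; left; exists u; last by rewrite -euv.
    by rewrite /P -euv eH Ee.
  move=> [i _ [v [_ [[u /and3P[eH Ee _] ex]|[Vv ->]]]]]; last by right; exists v.
  by left; exists [set u; v]%SET => //; rewrite eH.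
apply: (@acyclic_sequence _ K q) => [i _|i j x /andP[ji _]].
  have [[v vi]|nv] := pselect (exists v, lab v = i); last first.
    rewrite (_ : K i = set0); first exact: acyclic0.
    by apply/seteqP; split=> x // [v [vi _]]; apply: nv; exists v.
  have aP : acyclic [set x | exists2 u, P v u & T [set u; v]%SET x].
    by apply: truncated_star => u /and3P[].
  have [Vv|nVv] := boolP (V v).
    rewrite (_ : K i = [set x | exists2 u, P v u & T [set u; v]%SET x] `|` [set pos v]).
      by apply: (@acyclicU _ _ _ (pos v)) => //; exact: acyclic1.
    apply/seteqP; split=> x; last first.
      by case=> [h|->]; exists v; split=> //; [left|right].
    by move=> [v' [v'i]]; rewrite -vi in v'i; rewrite (lab_inj v'i) => -[h|[_ ->]]; [left|right].
  rewrite (_ : K i = [set x | exists2 u, P v u & T [set u; v]%SET x]) //.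
  apply/seteqP; split=> x; last by move=> h; exists v; split=> //; left.
  move=> [v' [v'i]]; rewrite -vi in v'i; rewrite (lab_inj v'i) => -[//|[Vv]].
  by rewrite Vv in nVv.
move=> [v [vi Kv]] [v' [v'j Kv']]; subst i j.
case: Kv => [[u /and3P[eH Ee uv] ex]|[_ xv]]; last first.
  case: Kv' => [[u' /and3P[e'H _ u'v'] e'x]|[_ xv']].
    have := truncated_vertex e'H; rewrite xv in e'x => /(_ _ e'x).
    rewrite in_set2 => /orP[/eqP vu'|/eqP vv']; last by rewrite vv' ltnn in ji.
    by have := ltn_trans u'v' ji; rewrite vu' ltnn.
  by move: ji; rewrite xv in xv'; rewrite (plane_pos plHD xv') ltnn.
have key y : y \in [set u; v]%SET -> (lab y < lab v)%N -> adherent F (pos y) -> pos y = q (lab v).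
  rewrite in_set2 => /orP[/eqP->|/eqP->]; last by rewrite ltnn.
  by move=> luv au; apply/esym/Hq; exact: EF.
case: Kv' => [[u' /and3P[e'H _ u'v'] e'x]|[_ xv']]; last first.
  rewrite xv' in ex *; apply: key ji _; first exact: truncated_vertex ex.
  by have [_ _ _] := TP eH; apply.
have ef : [set u; v]%SET != [set u'; v']%SET.
  apply/eqP => /setP/(_ v); rewrite !in_set2 eqxx orbT => /esym/orP[/eqP vu'|/eqP vv'].
    by have := ltn_trans u'v' ji; rewrite vu' ltnn.
  by rewrite vv' ltnn in ji.
have [y [yuv yuv' -> ay]] := truncated_meet eH e'H ef ex e'x.
apply: key => //; move: yuv'; rewrite in_set2 => /orP[/eqP->|/eqP->//].
exact: ltn_trans ji.
Qed.

End Forest.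

(** * Hubs on the boundary of a face and the faces of leaves *)

Section Hubs.
Variable R : realType.
Local Notation pt := (R * R)%type.
Variables (W : finType) (H : sgraph W) (D : drawing R W).
Hypothesis plHD : plane H D.
Local Notation pos := (vertex_pos D).
Local Notation X := (drawn H D).
Variables (lab : W -> nat) (a b : W).
Hypothesis lab_inj : injective lab.
Hypothesis lab_small : forall u, (lab u < 2)%N -> u = a \/ u = b.
Hypothesis hub_neq : a != b.
Hypothesis edge_lab : forall u v, [set u; v]%SET \in edges H -> (lab u < lab v)%N ->
  (lab u < 2)%N \/ lab v = (lab u).+1.

Lemma truncation (F : set pt) : exists T : {set W} -> set pt,
  forall e, e \in edges H ->
  [/\ acyclic (T e), T e `<=` curve_image D e,
      forall x, curve_image D e x -> adherent F x -> T e x &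
      forall v, T e (pos v) -> adherent F (pos v)].
Proof.
have /choice[T HT] : forall e : {set W}, exists T : set pt, e \in edges H ->
  [/\ acyclic T, T `<=` curve_image D e,
      forall x, curve_image D e x -> adherent F x -> T x &
      forall v, T (pos v) -> adherent F (pos v)].
  move=> e; have [eH|] := boolP (e \in edges H); last by exists set0.
  by have [T ?] := truncated_edge plHD F eH; exists T.
by exists T.
Qed.

(* Away from both hubs the graph is a forest of paths, which does not separate
   the plane. *)
Lemma face_hub (F : set pt) c : union_of_faces H D F -> F c ->
  adherent F (pos a) \/ adherent F (pos b).
Proof.
move=> uF Fc; apply: contrapT => /not_orP[na nb].
have [T TP] := truncation F.
pose V v := `[< adherent F (pos v) >].
have aZ := @truncated_forest _ _ _ _ plHD _ _ TP _ lab_inj predT V.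
set Z := _ `|` _ in aZ.
have {}aZ : acyclic Z.
  apply: aZ => u v eH _ luv au; have [/lab_small[ua|ub]|//] := edge_lab eH luv.
    by rewrite ua in au.
  by rewrite ub in au.
have ZX : Z `<=` X.
  move=> x [[e /andP[eH _] ex]|[v _ ->]]; last exact: drawn_vertex.
  by have [_ eT _ _] := TP e eH; apply: (drawn_edge eH); exact: eT.
have XZ x : X x -> adherent F x -> Z x.
  move=> [[e eH ex]|[v _ ->]] ax; last by right; exists v => //; apply/asboolP.
  by left; exists e; [rewrite eH|have [_ _ + _] := TP e eH; apply].
have nZa : ~ Z (pos a).
  case=> [[e /andP[eH _] ex]|[v /asboolP Vv E]]; last by rewrite -E in Vv.
  by have [_ _ _ /(_ a ex)] := TP e eH.
have nZc : ~ Z c by move=> /ZX; have [FX _] := uF; exact: FX.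
(* [Z] does not separate [c] from the untouched hub, so [F] would contain a point of the drawing. *)
have := union_of_faces_boundary plHD uF XZ Fc (acyclic_chain aZ nZc nZa).
by have [FX _] := uF; move=> /FX; apply; exact: drawn_vertex.
Qed.

(* The star at [a] meets the rest of the boundary of the faces of the leaves at
   most in [U], so that it cuts out at most [#|U|] of their components. *)
Lemma leaf_faces_bound (L U : {set W}) (cc : W -> pt) :
  let F := [set z | exists2 w, w \in L & chain (~` X) (cc w) z] in
  (forall w, w \in L -> ~ X (cc w)) ->
  (forall w w', w \in L -> w' \in L -> chain (~` X) (cc w) (cc w') -> w = w') ->
  ~ adherent F (pos b) ->
  (forall v, adherent F (pos v) -> [\/ v = a, v \in U | v \in L]) ->
  (forall w, w \in L -> [set a; w]%SET \in edges H) ->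
  (forall w e, w \in L -> e \in edges H -> w \in e -> e = [set a; w]%SET) ->
  (#|L| <= #|U|)%N.
Proof.
move=> F ccX cc_inj nb aF La Le; rewrite leqNgt; apply/negP => UL.
have FX : F `<=` ~` X by move=> x [w _ /chain_r].
have [T TP] := truncation F.
pose N u := [set a; u]%SET \in edges H.
pose S := [set x | exists2 u, N u & T [set a; u]%SET x] `|` [set pos a].
(* Leaves are left to [S], which contains their truncated edges; in [Y] they would become additional
   meeting points. *)
pose V v := [&& `[< adherent F (pos v) >], v != a & v \notin L].
pose Y := [set x | exists2 e, (e \in edges H) && (a \notin e) & T e x] `|`
           [set x | exists2 v, V v & [set pos v] x].
have aS : acyclic S.
  have N' u : N u -> [set u; a]%SET \in edges H by rewrite finset.setUC.
  have aS := truncated_star plHD TP N'.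
  apply: (@acyclicU _ _ _ (pos a)); [|exact: acyclic1|by move=> x _ ->].
  congr acyclic: aS; apply/seteqP; split=> x [u Nu]; rewrite finset.setUC => ux; by exists u.
have aY : acyclic Y.
  apply: (@truncated_forest _ _ _ _ plHD _ _ TP _ lab_inj (fun e => a \notin e) V) => u v eH ae luv au.
  have [/lab_small[ua|ub]|//] := edge_lab eH luv; last by rewrite ub in au.
  by move: ae; rewrite in_set2 ua eqxx.
have ZX : S `|` Y `<=` X.
  have TX e : e \in edges H -> T e `<=` X.
    by move=> eH x ex; have [_ eT _ _] := TP e eH; apply: (drawn_edge eH); exact: eT.
  move=> x [[[u Nu]|->]|[[e /andP[eH _]]|[v _ ->]]]; try exact: drawn_vertex; exact: TX.
have XZ x : X x -> adherent F x -> (S `|` Y) x.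
  have TZ e : e \in edges H -> T e `<=` S `|` Y.
    move=> eH y ey; have [ae|nae] := boolP (a \in e); last first.
      by right; left; exists e => //; rewrite eH.
    have [u _ eE] := edge_ends eH ae; rewrite eE in eH ey.
    by left; left; exists u.
  have eZ e y : e \in edges H -> curve_image D e y -> adherent F y -> (S `|` Y) y.
    by move=> eH ey ay; apply: (TZ e eH); have [_ _ + _] := TP e eH; apply.
  move=> [[e eH ex]|[v _ ->]] ax; first exact: eZ ex ax.
  have [->|va] := eqVneq v a; first by left; right.
  have [vL|vL] := boolP (v \in L); last first.
    by right; right; exists v => //; apply/and3P; split => //; apply/asboolP.
  apply: (eZ _ _ (La v vL)) => //.
  have [g [_ _ _ g1 <-]] := edge_curve_from plHD (La v vL).
  by exists 1 => //=; rewrite in_itv /= lexx ler01.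
have SYU x : S x -> Y x -> exists2 u, u \in U & x = pos u.
  have inU v : adherent F (pos v) -> v != a -> v \notin L -> v \in U.
    by move=> av va vL; case: (aF v av) => //; [move=> e; rewrite e eqxx in va|move=> h; rewrite h in vL].
  move=> Sx [[e /andP[eH ae] ex]|[v /and3P[/asboolP av va vL] ->]]; last first.
    by exists v => //; exact: inU.
  case: Sx => [[u Nu ux]|xa]; last first.
    have := truncated_vertex plHD TP eH; rewrite xa in ex => /(_ _ ex) h.
    by rewrite h in ae.
  have ef : [set a; u]%SET != e by apply: contraNneq ae => <-; rewrite in_set2 eqxx.
  have [y [yau ye -> ay]] := truncated_meet plHD TP Nu eH ef ux ex.
  have ya : y != a by apply: contraNneq ae => <-.
  exists y => //; apply: inU => //; apply/negP => yL.
  by move: ae; rewrite (Le y e yL eH ye) in_set2 eqxx.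
have nbZ : ~ (S `|` Y) (pos b).
  have TZ e : e \in edges H -> ~ T e (pos b) by move=> eH eb; have [_ _ _ /(_ b eb)] := TP e eH.
  move=> [[[u Nu]|E]|[[e /andP[eH _]]|[v /and3P[/asboolP av _ _] E]]]; try exact: TZ.
    by have := plane_pos plHD E => ba; have /eqP := hub_neq; apply.
  by rewrite -E in av.
(* [S] and [Y] together contain the boundary of the leaf faces, so removing the rest of the drawing
   does not enlarge these faces. *)
have faceb w z : w \in L -> chain (~` (S `|` Y)) (cc w) z -> chain (~` X) (cc w) z.
  move=> wL; apply: (union_of_faces_boundary plHD (@union_of_faces_chain _ _ H D (cc w))).
    by move=> x Xx ax; apply: XZ => //; apply: adherent_sub ax => y cy; exists w.
  by apply: chain_nil; exact: ccX.
pose q (i : 'I_#|U|.+1) := pos (nth b (enum U) i).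
(* The hub [b] lies off [S] and [Y] and in no leaf face; as an additional point it makes up for the
   spare last index of [q]. *)
pose z (i : 'I_#|U|.+2) := if i == 0%N :> nat then pos b else cc (nth b (enum L) i.-1).
have sL (i : 'I_#|U|.+2) : i != 0%N :> nat -> (i.-1 < size (enum L))%N.
  by case: i => [[|i] //= hi] _; rewrite -cardE; apply: leq_trans UL.
have zL (i : 'I_#|U|.+2) : i != 0%N :> nat -> nth b (enum L) i.-1 \in L.
  by move=> i0; rewrite -mem_enum mem_nth// sL.
have nZz i : ~ (S `|` Y) (z i).
  by rewrite /z; case: eqVneq => [_ //|/zL/ccX h /ZX].
have cY : compact Y by case: aY.
have [|||i|i [j [ij cij]]] := @acyclic_separation _ #|U| S Y q z aS cY.
- move=> x Sx Yx; have [u uU ->] := SYU x Sx Yx.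
  have ui : (index u (enum U) < #|U|.+1)%N by rewrite ltnS cardE index_size.
  by exists (Ordinal ui); rewrite /q /= nth_index// mem_enum.
- by move=> i Si; apply: (nZz i); left.
- by move=> i Yi; apply: (nZz i); right.
- have aYz k := aY.2 (z k) (fun Yk => nZz k (or_intror Yk)).
  exact: liftableD (aYz i) (liftableN (aYz ord0)).
wlog i0 : i j ij cij / i != 0%N :> nat.
  move=> hw; have [i0|] := eqVneq (i : nat) 0%N; last exact: hw cij.
  apply: (hw j i); [by rewrite eq_sym|exact: chain_sym|].
  by apply: contraNneq ij => j0; apply/eqP/val_inj; rewrite /= i0 j0.
have wiL := zL i i0; move: cij; rewrite {1}/z (negbTE i0) => /(faceb _ _ wiL).
rewrite /z; case: eqVneq => [_ /chain_r|j0]; first by apply; exact: drawn_vertex.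
move=> /(cc_inj _ _ wiL (zL j j0)) /eqP.
rewrite nth_uniq ?enum_uniq ?sL//.
move=> /eqP e; move: ij => /eqP; apply; apply: val_inj => /=.
by rewrite -(prednK (n := i)) ?lt0n// e prednK ?lt0n.
Qed.

End Hubs.

(** * The graph and its saturated subgraphs *)

Section HubGraph.
Variable n : nat.

(** Oriented from the smaller label to the larger: 0 and 1 are the hubs, and the path runs through
    2, 3, and so on. *)
Definition hub_adj (i j : nat) : bool := (i < j)%N && ((i < 2)%N || (j == i.+1)).

Definition hub_edges : {set {set 'I_n}} :=
  [set e | [exists i : 'I_n, [exists j : 'I_n, (e == [set i; j]%SET) && hub_adj i j]]]%SET.

Lemma hub_edgesP e : reflect (exists i j : 'I_n, e = [set i; j]%SET /\ hub_adj i j)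
  (e \in hub_edges).
Proof.
rewrite inE; apply: (iffP existsP) => [[i /existsP[j /andP[/eqP-> ij]]]|[i [j [-> ij]]]].
  by exists i, j.
by exists i; apply/existsP; exists j; rewrite eqxx.
Qed.

Lemma card_hub_edge e : e \in hub_edges -> #|e| = 2%N.
Proof.
move=> /hub_edgesP[i [j [-> /andP[ij _]]]]; rewrite cards2; case: eqVneq => // e0.
by rewrite e0 ltnn in ij.
Qed.

Definition hub_graph := SGraph card_hub_edge.

Lemma hub_graph_edge (i j : 'I_n) : ([set i; j]%SET \in edges hub_graph) = hub_adj i j || hub_adj j i.
Proof.
apply/hub_edgesP/orP => [[x [y [exy xy]]]|[h|h]]; last 2 first.
- by exists i, j.
- by exists j, i; rewrite finset.setUC.
have xy' : x != y by move: xy => /andP[xy _]; apply: contraTneq xy => ->; rewrite ltnn.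
have := set21 x y; have := set22 x y; rewrite -exy !in_set2.
move=> /orP[/eqP yE|/eqP yE] /orP[/eqP xE|/eqP xE]; rewrite xE yE in xy xy'.
- by rewrite eqxx in xy'.
- by right.
- by left.
- by rewrite eqxx in xy'.
Qed.

End HubGraph.

(* Moves the label [p] into the gap between [g] and [g + 1]. *)
Definition move_label (p g x : nat) : nat :=
  if (p <= g)%N then (if x == p then g else if (p < x <= g)%N then x.-1 else x)
  else (if x == p then g.+1 else if (g < x < p)%N then x.+1 else x).

Lemma move_label_bound n p g x : (p < n)%N -> (g < n)%N -> (x < n)%N -> (move_label p g x < n)%N.
Proof. by rewrite /move_label; repeat case: ifP; lia. Qed.

Lemma move_label_inj p g : injective (move_label p g).
Proof. by move=> x y; rewrite /move_label; repeat case: ifP; lia. Qed.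

Lemma move_label_hub p g x : (1 < p)%N -> (0 < g)%N -> (x < 2)%N -> move_label p g x = x.
Proof. by rewrite /move_label; repeat case: ifP; lia. Qed.

Lemma move_label_path p g x : x != p -> x.+1 != p -> x != g ->
  move_label p g x.+1 = (move_label p g x).+1.
Proof. by rewrite /move_label; repeat case: ifP; lia. Qed.

Lemma move_label_new p g x : x != p -> x = g \/ x = g.+1 ->
  move_label p g x = (move_label p g p).+1 \/ move_label p g p = (move_label p g x).+1.
Proof. by rewrite /move_label; repeat case: ifP; lia. Qed.

(** * What saturation forces on a common face *)

Section Saturated.
Variable R : realType.
Local Notation pt := (R * R)%type.
Variables (n : nat) (W : finType) (H : sgraph W) (D : drawing R W) (f : W -> 'I_n).
Hypothesis plHD : plane H D.
Hypothesis f_inj : injective f.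
Hypothesis f_hom : forall e, e \in edges H -> (f @: e)%SET \in edges (hub_graph n).
Hypothesis sat : forall (e : {set W}) (H' : sgraph W) (D' : drawing R W),
  adds_edge H e H' -> extends H D D' -> plane H' D' -> ~ iso_to_subgraph H' (hub_graph n).
Local Notation pos := (vertex_pos D).
Local Notation X := (drawn H D).

Definition label (w : W) : nat := f w.

Lemma label_inj : injective label.
Proof. by move=> u v /val_inj /f_inj. Qed.

Lemma edge_label u v : [set u; v]%SET \in edges H ->
  hub_adj (label u) (label v) || hub_adj (label v) (label u).
Proof. by move=> /f_hom; rewrite imsetU1 imset_set1 hub_graph_edge. Qed.

Lemma edge_label_lt u v : [set u; v]%SET \in edges H -> (label u < label v)%N ->
  (label u < 2)%N \/ label v = (label u).+1.
Proof.
move=> /edge_label; rewrite /hub_adj => /orP[] /andP[h1 h2] luv; last by lia.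
by case/orP: h2 => [|/eqP]; [left|right].
Qed.

Definition share_face u w := exists c, [/\ ~ X c,
  adherent (chain (~` X) c) (pos u) & adherent (chain (~` X) c) (pos w)].

(** On a common face the edge can be drawn, so saturation is contradicted as soon as the larger
    graph embeds in the hub graph, by [f] or by any other map. *)
Lemma saturated_share_face u w : u != w -> share_face u w ->
  (forall H', edges H' = ([set u; w] |: edges H)%SET -> iso_to_subgraph H' (hub_graph n)) ->
  [set u; w]%SET \in edges H.
Proof.
move=> uw [c [nXc au aw]] iso; apply: contraT => nuw.
have [H' [D' [hadd hext hpl]]] := plane_add_edge plHD uw nuw nXc au aw.
by case: (sat hadd hext hpl); apply: iso; case: hadd.
Qed.

Lemma hub_share_face h w : (label h < 2)%N -> h != w -> share_face h w ->
  [set h; w]%SET \in edges H.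
Proof.
move=> lh hw hws; apply: saturated_share_face => // H' H'E; exists f; split => // e.
rewrite H'E in_setU1 => /orP[/eqP->|/f_hom//].
rewrite imsetU1 imset_set1 hub_graph_edge /hub_adj lh.
have : label h != label w by apply: contra_neq hw; exact: label_inj.
by rewrite /label in lh *; lia.
Qed.

Definition next_edge w := [exists v, (label v == (label w).+1) && ([set w; v]%SET \in edges H)].
(** The bound on [label v] excludes the hub 1, whose edge to the vertex labelled 2 counts as a hub
    edge. *)
Definition prev_edge w :=
  [exists v, [&& label w == (label v).+1, (1 < label v)%N & [set v; w]%SET \in edges H]].

(** Otherwise there is a gap in the path beside [u]: at [g = label u] if the next edge is missing,
    at [g = label u - 1] if the previous one is. As [w] has no path edge, its label can be moved
    into the gap without breaking an edge of [H], and it becomes a neighbour of [u] on the path.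
    Saturation then puts the edge into [H], where it would be a path edge at [w]. *)
Lemma pathless_share_face w u : (1 < label w)%N -> (1 < label u)%N -> w != u ->
  ~~ next_edge w -> ~~ prev_edge w -> share_face w u -> next_edge u && prev_edge u.
Proof.
move=> lw lu wu nw pw wus.
(* No path edge of [H] touches [w] or spans the gap, which is what [move_label_path] asks for. *)
have edge_path x y g : [set x; y]%SET \in edges H -> (1 < label x)%N -> label y = (label x).+1 ->
    (g = label u /\ ~~ next_edge u) \/ (g.+1 = label u /\ ~~ prev_edge u) ->
    [/\ label x != label w, (label x).+1 != label w & label x != g].
  move=> xyH lx lyx hg; split.
  - apply/negP => /eqP/label_inj xw; case/existsP: nw; exists y.
    by rewrite -xw lyx eqxx.
  - apply/negP => /eqP xw; case/existsP: pw; exists x.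
    by rewrite -xw eqxx lx; have <- : y = w by apply: label_inj; rewrite lyx.
  - apply/negP => /eqP xg; case: hg => [[gu]|[gu]] /existsP[].
      by exists y; have <- : x = u by [apply: label_inj; rewrite xg]; rewrite lyx eqxx.
    by exists x; have <- : y = u by [apply: label_inj; rewrite lyx xg]; rewrite lyx eqxx lx.
have lwn : (label w < n)%N by exact: ltn_ord.
have lun : (label u < n)%N by exact: ltn_ord.
suff H' g : (g = label u /\ ~~ next_edge u) \/ (g.+1 = label u /\ ~~ prev_edge u) -> False.
  apply/andP; split; apply: contraT => hn; exfalso.
    by apply: (H' (label u)); left.
  by apply: (H' (label u).-1); right; split => //; lia.
move=> hg; have g0 : (0 < g)%N by case: hg => -[]; lia.
have gn : (g < n)%N by case: hg => -[]; lia.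
have ug : label u = g \/ label u = g.+1 by case: hg => -[]; [left|right].
pose mv := move_label (label w) g.
have mvn x : (mv (label x) < n)%N by apply: move_label_bound => //; exact: ltn_ord.
pose f' x := Ordinal (mvn x).
have mvx x : (label x < 2)%N -> mv (label x) = label x by exact: move_label_hub.
have mv_hub x y : (label x < 2)%N -> (label x < label y)%N -> mv (label y) != label x.
  move=> lx lxy; apply/eqP => e1; have : label y = label x; last by lia.
  by apply: (@move_label_inj (label w) g); rewrite -/mv e1 mvx.
have luw : label u != label w by apply: contra_neq wu => /label_inj.
have wuH : [set w; u]%SET \in edges H.
  apply: saturated_share_face => // H0 H0E; exists f'; split.
    by move=> x y /(congr1 val) /move_label_inj /label_inj.
  move=> e; rewrite H0E in_setU1 => /orP[/eqP->|eH].
    rewrite imsetU1 imset_set1 hub_graph_edge /hub_adj /= /mv.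
    by have := move_label_new luw ug; lia.
  have /eqP/cards2P[x [y [xy exy]]] := card_edge eH.
  wlog lxy : x y xy exy / (label x < label y)%N.
    move=> hw; have [lxy|lyx|lxy] := ltngtP (label x) (label y).
    - exact: hw lxy.
    - by apply: hw lyx; [rewrite eq_sym|rewrite exy finset.setUC].
    - by move: xy; rewrite (label_inj lxy) eqxx.
  rewrite exy in eH *; rewrite imsetU1 imset_set1 hub_graph_edge /hub_adj /=.
  have [lx|lyx] := edge_label_lt eH lxy.
    by have := mv_hub _ _ lx lxy; rewrite (mvx _ lx); lia.
  have [lx|lx] := ltnP (label x) 2.
    by have := mv_hub _ _ lx lxy; rewrite (mvx _ lx); lia.
  have [h1 h2 h3] := edge_path _ _ g eH lx lyx hg.
  by rewrite lyx /mv (move_label_path h1 h2 h3); lia.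
have [lwu|luw'|e] := ltngtP (label w) (label u); last by rewrite (label_inj e) eqxx in wu.
  have [|lu'] := edge_label_lt wuH lwu; first by rewrite ltnNge lw.
  by case/existsP: nw; exists u; rewrite lu' eqxx.
rewrite finset.setUC in wuH; have [|lw'] := edge_label_lt wuH luw'; first by rewrite ltnNge lu.
by case/existsP: pw; exists u; rewrite lw' eqxx lu.
Qed.

Hypothesis cardW : #|W| = n.

Lemma label_onto i : (i < n)%N -> exists w, label w = i.
Proof.
move=> hi; have [|g gK fK] := inj_card_bij f_inj; first by rewrite card_ord cardW.
by exists (g (Ordinal hi)); rewrite /label fK.
Qed.

End Saturated.

(** * Leaves against inner vertices, and the edge count *)

Section SaturatedCount.
Variable R : realType.
Local Notation pt := (R * R)%type.
Variables (n : nat) (W : finType) (H : sgraph W) (D : drawing R W) (f : W -> 'I_n).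
Hypothesis plHD : plane H D.
Hypothesis cardW : #|W| = n.
Hypothesis f_inj : injective f.
Hypothesis f_hom : forall e, e \in edges H -> (f @: e)%SET \in edges (hub_graph n).
Hypothesis sat : forall (e : {set W}) (H' : sgraph W) (D' : drawing R W),
  adds_edge H e H' -> extends H D D' -> plane H' D' -> ~ iso_to_subgraph H' (hub_graph n).
Local Notation pos := (vertex_pos D).
Local Notation X := (drawn H D).
Local Notation label := (label f).
Local Notation next_edge := (next_edge H f).
Local Notation prev_edge := (prev_edge H f).

Lemma adherent_finite_union (L : {set W}) (K : W -> set pt) x :
  adherent [set z | exists2 w, w \in L & K w z] x -> exists2 w, w \in L & adherent (K w) x.
Proof.
move=> aL; apply: contrapT => nL.
have /choice[d Hd] : forall w, exists d : R, 0 < d /\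
    (w \in L -> forall z, K w z -> d <= `|z - x|).
  move=> w; have [wL|_] := boolP (w \in L); last by exists 1.
  apply: contrapT => nd; apply: nL; exists w => // d d0; apply: contrapT => nz.
  apply: nd; exists d; split => // _ z Kz; rewrite leNgt; apply/negP => zx.
  by apply: nz; exists z.
have [|z [w wL Kz]] := aL (\big[Num.min/1]_w d w).
  by apply: lt_bigmin => // w _; have [] := Hd w.
have [_ /(_ wL z Kz) h] := Hd w; rewrite ltNge (le_trans _ h)//.
by rewrite bigmin_le_cond.
Qed.

Definition leaves (h h' : W) : {set W} :=
  [set w | [&& (1 < label w)%N, [set h; w]%SET \in edges H, [set h'; w]%SET \notin edges H,
     ~~ next_edge w & ~~ prev_edge w]]%SET.

Definition inner (h : W) : {set W} :=
  [set w | [&& (1 < label w)%N, [set h; w]%SET \in edges H, next_edge w & prev_edge w]]%SET.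

(** A face is chosen at each leaf. Saturation keeps it away from [h'], so it touches [h], and by
    relabelling every further vertex on it has both path edges, hence lies in [inner h]. In
    particular the faces chosen for two leaves are different. *)
Lemma leaves_bound h h' : h != h' -> (label h < 2)%N -> (label h' < 2)%N ->
  (forall u, (label u < 2)%N -> u = h \/ u = h') -> (#|leaves h h'| <= #|inner h|)%N.
Proof.
move=> hh' lh lh' hubs.
have hub_small w u : (1 < label w)%N -> (label u < 2)%N -> u != w.
  by move=> lw lu; apply: contraTneq lw => <-; rewrite -leqNgt.
have /choice[cc Hcc] : forall w, exists c, ~ X c /\ adherent (chain (~` X) c) (pos w).
  by move=> w; have [c] := vertex_face plHD w; exists c.
have share w u : adherent (chain (~` X) (cc w)) (pos u) -> share_face H D w u.
  by move=> au; exists (cc w); have [] := Hcc w.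
have share' w u : adherent (chain (~` X) (cc w)) (pos u) -> share_face H D u w.
  by move=> au; exists (cc w); have [] := Hcc w.
have nb w : w \in leaves h h' -> ~ adherent (chain (~` X) (cc w)) (pos h').
  rewrite inE => /and5P[lw _ h'w _ _] ah'.
  move: h'w; rewrite (hub_share_face plHD f_inj f_hom sat lh')//; last exact: share'.
  exact: hub_small.
have ah w : w \in leaves h h' -> adherent (chain (~` X) (cc w)) (pos h).
  move=> wL; have cw : chain (~` X) (cc w) (cc w) by apply: chain_nil; have [] := Hcc w.
  have := face_hub plHD (label_inj f_inj) hubs (edge_label_lt f_hom) (@union_of_faces_chain _ _ H D (cc w)) cw.
  by case=> // /(nb w wL).
have inU w v : w \in leaves h h' -> adherent (chain (~` X) (cc w)) (pos v) ->
    [\/ v = h, v = w | v \in inner h].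
  move=> wL av; have [lv|lv] := ltnP (label v) 2.
    have [->|vh'] := hubs v lv; [by constructor 1|].
    by case: (nb w wL); rewrite -vh'.
  have [->|vw] := eqVneq v w; [by constructor 2|constructor 3].
  move: (wL); rewrite inE => /and5P[lw _ _ nw pw].
  have wv : w != v by rewrite eq_sym.
  have /andP[nv pv] := pathless_share_face plHD f_inj f_hom sat lw lv wv nw pw (share _ _ av).
  rewrite inE lv nv pv !andbT /=.
  apply: (hub_share_face plHD f_inj f_hom sat lh); first exact: hub_small.
  by exists (cc w); split; [by have [] := Hcc w|exact: ah|].
apply: (leaf_faces_bound plHD (label_inj f_inj) hubs hh' (edge_label_lt f_hom) (cc := cc)).
- by move=> w _; have [] := Hcc w.
- move=> w w' wL w'L cww'; apply/eqP; apply: contraT => ww'.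
  have av : adherent (chain (~` X) (cc w)) (pos w').
    by have [_] := Hcc w'; apply: adherent_sub => z; exact: chain_trans.
  have [w'h|w'w|] := inU w w' wL av.
  + by move: w'L; rewrite inE => /and5P[lw' _ _ _ _]; rewrite w'h ltnNge -ltnS lh in lw'.
  + by rewrite w'w eqxx in ww'.
  + by move: w'L; rewrite !inE => /and5P[_ _ _ /negbTE-> _]; rewrite !andbF.
- by move=> /adherent_finite_union[w wL]; exact: nb.
- move=> v /adherent_finite_union[w wL /(inU w v wL)[->|->|vU]]; [by constructor 1|by constructor 3|by constructor 2].
- by move=> w; rewrite inE => /and5P[].
- move=> w e; rewrite inE => /and5P[lw hw h'w nw pw] eH we.
  have [x wx eE] := edge_ends eH we; rewrite eE in eH *.
  have [lx|lx] := ltnP (label x) 2.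
    have [->|xh'] := hubs x lx; first by rewrite finset.setUC.
    by move: h'w; rewrite finset.setUC -xh' eH.
  have [lwx|lxw|e1] := ltngtP (label w) (label x); last by rewrite (label_inj f_inj e1) eqxx in wx.
    have [|lx'] := edge_label_lt f_hom eH lwx; first by rewrite ltnNge lw.
    by case/existsP: nw; exists x; rewrite lx' eqxx.
  rewrite finset.setUC in eH; have [|lw'] := edge_label_lt f_hom eH lxw; first by rewrite ltnNge lx.
  by case/existsP: pw; exists x; rewrite lw' eqxx lx.
Qed.

Lemma saturated_edge_bound : (3 <= n)%N -> (3 * (n - 2) <= 2 * num_edges H)%N.
Proof.
move=> n3.
have [a la] := label_onto f_inj cardW (leq_trans (isT : 0 < 3)%N n3).
have [b lb] := label_onto f_inj cardW (leq_trans (isT : 1 < 3)%N n3).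
have ab : a != b by apply/eqP => e; rewrite e lb in la.
have hubs u : (label u < 2)%N -> u = a \/ u = b.
  case E : (label u) => [|[|k]] // _; [left|right]; apply: (label_inj f_inj).
    by rewrite E la.
  by rewrite E lb.
have hubs' u : (label u < 2)%N -> u = b \/ u = a by move=> /hubs[]; [right|left].
have la2 : (label a < 2)%N by rewrite la.
have lb2 : (label b < 2)%N by rewrite lb.
have hub_small w u : (1 < label w)%N -> (label u < 2)%N -> u != w.
  by move=> lw lu; apply: contraTneq lw => <-; rewrite -leqNgt.
pose P w := (1 < label w)%N.
have hub_or w : P w -> ([set a; w]%SET \in edges H) || ([set b; w]%SET \in edges H).
  move=> lw; have [c nXc cw] := vertex_face plHD w.
  have cc : chain (~` X) c c by exact: chain_nil.
  have [ac|bc] := face_hub plHD (label_inj f_inj) hubs (edge_label_lt f_hom) (@union_of_faces_chain _ _ H D c) cc.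
    by rewrite (hub_share_face plHD f_inj f_hom sat la2) ?hub_small//; exists c.
  by rewrite (hub_share_face plHD f_inj f_hom sat lb2) ?hub_small ?orbT//; exists c.
have LA := leaves_bound ab la2 lb2 hubs.
have ba : b != a by rewrite eq_sym.
have LB := leaves_bound ba lb2 la2 hubs'.
pose al w := [set a; w]%SET \in edges H; pose be w := [set b; w]%SET \in edges H.
have cardP : #|[set w | P w]%SET| = (n - 2)%N.
  have := cardsC [set w | P w]%SET; rewrite cardW.
  have -> : (~: [set w | P w])%SET = [set a; b]%SET.
    apply/setP => w; rewrite !inE -leqNgt; apply/idP/orP.
      by move=> /hubs[->|->]; rewrite eqxx; [left|right].
    by case=> /eqP->; rewrite ?la ?lb.
  by rewrite cards2 ab; lia.
have wa w : P w -> (w == a) = false by move=> Pw; rewrite eq_sym; apply/negbTE/hub_small.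
have wb w : P w -> (w == b) = false by move=> Pw; rewrite eq_sym; apply/negbTE/hub_small.
(* Three disjoint classes: edges at [a] only, at [b] only, at neither hub; a possible edge between
   the hubs is left out. *)
pose E1 := [set e in edges H | (a \in e) && (b \notin e)]%SET.
pose E2 := [set e in edges H | (b \in e) && (a \notin e)]%SET.
pose E3 := [set e in edges H | (a \notin e) && (b \notin e)]%SET.
have star_card h : (label h < 2)%N ->
    #|[set [set h; w]%SET | w in [set w | P w && ([set h; w]%SET \in edges H)]]%SET| =
    #|[set w | P w && ([set h; w]%SET \in edges H)]%SET|.
  move=> lh; rewrite card_in_imset// => w w'; rewrite !inE => /andP[Pw _] /andP[Pw' _] /setP/(_ w).
  rewrite !in_set2 eqxx orbT => /esym/orP[/eqP e|/eqP//].
  by have := hub_small w h Pw lh; rewrite e eqxx.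
have E1c : (#|[set w | P w && al w]%SET| <= #|E1|)%N.
  rewrite -(star_card a la2); apply: subset_leq_card; apply/fintype.subsetP => e /imsetP[w].
  rewrite inE => /andP[Pw aw ->]; rewrite inE aw !in_set2 eqxx /= eq_sym (negbTE ab) /=.
  by rewrite eq_sym wb.
have E2c : (#|[set w | P w && be w]%SET| <= #|E2|)%N.
  rewrite -(star_card b lb2); apply: subset_leq_card; apply/fintype.subsetP => e /imsetP[w].
  rewrite inE => /andP[Pw aw ->]; rewrite inE aw !in_set2 eqxx /= (negbTE ab) /=.
  by rewrite eq_sym wa.
(* Path edges are counted at their lower ends here and at their upper ends in [E3p]. *)
have E3n : (#|[set w | P w && next_edge w]%SET| <= #|E3|)%N.
  have /choice[nx Hnx] : forall w, exists v, next_edge w -> label v = (label w).+1 /\ [set w; v]%SET \in edges H.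
    move=> w; have [/existsP[v /andP[/eqP h1 h2]]|] := boolP (next_edge w); last by exists w.
    by exists v.
  rewrite -(card_in_imset (f := fun w => [set w; nx w]%SET)).
    apply: subset_leq_card; apply/fintype.subsetP => e /imsetP[w]; rewrite inE => /andP[Pw /Hnx[lw ew]] ->.
    have Pn : P (nx w) by rewrite /P lw; apply: leq_trans Pw _.
    by rewrite inE ew !in_set2 ![a == _]eq_sym ![b == _]eq_sym !wa// !wb.
  move=> w w'; rewrite !inE => /andP[_ /Hnx[lw _]] /andP[_ /Hnx[lw' _]] /setP E.
  have := E w; have := E w'; rewrite !in_set2 !eqxx /= => /orP[/eqP//|/eqP e1] /esym/orP[/eqP//|/eqP e2].
  by have := congr1 label e1; have := congr1 label e2; rewrite lw lw'; lia.
have E3p : (#|[set w | P w && prev_edge w]%SET| <= #|E3|)%N.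
  have /choice[nx Hnx] : forall w, exists v, prev_edge w ->
      [/\ label w = (label v).+1, P v & [set v; w]%SET \in edges H].
    move=> w; have [/existsP[v /and3P[/eqP h1 h2 h3]]|] := boolP (prev_edge w); last by exists w.
    by exists v.
  rewrite -(card_in_imset (f := fun w => [set nx w; w]%SET)).
    apply: subset_leq_card; apply/fintype.subsetP => e /imsetP[w]; rewrite inE => /andP[Pw /Hnx[lw Pn ew]] ->.
    by rewrite inE ew !in_set2 ![a == _]eq_sym ![b == _]eq_sym !wa// !wb.
  move=> w w'; rewrite !inE => /andP[_ /Hnx[lw _ _]] /andP[_ /Hnx[lw' _ _]] /setP E.
  have := E w; have := E w'; rewrite !in_set2 !eqxx !orbT /= => /orP[/eqP e1|/eqP//] /esym/orP[/eqP e2|/eqP//].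
  by have := congr1 label e1; have := congr1 label e2; lia.
have E123 : (#|E1| + #|E2| + #|E3| <= num_edges H)%N.
  have -> : num_edges H = (#|E1| + #|edges H :\: E1|)%N.
    have E1H : E1 \subset edges H by apply/fintype.subsetP => e; rewrite inE => /andP[].
    by rewrite /num_edges -(cardsID E1 (edges H)) (finset.setIidPr E1H).
  rewrite -addnA leq_add2l -cardsUI (_ : E2 :&: E3 = finset.set0)%SET ?cards0 ?addn0.
    apply: subset_leq_card; apply/fintype.subsetP => e; rewrite !inE.
    by case: (e \in edges H); case: (a \in e); case: (b \in e).
  by apply/setP => e; rewrite !inE; case: (e \in edges H); case: (a \in e); case: (b \in e).
have card_sum (Q : pred W) : #|[set w | P w && Q w]%SET| = (\sum_(w | P w) Q w)%N.
  by rewrite -sum1dep_card big_mkcondr /=; apply: eq_bigr => w _; case: (Q w).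
have LAe : #|leaves a b| = (\sum_(w | P w) [&& al w, ~~ be w, ~~ next_edge w & ~~ prev_edge w])%N by rewrite -card_sum.
have LBe : #|leaves b a| = (\sum_(w | P w) [&& be w, ~~ al w, ~~ next_edge w & ~~ prev_edge w])%N by rewrite -card_sum.
have UAe : #|inner a| = (\sum_(w | P w) [&& al w, next_edge w & prev_edge w])%N by rewrite -card_sum.
have UBe : #|inner b| = (\sum_(w | P w) [&& be w, next_edge w & prev_edge w])%N by rewrite -card_sum.
have c3 : (3 * (n - 2) = \sum_(w | P w) 3)%N.
  by rewrite sum_nat_const mulnC; congr (_ * _)%N; rewrite -cardP cardsE.
rewrite card_sum in E1c; rewrite card_sum in E2c; rewrite card_sum in E3n; rewrite card_sum in E3p.
rewrite LAe UAe in LA; rewrite LBe UBe in LB.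
(* The local count: a vertex owes 3, and one more for each hub at which it is inner; it has 2 for
   each hub edge, 1 for each path edge and 1 for being a leaf. In the sum, [LA] and [LB] bound the
   leaf terms by the inner ones. *)
have : (\sum_(w | P w) (3 + ([&& al w, next_edge w & prev_edge w] + [&& be w, next_edge w & prev_edge w])) <=
  \sum_(w | P w) (al w + al w + (be w + be w) + (next_edge w + prev_edge w) +
  ([&& al w, ~~ be w, ~~ next_edge w & ~~ prev_edge w] + [&& be w, ~~ al w, ~~ next_edge w & ~~ prev_edge w])))%N.
  apply: leq_sum => w /hub_or; rewrite -/(al w) -/(be w).
  by case: (al w) (be w) (next_edge w) (prev_edge w) => [] [] [] [].
rewrite !big_split /= -c3; lia.
Qed.

End SaturatedCount.

(** * Maximality: the complete graph on five vertices *)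

Section NonPlanar.
Variable R : realType.
Local Notation pt := (R * R)%type.
Implicit Types (g h : R -> pt) (z : pt) (s t : R).

Let i0 : (0 : R) \in `[0 : R, 1]. Proof. by rewrite in_itv /= lexx ler01. Qed.
Let i1 : (1 : R) \in `[0 : R, 1]. Proof. by rewrite in_itv /= lexx ler01. Qed.

Lemma lift_variation (u v : R -> R) : continuous u -> continuous v ->
  (forall t, t \in `[0, 1] -> modeq (u t) (v t)) -> u 1 - u 0 = v 1 - v 0.
Proof.
move=> cu cv uv; have := @int_valued_const R (fun t => u t - v t) _ uv.
have c : continuous (fun t => u t - v t) by move=> t; apply: cvgB; [exact: cu|exact: cv].
by move=> /(_ c); lra.
Qed.

(* The variation of the angle of [g - z] along [g]; meaningless when [g] meets [z]. *)
Definition turn g z : R :=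
  xget 0 [set d | exists u : R -> R, [/\ continuous u,
    forall t, t \in `[0, 1] -> modeq (u t) (angle (g t - z)) & d = u 1 - u 0]].

Lemma turnE g z u : continuous u ->
  (forall t, t \in `[0, 1] -> modeq (u t) (angle (g t - z))) -> turn g z = u 1 - u 0.
Proof.
move=> cu gu; rewrite /turn; case: xgetP => [d _ [v [cv gv ->]]|/(_ (u 1 - u 0))].
  apply: lift_variation => // t t01; apply: modeq_trans (gv t t01) (modeq_sym (gu t t01)).
by case; exists u.
Qed.

(** After clamping, [g s - h t] vanishes nowhere on the plane of parameters, and the box around the
    square is star-shaped about the origin, so a lift exists on it. *)
Lemma angle_square g h : continuous g -> continuous h ->
  (forall s t, s \in `[0, 1] -> t \in `[0, 1] -> g s != h t) ->
  exists th : R -> R -> R, [/\ forall t, continuous (th^~ t), forall s, continuous (th s) &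
    forall s t, s \in `[0, 1] -> t \in `[0, 1] -> modeq (th s t) (angle (g s - h t))].
Proof.
move=> cg ch gh; pose c := clamp (0 : R) 1.
have c01 t : c t \in `[0, 1] by exact: clamp_itv.
have cc : continuous c by exact: clamp_continuous.
pose a (p : pt) := angle (g (c p.1) - h (c p.2)).
have ca p : modcont a p.
  apply: (@modcont_comp _ _ _ (@angle R) (fun p : pt => g (c p.1) - h (c p.2))).
    apply: cvgB.
      apply: (@continuous_comp _ _ _ (fun p : pt => c p.1) g); last exact: cg.
      by apply: (@continuous_comp _ _ _ (fst : pt -> R) c); [exact: cvg_fst|exact: cc].
    apply: (@continuous_comp _ _ _ (fun p : pt => c p.2) h); last exact: ch.
    by apply: (@continuous_comp _ _ _ (snd : pt -> R) c); [exact: cvg_snd|exact: cc].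
  by apply: angle_modcont; rewrite subr_eq0; exact: gh.
have [|th cth Hth] := modcont_lift (@box_compact R 1) _ ca.
  move=> x t /boxP x1 /andP[t0 t1]; apply/boxP; rewrite normrZ ger0_norm//.
  by rewrite (le_trans _ x1)// ler_piMl.
have inbox s t : (([set` `[-1, 1]] `*` [set` `[-1, 1]]) : set pt) (c s, c t).
  have := c01 s; have := c01 t; rewrite /setX /= !in_itv /= => /andP[? ?] /andP[? ?].
  by split; apply/andP; split; lra.
exists (fun s t => th (c s, c t)); split.
- move=> t s; apply: (@continuous_comp _ _ _ (fun s => (c s, c t)) th).
    by apply: continuous_pair; [exact: cc|exact: cvg_cst].
  exact: cth.
- move=> s t; apply: (@continuous_comp _ _ _ (fun t => (c s, c t)) th).
    by apply: continuous_pair; [exact: cvg_cst|exact: cc].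
  exact: cth.
- move=> s t s01 t01; apply: modeq_trans (Hth _ (inbox s t)) _.
  by rewrite /a /= /c !clamp_id//; exact: modeq_refl.
Qed.

(** All four turns are differences of one lift at the corners of the parameter square; exchanging
    [g] and [h] adds a half turn, which cancels in differences. *)
Lemma turn_square g h : continuous g -> continuous h ->
  (forall s t, s \in `[0, 1] -> t \in `[0, 1] -> g s != h t) ->
  [/\ turn g (h 0) + turn h (g 1) = turn h (g 0) + turn g (h 1),
      modeq (turn g (h 0)) (angle (g 1 - h 0) - angle (g 0 - h 0)),
      modeq (turn g (h 1)) (angle (g 1 - h 1) - angle (g 0 - h 1)),
      modeq (turn h (g 0)) (angle (h 1 - g 0) - angle (h 0 - g 0)) &
      modeq (turn h (g 1)) (angle (h 1 - g 1) - angle (h 0 - g 1))].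
Proof.
move=> cg ch gh; have [th [c1 c2 Hth]] := angle_square cg ch gh.
have tg t : t \in `[0, 1] -> turn g (h t) = th 1 t - th 0 t.
  by move=> t01; apply: (turnE (c1 t)) => s s01; exact: Hth.
have flip s t : s \in `[0, 1] -> t \in `[0, 1] -> modeq (th s t + 2^-1) (angle (h t - g s)).
  move=> s01 t01; rewrite -[h t - g s]opprB; apply: modeq_sym.
  have n0 : g s - h t != 0 by rewrite subr_eq0 gh.
  apply: modeq_trans (angleN n0) _; apply: modeqD; last exact: modeq_refl.
  exact/modeq_sym/Hth.
have tn s : s \in `[0, 1] -> turn h (g s) = th s 1 - th s 0.
  move=> s01; rewrite (@turnE h (g s) (fun t => th s t + 2^-1)); first by ring.
    by move=> t; apply: cvgD; [exact: c2|exact: cvg_cst].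
  by move=> t t01; exact: flip.
split.
- by rewrite !tg// !tn//; ring.
- by rewrite tg//; apply: modeqB; exact: Hth.
- by rewrite tg//; apply: modeqB; exact: Hth.
- rewrite tn//; have -> : th 0 1 - th 0 0 = (th 0 1 + 2^-1) - (th 0 0 + 2^-1) by ring.
  by apply: modeqB; exact: flip.
- rewrite tn//; have -> : th 1 1 - th 1 0 = (th 1 1 + 2^-1) - (th 1 0 + 2^-1) by ring.
  by apply: modeqB; exact: flip.
Qed.

(* The van Kampen obstruction: with [N i j k] and [B i j] the integers that
   compare turns with differences of angles, the fifteen relations [turn_square]
   for disjoint edges have even coefficients in their sum, whose constant term is
   the number 5 of crossings of a convex drawing. *)
Lemma no_plane_K5 (p : nat -> pt) (g : nat -> nat -> R -> pt) :
  (forall i j, (i < j < 5)%N -> p i != p j) ->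
  (forall i j, (i < j < 5)%N -> [/\ continuous (g i j), g i j 0 = p i & g i j 1 = p j]) ->
  (forall i j k l s t, (i < j < 5)%N -> (k < l < 5)%N ->
     [&& i != k, i != l, j != k & j != l] -> s \in `[0, 1] -> t \in `[0, 1] ->
     g i j s != g k l t) -> False.
Proof.
move=> pD gP gD.
pose A i j := angle (p i - p j).
pose N i j k : int := Num.floor (turn (g i j) (p k) - (A j k - A i k)).
pose B i j : int := Num.floor (A j i - A i j - 2^-1).
have BE i j : (i < j < 5)%N -> A j i = A i j + 2^-1 + (B i j)%:~R.
  move=> ij; rewrite /B floorK; first by ring.
  have n0 : p i - p j != 0 by rewrite subr_eq0 pD.
  have := angleN n0; rewrite opprB /modeq -/(A j i) -/(A i j) => h.
  by rewrite -addrA -opprD.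
have NE i j k l : (i < j < 5)%N -> (k < l < 5)%N -> [&& i != k, i != l, j != k & j != l] ->
  [/\ turn (g i j) (p k) + turn (g k l) (p j) = turn (g k l) (p i) + turn (g i j) (p l),
    turn (g i j) (p k) = A j k - A i k + (N i j k)%:~R,
    turn (g i j) (p l) = A j l - A i l + (N i j l)%:~R,
    turn (g k l) (p i) = A l i - A k i + (N k l i)%:~R &
    turn (g k l) (p j) = A l j - A k j + (N k l j)%:~R].
  move=> ij kl d; have [cg g0 g1] := gP i j ij; have [ch h0 h1] := gP k l kl.
  have [|h m1 m2 m3 m4] := turn_square cg ch; first by move=> s t; exact: gD.
  rewrite g0 g1 h0 h1 in h m1 m2 m3 m4.
  by split => //; rewrite /N floorK //; ring.
(* The three ways to split four points into two disjoint edges. In the interleaved splitting, the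
   crossing pair of a convex drawing, the half turns leave the constant 1; in the others they
   cancel. *)
have eqs (x y z w : nat) : (x < y)%N -> (y < z)%N -> (z < w < 5)%N ->
  [/\ N x y z + N z w y - N z w x - N x y w - B y z + B y w + B x z - B x w = 0,
      N x z y + N y w z - N y w x - N x z w + B y z + B z w + B x y - B x w + 1 = 0 &
      N x w y + N y z w - N y z x - N x w z + B y w - B z w + B x y - B x z = 0].
  move=> xy yz /andP[zw w5].
  have xz := ltn_trans xy yz; have yw := ltn_trans yz zw.
  have Bxy : A y x = A x y + 2^-1 + (B x y)%:~R by apply: BE; lia.
  have Bxz : A z x = A x z + 2^-1 + (B x z)%:~R by apply: BE; lia.
  have Bxw : A w x = A x w + 2^-1 + (B x w)%:~R by apply: BE; lia.
  have Byz : A z y = A y z + 2^-1 + (B y z)%:~R by apply: BE; lia.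
  have Byw : A w y = A y w + 2^-1 + (B y w)%:~R by apply: BE; lia.
  have Bzw : A w z = A z w + 2^-1 + (B z w)%:~R by apply: BE; lia.
  split; apply/eqP; rewrite -(intr_eq0 R) !(intrD, rmorphN) /=; apply/eqP.
  - by have [|||e e1 e2 e3 e4] := NE x y z w; [lia|lia|lia|lra].
  - by have [|||e e1 e2 e3 e4] := NE x z y w; [lia|lia|lia|lra].
  - by have [|||e e1 e2 e3 e4] := NE x w y z; [lia|lia|lia|lra].
have E0 := eqs 0%N 1%N 2%N 3%N isT isT isT.
have E1 := eqs 0%N 1%N 2%N 4%N isT isT isT.
have E2 := eqs 0%N 1%N 3%N 4%N isT isT isT.
have E3 := eqs 0%N 2%N 3%N 4%N isT isT isT.
have E4 := eqs 1%N 2%N 3%N 4%N isT isT isT.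
clear -E0 E1 E2 E3 E4; move: E0 E1 E2 E3 E4 => [a1 a2 a3] [b1 b2 b3] [c1 c2 c3] [d1 d2 d3] [e1 e2 e3].
lia.
Qed.

End NonPlanar.

(* In the graph with the additional edge between the labels [x] and [y], the hubs
   0 and 1 together with [x], [x + 1] and [y] span a subdivision of the complete
   graph on five vertices. *)
Definition k5_label (x y i : nat) := nth 0%N [:: 0%N; 1%N; x; x.+1; y] i.

(** The labels allowed on the curve that stands for the edge [i j]; only the edge from index 3 to
    index 4 is subdivided, by the path from [x + 1] to [y]. *)
Definition k5_class (x y i j m : nat) :=
  [|| m == k5_label x y i, m == k5_label x y j |
      [&& i == 3%N, j == 4%N & (x < m <= y)%N]].

Section K5Labels.
Variables x y : nat.
Hypotheses (x2 : (1 < x)%N) (xy : (x.+1 < y)%N).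

Lemma k5_label_le i : (i < 5)%N -> (k5_label x y i <= y)%N.
Proof. by rewrite /k5_label; case: i => [|[|[|[|[|i]]]]] //= _; lia. Qed.

Lemma k5_label_lt i j : (i < j < 5)%N -> (k5_label x y i < k5_label x y j)%N.
Proof.
by rewrite /k5_label; case: i j => [|[|[|[|[|i]]]]] // [|[|[|[|[|j]]]]] //=; lia.
Qed.

Lemma k5_label_inj i j : (i < 5)%N -> (j < 5)%N -> k5_label x y i = k5_label x y j -> i = j.
Proof.
move=> i5 j5 e; have [ij|ji|//] := ltngtP i j.
  by have := @k5_label_lt i j; rewrite ij j5 e ltnn => /(_ isT).
by have := @k5_label_lt j i; rewrite ji i5 e ltnn => /(_ isT).
Qed.

Lemma k5_label_small i : (i < 3)%N -> (k5_label x y i <= x)%N.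
Proof. by rewrite /k5_label; case: i => [|[|[|i]]] //= _; lia. Qed.

Lemma k5_class_disjoint i j k l m : (i < j < 5)%N -> (k < l < 5)%N ->
  [&& i != k, i != l, j != k & j != l] ->
  k5_class x y i j m -> k5_class x y k l m -> False.
Proof.
move=> /andP[ij j5] /andP[kl l5] /and4P[ik il jk jl].
have i5 := ltn_trans ij j5; have k5 := ltn_trans kl l5.
have inj := k5_label_inj.
case/or3P=> [/eqP mE|/eqP mE|/and3P[/eqP iE /eqP jE /andP[xm my]]];
  case/or3P=> [/eqP mE'|/eqP mE'|/and3P[/eqP kE /eqP lE /andP[xm' my']]].
- by move/eqP: ik; apply; apply: inj; rewrite -?mE.
- by move/eqP: il; apply; apply: inj; rewrite -?mE.
- by have := @k5_label_small i; rewrite -mE; lia.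
- by move/eqP: jk; apply; apply: inj; rewrite -?mE.
- by move/eqP: jl; apply; apply: inj; rewrite -?mE.
- by have := @k5_label_small j; rewrite -mE; lia.
- by have := @k5_label_small k; rewrite -mE'; lia.
- by have := @k5_label_small l; rewrite -mE'; lia.
- by rewrite iE kE in ik.
Qed.

End K5Labels.

(** * An added edge yields a drawing of the complete graph on five vertices *)

Section Maximality.
Variable R : realType.
Local Notation pt := (R * R)%type.
Implicit Types (g h : R -> pt) (s t : R).

(** [no_plane_K5] asks for continuous curves, so the pieces are joined without being made simple. *)
Lemma curve_concat g h : continuous g -> continuous h -> g 1 = h 0 ->
  exists k : R -> pt, [/\ continuous k, k 0 = g 0, k 1 = h 1 &
    forall t, t \in `[0, 1] -> exists2 s, s \in `[0, 1] & k t = g s \/ k t = h s].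
Proof.
move=> cg ch gh; pose k t := g (clamp 0 1 (t * 2)) + (h (clamp 0 1 (-1 + t * 2)) - h 0).
have kl t : t <= 2^-1 -> k t = g (clamp 0 1 (t * 2)).
  move=> t2; rewrite /k (_ : clamp 0 1 (-1 + t * 2) = 0) ?subrr ?addr0//.
  by rewrite /clamp min_r ?max_l//; lra.
have kr t : 2^-1 <= t -> k t = h (clamp 0 1 (-1 + t * 2)).
  move=> t2; rewrite /k (_ : clamp 0 1 (t * 2) = 1) ?gh ?subrKC//.
  by rewrite /clamp min_l ?max_r//; lra.
have c01 u : clamp 0 1 u \in `[0 : R, 1] by exact: clamp_itv.
exists k; split.
- move=> t; apply: cvgD.
    apply: (@continuous_comp _ _ _ (fun t => clamp 0 1 (t * 2)) g); last exact: cg.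
    apply: (@continuous_comp _ _ _ (fun t => t * 2) (clamp 0 1)); last exact: clamp_continuous.
    by apply: cvgM; [exact: cvg_id|exact: cvg_cst].
  apply: cvgB; last exact: cvg_cst.
  apply: (@continuous_comp _ _ _ (fun t => clamp 0 1 (-1 + t * 2)) h); last exact: ch.
  apply: (@continuous_comp _ _ _ (fun t => -1 + t * 2) (clamp 0 1)); last exact: clamp_continuous.
  exact: affine_continuous.
- by rewrite kl ?mul0r ?clamp_id ?in_itv /= ?lexx ?ler01//; lra.
- rewrite kr; last lra.
  by rewrite (_ : -1 + 1 * 2 = 1) ?clamp_id ?in_itv /= ?lexx ?ler01//; lra.
- move=> t _; have [t2|t2] := leP t 2^-1.
    by exists (clamp 0 1 (t * 2)) => //; left; exact: kl.
  by exists (clamp 0 1 (-1 + t * 2)) => //; right; apply: kr; exact: ltW.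
Qed.

Lemma path_curve (W : finType) (H : sgraph W) (D : drawing R W) (v : nat -> W) (k l : nat) :
  plane H D -> (k < l)%N ->
  (forall m, (k <= m < l)%N -> [set v m; v m.+1]%SET \in edges H) ->
  exists g : R -> pt, [/\ continuous g, g 0 = vertex_pos D (v k), g 1 = vertex_pos D (v l) &
    forall t, t \in `[0, 1] -> exists2 m, (k <= m < l)%N & curve_image D [set v m; v m.+1]%SET (g t)].
Proof.
move=> pl; elim: l => // l IH; rewrite ltnS leq_eqVlt => /orP[/eqP kl|kl] vE.
  have [|g [cg _ g0 g1 gim]] := edge_curve_from pl (vE k _); first by lia.
  exists g; split; rewrite -?kl// => t t01; exists k; first lia.
  by rewrite -gim; exists t.
have [|g [cg g0 g1 gm]] := IH kl; first by move=> m km; apply: vE; lia.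
have [|h [ch _ h0 h1 him]] := edge_curve_from pl (vE l _); first by lia.
have [|u [cu u0 u1 um]] := curve_concat cg ch; first by rewrite g1 h0.
exists u; split; rewrite ?u0 ?u1// => t /um[s s01 [->|->]].
  by have [m km gmt] := gm s s01; exists m => //; lia.
by exists l; [lia|rewrite -him; exists s].
Qed.

Lemma hub_graph_maximal n (e : {set 'I_n}) (G' : sgraph 'I_n) : (3 <= n)%N ->
  adds_edge (hub_graph n) e G' -> ~ planar R G'.
Proof.
case: n e G' => // n e G' n3 [eN G'E] [D pl].
have eG' : e \in edges G' by rewrite G'E in_setU1 eqxx.
have /eqP/cards2P[x [y [xy exy]]] := card_edge eG'.
wlog lxy : x y xy exy / (x < y)%N.
  move=> hw; have [lxy|lyx|lxy] := ltngtP x y.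
  - exact: hw lxy.
  - by apply: hw lyx; [rewrite eq_sym|rewrite exy finset.setUC].
  - by move: xy; rewrite (val_inj lxy) eqxx.
rewrite exy hub_graph_edge /hub_adj lxy /= negb_or negb_or -!leqNgt in eN.
have [x2 xy1] : (1 < x)%N /\ (x.+1 < y)%N by lia.
have xn : (x < n.+1)%N := ltn_ord x.
have yn : (y < n.+1)%N := ltn_ord y.
pose v i : 'I_n.+1 := inord i.
have vE i : (i < n.+1)%N -> (v i : nat) = i by move=> h; rewrite /v inordK.
pose lab := k5_label x y; pose cls := k5_class x y.
have labn i : (i < 5)%N -> (lab i < n.+1)%N.
  by move=> i5; apply: leq_ltn_trans (k5_label_le x2 xy1 i5) yn.
have lab_lt i j : (i < j < 5)%N -> (lab i < lab j)%N by exact: k5_label_lt.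
have /choice[g Hg] : forall ij : nat * nat, exists g : R -> pt, (ij.1 < ij.2 < 5)%N ->
    [/\ continuous g, g 0 = vertex_pos D (v (lab ij.1)), g 1 = vertex_pos D (v (lab ij.2)) &
      forall t, t \in `[0, 1] -> exists f, [/\ f \in edges G', curve_image D f (g t) &
        forall z : 'I_n.+1, z \in f -> cls ij.1 ij.2 z]].
  move=> [i j] /=; have [ij|nij] := boolP (i < j < 5)%N; last by exists (fun=> 0).
  (* The edge from [x + 1] to [y] is replaced by the path between these labels. *)
  have [/andP[/eqP i3 /eqP j4]|nij] := boolP ((i == 3%N) && (j == 4%N)).
    subst i j; have [|m km|g [cg g0 g1 gm]] := @path_curve _ _ _ v x.+1 y pl.
    - by [].
    - rewrite G'E in_setU1 hub_graph_edge /hub_adj !vE; [|lia|lia].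
      by rewrite ltnSn eqxx orbT orbT.
    - exists g => _; split => // t /gm[m km gt]; exists [set v m; v m.+1]%SET; split => //.
        rewrite G'E in_setU1 hub_graph_edge /hub_adj !vE; [|lia|lia].
        by rewrite ltnSn eqxx orbT orbT.
      by move=> z; rewrite in_set2 => /orP[] /eqP->; rewrite /cls /k5_class vE; lia.
  have fE : [set v (lab i); v (lab j)]%SET \in edges G'.
    rewrite G'E in_setU1 exy hub_graph_edge /hub_adj !vE; try by apply: labn; lia.
    (* The edge from [x] to [y] is the added one; the remaining pairs are edges of the hub graph. *)
    have [/andP[/eqP i2 /eqP j4]|nij'] := boolP ((i == 2%N) && (j == 4%N)).
      by subst i j; rewrite /lab /k5_label /= /v !inord_val eqxx.
    rewrite (lab_lt i j ij) /=; apply/orP; right; apply/orP; left.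
    by move: ij nij nij'; rewrite /lab /k5_label; case: i j => [|[|[|[|[|i]]]]] // [|[|[|[|[|j]]]]] //=;
      rewrite ?eqxx ?orbT //; lia.
  have [h [ch _ h0 h1 him]] := edge_curve_from pl fE.
  exists h => _; split => // t t01; exists [set v (lab i); v (lab j)]%SET; split => //.
    by rewrite -him; exists t.
  move=> z; rewrite in_set2 => /orP[] /eqP->; rewrite /cls /k5_class vE; try by apply: labn; lia.
    by rewrite eqxx.
  by rewrite eqxx orbT.
apply: (@no_plane_K5 R (fun i => vertex_pos D (v (lab i))) (fun i j => g (i, j))).
- move=> i j ij; apply/eqP => /(plane_pos pl) /(congr1 val) /=.
  rewrite !vE; try by apply: labn; lia.
  by have := lab_lt i j ij; lia.
- by move=> i j ij; have [] := Hg (i, j) ij.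
- move=> i j k l s t ij kl d s01 t01; apply/eqP => E.
  have [_ _ _ /(_ s s01)[f [fG fs fc]]] := Hg (i, j) ij.
  have [_ _ _ /(_ t t01)[f' [f'G f't f'c]]] := Hg (k, l) kl.
  (* The label of a common vertex of the two edges would lie in two disjoint classes. *)
  suff [z zf zf'] : exists2 z, z \in f & z \in f'.
    exact: (k5_class_disjoint x2 xy1 ij kl d (fc z zf) (f'c z zf')).
  have [ff'|ff'] := eqVneq f f'.
    have /eqP/cards2P[z [w [_ fE]]] := card_edge fG.
    by exists z; rewrite -?ff' fE in_set2 eqxx.
  rewrite -E in f't; have [z] := curves_meet pl fG f'G ff' fs f't.
  by rewrite finset.in_setI => /andP[zf zf'] _; exists z.
Qed.

End Maximality.

(** * A straight-line drawing *)

Section StraightDrawing.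
Variable R : realType.
Local Notation pt := (R * R)%type.
Implicit Types (i j v : nat) (t s : R).

(** The path climbs the vertical axis midway between the hubs. Segments from one hub to the path
    have different slopes, and those from different hubs lie on different sides of the axis. *)
Definition hub_pos i : pt :=
  if i is i'.+2 then (0, i'.+1%:R) else if i is 1%N then (1, 0) else (-1, 0).

Definition hub_segment i j t : pt := hub_pos i + t *: (hub_pos j - hub_pos i).

Lemma hub_segmentP i j t : hub_adj i j -> t \in `[0, 1] ->
  let p := hub_segment i j t in
  [\/ [/\ i = 0%N, j = 1%N & p.2 = 0],
      exists k, [/\ i = 0%N, j = k.+2, -1 <= p.1 <= 0 & p.2 = (1 + p.1) * k.+1%:R],
      exists k, [/\ i = 1%N, j = k.+2, 0 <= p.1 <= 1 & p.2 = (1 - p.1) * k.+1%:R] |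
      exists k, [/\ i = k.+2, j = k.+3, p.1 = 0 & k.+1%:R <= p.2 <= k.+1%:R + 1]].
Proof.
move=> ij t01 p; have /andP[t0 t1] : 0 <= t <= 1 by move: t01; rewrite in_itv.
have p1 : p.1 = (hub_pos i).1 + t * ((hub_pos j).1 - (hub_pos i).1) by [].
have p2 : p.2 = (hub_pos i).2 + t * ((hub_pos j).2 - (hub_pos i).2) by [].
clearbody p; rewrite {}p1 {}p2; case: i j ij => [|[|k]] [|[|l]] //= ij.
- by constructor 1; split => //; ring.
- by constructor 2; exists l; split => //; [apply/andP; split; lra|ring].
- by constructor 3; exists l; split => //; [apply/andP; split; lra|ring].
constructor 4; exists k; have <- : k.+1 = l by move: ij; rewrite /hub_adj; lia.
split => //; first by ring.
by rewrite -[k.+2%:R]natr1; apply/andP; split; lra.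
Qed.

Lemma hub_pos_inj : injective hub_pos.
Proof.
move=> [|[|k]] [|[|l]] //= e; have e1 := congr1 fst e; have e2 := congr1 snd e;
  clear e; rewrite /= in e1 e2; try by exfalso; lra.
by move/eqP: e2; rewrite eqr_nat => /eqP ->.
Qed.

Lemma hub_segment_vertex i j t v : hub_adj i j -> t \in `[0, 1] ->
  hub_segment i j t = hub_pos v -> v = i \/ v = j.
Proof.
move=> ij t01 e; have := hub_segmentP ij t01; rewrite e.
case=> [[-> -> h]|[k [-> -> h1 h2]]|[k [-> -> h1 h2]]|[k [-> -> h1 h2]]].
- case: v h {e} => [|[|v]] /= h; [by left|by right|].
  by have := ltr0Sn R v; rewrite h ltxx.
- case: v h1 h2 {e} => [|[|v]] /= h1 h2; [by left|exfalso; lra|right].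
  by move: h2; rewrite addr0 mul1r => /eqP; rewrite eqr_nat => /eqP ->.
- case: v h1 h2 {e} => [|[|v]] /= h1 h2; [exfalso; lra|by left|right].
  by move: h2; rewrite subr0 mul1r => /eqP; rewrite eqr_nat => /eqP ->.
- case: v h1 h2 {e} => [|[|v]] /= h1 h2; [exfalso; lra|exfalso; lra|].
  move: h2; rewrite natr1 !ler_nat; lia.
Qed.

Lemma hub_segment_meet i j i' j' t t' : hub_adj i j -> hub_adj i' j' ->
  (i, j) <> (i', j') -> t \in `[0, 1] -> t' \in `[0, 1] ->
  hub_segment i j t = hub_segment i' j' t' ->
  exists v, [/\ v = i \/ v = j, v = i' \/ v = j' & hub_segment i j t = hub_pos v].
Proof.
wlog ii' : i j i' j' t t' / (i <= i')%N.
  move=> hw ij ij' ne t01 t01' e; have [ii'|i'i] := leqP i i'; first exact: hw e.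
  have [||v [h1 h2 h3]] := hw i' j' i j t' t _ ij' ij _ t01' t01 (esym e); first exact: ltnW.
    by move=> h; apply: ne.
  by exists v; split => //; rewrite e.
move=> ij ij' ne t01 t01' e.
have P := hub_segmentP ij t01; have := hub_segmentP ij' t01'; rewrite -e {e}.
set p := hub_segment i j t in P *; clearbody p.
have pE v : p.1 = (hub_pos v).1 -> p.2 = (hub_pos v).2 -> p = hub_pos v by exact: pair_ext.
have nat_between k l : (k.+1%:R : R) <= l.+1%:R <= k.+1%:R + 1 -> l = k \/ l = k.+1.
  by rewrite natr1 !ler_nat; lia.
case: P => [[iE jE h]|[k [iE jE h1 h2]]|[k [iE jE h1 h2]]|[k [iE jE h1 h2]]];
  case=> [[iE' jE' h']|[k' [iE' jE' h1' h2']]|[k' [iE' jE' h1' h2']]|[k' [iE' jE' h1' h2']]];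
  subst i j i' j' => //; clear ij ij' t01 t01'.
- exists 0%N; split; [by left|by left|]; apply: pE => //=.
  have := ltr0Sn R k'; move: h2'; rewrite h => /esym/eqP; rewrite mulf_eq0 => /orP[/eqP|/eqP ->]; last by rewrite ltxx.
  by lra.
- exists 1%N; split; [by right|by left|]; apply: pE => //=.
  have := ltr0Sn R k'; move: h2'; rewrite h => /esym/eqP; rewrite mulf_eq0 => /orP[/eqP|/eqP ->]; last by rewrite ltxx.
  by lra.
- by exfalso; have := ltr0Sn R k'; lra.
- exists 0%N; split; [by left|by left|]; apply: pE => //=.
  have := ltr0Sn R k; move: h2; rewrite h' => /esym/eqP; rewrite mulf_eq0 => /orP[/eqP|/eqP ->]; last by rewrite ltxx.
  by lra.
- exists 0%N; split; [by left|by left|].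
  have p1 : 1 + p.1 = 0.
    apply/eqP; apply: contra_notT ne => p1.
    by move: h2'; rewrite h2 => /(mulfI p1) /eqP; rewrite eqr_nat => /eqP ->.
  by apply: pE => /=; [lra|rewrite h2 p1 mul0r].
- have p1 : p.1 = 0 by lra.
  exists k.+2; split; [by right| |].
    by right; move: h2'; rewrite h2 p1 addr0 subr0 !mul1r => /eqP; rewrite eqr_nat => /eqP ->.
  by apply: pE => //=; rewrite h2 p1 addr0 mul1r.
- have hk : p.2 = k.+1%:R by rewrite h2 h1' addr0 mul1r.
  exists k.+2; split; [by right| |exact: pE].
  by rewrite hk in h2'; case: (nat_between _ _ _ h2') => ->; [left|right].
- exists 1%N; split; [by left|by left|].
  have p1 : 1 - p.1 = 0.
    apply/eqP; apply: contra_notT ne => p1.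
    by move: h2'; rewrite h2 => /(mulfI p1) /eqP; rewrite eqr_nat => /eqP ->.
  by apply: pE => /=; [lra|rewrite h2 p1 mul0r].
- have hk : p.2 = k.+1%:R by rewrite h2 h1' subr0 mul1r.
  exists k.+2; split; [by right| |exact: pE].
  by rewrite hk in h2'; case: (nat_between _ _ _ h2') => ->; [left|right].
- have kk' : k != k' by apply/eqP => kk'; apply: ne; rewrite kk'.
  have {ne kk'}k1 : k' = k.+1.
    have h : (k'.+1 <= k.+2)%N by rewrite -(ler_nat R) -[k.+2%:R]natr1; lra.

    by move: kk' ii'; lia.
  exists k.+3; split; [by right|by left; rewrite k1|].
  by apply: pE => //=; rewrite k1 in h2'; move: h2 h2'; rewrite -[k.+2%:R]natr1; lra.
Qed.

End StraightDrawing.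

(** * Planarity and number of edges of the hub graph *)

Section HubGraphPlanar.
Variables (R : realType) (n : nat).
Local Notation pt := (R * R)%type.

Lemma hub_graph_planar : planar R (hub_graph n).
Proof.
have /choice[ij Hij] : forall e : {set 'I_n}, exists ij : option ('I_n * 'I_n),
    e \in edges (hub_graph n) -> exists i j, [/\ ij = Some (i, j), e = [set i; j]%SET & hub_adj i j].
  move=> e; have [/hub_edgesP[i [j [eE hij]]]|eN] := boolP (e \in edges (hub_graph n)).
    by exists (Some (i, j)) => _; exists i, j.
  by exists None.
pose D : drawing R 'I_n := Drawing (fun i : 'I_n => @hub_pos R i)
  (fun e => if ij e is Some (i, j) then @hub_segment R i j else fun=> 0).
have eP e : e \in edges (hub_graph n) -> exists i j : 'I_n,
    [/\ e = [set i; j]%SET, hub_adj i j & edge_curve D e = @hub_segment R i j].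
  by move=> /Hij[i [j [ijE eE hij]]]; exists i, j; rewrite /D /= ijE.
have pos_inj : injective (vertex_pos D) by move=> i j /hub_pos_inj /val_inj.
exists D; split => //.
- move=> e /eP[i [j [_ _ ->]]]; apply: continuous_subspaceT => t.
  apply: cvgD; first exact: cvg_cst.
  by apply: cvgZ; [exact: cvg_id|exact: cvg_cst].
- move=> e /eP[i [j [_ /andP[ij' _] ->]]] t s _ _ /addrI; move/eqP; rewrite -subr_eq0 -scalerBl scaler_eq0 subr_eq0.
  move=> /orP[/eqP//|]; rewrite subr_eq0 => /eqP /hub_pos_inj ji.
  by rewrite ji ltnn in ij'.
- move=> e /eP[i [j [eE _ ->]]]; rewrite /hub_segment scale0r addr0 scale1r subrKC eE.
  apply/seteqP; split=> x.
    by case=> ->; [exists i|exists j]; rewrite //= in_set2 eqxx ?orbT.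
  by move=> [y /=]; rewrite in_set2 => /orP[/eqP->|/eqP->] <-; [left|right].
- move=> e v /eP[i [j [-> hij cE]]]; rewrite /curve_image cE => -[t t01 tv].
  have [vi|vj] := hub_segment_vertex hij t01 tv; rewrite in_set2.
    by rewrite (val_inj vi) eqxx.
  by rewrite (val_inj vj) eqxx orbT.
- move=> e f eH fH ef x []; have [i [j [eE hij ec]]] := eP e eH; have [k [l [fE hkl fc]]] := eP f fH.
  rewrite /curve_image ec fc => -[t t01 <-] [s s01 E].
  have ne : (nat_of_ord i, nat_of_ord j) <> (nat_of_ord k, nat_of_ord l).
    by case=> /val_inj ik /val_inj jl; move: ef; rewrite eE fE ik jl eqxx.
  have [v [vij vkl ->]] := hub_segment_meet hij hkl ne t01 s01 (esym E).
  have vn : (v < n)%N by case: vij => ->; exact: ltn_ord.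
  exists (Ordinal vn) => //=; rewrite finset.in_setI eE fE !in_set2.
  by apply/andP; split; [case: vij => vE|case: vkl => vE]; apply/orP; [left|right|left|right];
    apply/eqP/val_inj.
Qed.

Lemma num_edges_hub_graph : (3 <= n)%N -> (num_edges (hub_graph n) <= 3 * n - 6)%N.
Proof.
move=> n3; pose S := [set p : 'I_n * 'I_n | hub_adj p.1 p.2]%SET.
have : (num_edges (hub_graph n) <= #|S|)%N.
  apply: leq_trans (leq_imset_card (fun p : 'I_n * 'I_n => [set p.1; p.2]%SET) S).
  apply/subset_leq_card/fintype.subsetP => e /hub_edgesP[i [j [-> hij]]].
  by apply/imsetP; exists (i, j); rewrite ?inE.
move=> /leq_trans; apply.
(* The lower neighbours of [j]: none, one, two, and then always three, in all
   [0 + 1 + 2 + 3 (n - 3)]. *)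
pose L j := match j with 0 => [::] | 1 => [:: 0] | 2 => [:: 0; 1] | j'.+1 => [:: 0; 1; j'] end%N.
have -> : #|S| = (\sum_(j < n) \sum_(i < n | hub_adj i j) 1)%N.
  rewrite -sum1_card [RHS](exchange_big_dep predT)//= pair_big_dep /=.
  by apply: eq_bigl => p; rewrite inE.
have le_j (j : 'I_n) : (\sum_(i < n | hub_adj i j) 1 <= size (L j))%N.
  rewrite sum1dep_card cardsE cardE -(size_map val); apply: uniq_leq_size.
    by rewrite (map_inj_uniq val_inj) enum_uniq.
  move=> _ /mapP[i + ->]; rewrite mem_enum /in_mem /= /hub_adj.
  case: (j : nat) => [|[|[|k]]] /=; rewrite ?inE /=; lia.
apply: (@leq_trans (\sum_(j < n) size (L j))%N); first by apply: leq_sum => j _; exact: le_j.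
have -> : (\sum_(j < n) size (L j) = 3 * n - 6)%N; last by [].
case: n n3 => [|[|[|m]]] // _.
elim: m => [|m IH]; first by rewrite !big_ord_recr big_ord0.
by rewrite big_ord_recr IH /=; lia.
Qed.

Lemma num_edges_hub_graph_gt0 : (3 <= n)%N -> (0 < num_edges (hub_graph n))%N.
Proof.
case: n => [|[|m]] // _; apply/card_gt0P; exists [set inord 0; inord 1]%SET.
by rewrite hub_graph_edge /hub_adj !inordK.
Qed.

End HubGraphPlanar.

(** * Attainment of the minimum ratio and the final estimate *)

Lemma iso_to_subgraph_num_edges (W V : finType) (H : sgraph W) (G : sgraph V) :
  iso_to_subgraph H G -> (num_edges H <= num_edges G)%N.
Proof.
move=> [f [f_inj fH]]; rewrite /num_edges -(card_imset (edges H) (imset_inj f_inj)).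
by apply/subset_leq_card/fintype.subsetP => _ /imsetP[e eH ->]; exact: fH.
Qed.

(** The default value 0 of [set_min] has to be excluded. The ratios are ordered by a natural number
    of edges, and there is at least one: a plane drawing of [G] itself is saturated, since a graph
    with more edges does not embed in [G]. *)
Lemma psr_attained (R : realType) (V : finType) (G : sgraph V) : planar R G ->
  saturation_ratios G (psr R G).
Proof.
move=> [D pl].
pose P k := `[< exists (W : finType) (H : sgraph W) (D : drawing R W),
  plane_saturated H D G /\ num_edges H = k >].
have exP : exists k, P k.
  exists (num_edges G); apply/asboolP; exists V, G, D; split => //; split => //.
    by exists id; split => // e; rewrite imset_id.
  move=> e G' D' [eN G'E] _ _ /iso_to_subgraph_num_edges.
  by rewrite /num_edges G'E cardsU1 eN ltnn.
have [k /asboolP[W [H [D' [satH HE]]]] kmin] := ex_minnP exP.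
rewrite /psr /set_min; have [|+ _ //] := @xgetPex _ (0 : R) [set r | saturation_ratios G r /\ lbound (saturation_ratios G) r].
exists ((num_edges H)%:R / (num_edges G)%:R); split; first by exists W, H, D'.
move=> _ [W' [H' [D'' [satH' ->]]]]; rewrite ler_wpM2r ?invr_ge0// ler_nat HE.
by apply: kmin; apply/asboolP; exists W', H', D''.
Qed.

Theorem theorem4 (R : realType) (n : nat) (hn : (3 <= n)%N) :
  exists G : sgraph 'I_n,
    [/\ maximal_planar R G,
        psr R G >= (3 / 2 * n%:R - 3) / (3 * n%:R - 6) &
        (3 / 2 * n%:R - 3) / (3 * n%:R - 6) = 1 / 2 :> R].
Proof.
have n3 : 3 <= n%:R :> R by rewrite ler_nat.
have half : (3 / 2 * n%:R - 3) / (3 * n%:R - 6) = 1 / 2 :> R.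
  have n0 : 3 * n%:R - 6 != 0 :> R by rewrite gt_eqF//; lra.
  by apply: (mulIf n0); rewrite mulfVK//; lra.
have pl := hub_graph_planar R n.
exists (hub_graph n); split => //.
  by split=> // e G'; exact: hub_graph_maximal.
have [W [H [D [[plH cardW [f [f_inj f_hom]] sat] ->]]]] := psr_attained pl.
rewrite half ler_pdivlMr ?ltr0n ?num_edges_hub_graph_gt0//.
have := saturated_edge_bound plH _ f_inj f_hom sat hn; rewrite cardW card_ord => /(_ erefl) h1.
have := num_edges_hub_graph hn => h2.
(* [e(G) <= 3 n - 6 = 3 (n - 2) <= 2 e(H)]. *)
have : (num_edges (hub_graph n))%:R <= (2 * num_edges H)%:R :> R by rewrite ler_nat; lia.
by rewrite natrM; lra.
Qed.
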